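(* Let $\mathcal X$ be a Banach space and $A:\mathcal X\to\mathcal X$ a bounded linear operator of positive type that is one-to-one and has unbounded inverse. Let $(R_\alpha)_{\alpha>0}$ be a family of regularization operators for $A$ with saturation $p_0\in(1,\infty]$ (in the sense of the context), such that for each $u\in\mathcal X$ the map $\alpha\mapsto S_\alpha u$ is continuous on $(0,\infty)$, where $S_\alpha=I-R_\alpha A$. Let $f\in\mathcal R(A)$, let $u^\dagger\in\mathcal X$ satisfy $Au^\dagger=f$, let $\overline u\in\mathcal X$, and assume that $$\overline u-u^\dagger=A^pv\quad\text{for some }v\in\mathcal D((\log A)^\nu),$$ for some real number $0\le p<p_0-1$ and some integer $\nu\ge1$. Let $0<\delta_0<1$, and fix constants $b_1\ge b_0>e_0$ for the discrepancy principle described in the context. Then there exist finite constants $c,c'>0$, independent of $\delta$ (they may depend on the source element associated with $\overline u-u^\dagger$), such that for any $0<\delta\le\delta_0$, any $f^\delta\in\mathcal X$ with $\|f-f^\delta\|\le\delta$, and any parameter $\alpha_\delta\in(0,\infty]$ chosen according to the discrepancy principle, we have $$\|u_{\alpha_\delta}^\delta-u^\dagger\|\le c\,\delta^{\frac p{p+1}}\bigl(\log\tfrac1\delta\bigr)^{-\frac{\nu}{p+1}},\qquad \alpha_\delta\ge c'\,\delta^{\frac1{p+1}}\bigl(\log\tfrac1\delta\bigr)^{\frac{\nu}{p+1}}.$$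
   Context: Positive type: a bounded linear operator $A:\mathcal X\to\mathcal X$ is of positive type if for every $\alpha>0$ the operator $A+\alpha I:\mathcal X\to\mathcal X$ is one-to-one and onto, and $\|(A+\alpha I)^{-1}\|\le\kappa_*/\alpha$ for all $\alpha>0$, with a finite constant $\kappa_*>0$. $\mathcal R(A)$ denotes the range of $A$, which need not be dense in $\mathcal X$. Fractional powers: for $0<p<1$, $A^p u=\frac{\sin\pi p}{\pi}\int_0^\infty s^{p-1}(A+sI)^{-1}Au\,ds$ for $u\in\mathcal X$ (improper Bochner integral); for arbitrary $p>0$, $A^p=A^{p-\lfloor p\rfloor}A^{\lfloor p\rfloor}$, with $A^0=I$. The operators $A^p$, $p\ge0$, form a $C_0$-semigroup on $\overline{\mathcal R(A)}$. Logarithm: $\log A$ is the infinitesimal generator of the $C_0$-semigroup $(A^p)_{p\ge0}$ on $\overline{\mathcal R(A)}$, i.e. $(\log A)u=\lim_{p\downarrow0}\frac1p(A^pu-u)$, with $\mathcal D(\log A)=\{u\in\mathcal X:\lim_{p\downarrow0}\frac1p(A^pu-u)\text{ exists}\}\subset\overline{\mathcal R(A)}$. $(\log A)^\nu$ is its $\nu$-fold composition with the natural domain $\mathcal D((\log A)^\nu)$. For real $x>0$, $\log x$ is the natural logarithm. The source element associated with $\overline u-u^\dagger=A^pv$ is $w=(\lambda I-\log A)^\nu v$, where $\lambda>\log\|A\|$ is arbitrary but fixed. Regularization operators with saturation $p_0\in(0,\infty]$: bounded linear operators $R_\alpha:\mathcal X\to\mathcal X$, $\alpha>0$, with $S_\alpha:=I-R_\alpha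 A$, such that for all $\alpha>0$: (i) $\|R_\alpha\|\le e_*/\alpha$; (ii) $\|S_\alpha A^p\|\le e_p\,\alpha^p$ for all $0\le p\le p_0$ (for all $0\le p<\infty$ if $p_0=\infty$); (iii) $R_\alpha A=AR_\alpha$. Here $e_*$ and $e_p$ are finite constants (independent of $\alpha$), and $p\mapsto e_p$ is bounded on bounded intervals. In particular $e_0$ is the constant with $\|S_\alpha\|\le e_0$ for all $\alpha>0$. Regularizing elements: $u_\alpha^\delta=\overline u-R_\alpha(A\overline u-f^\delta)$ for $0<\alpha<\infty$, and $u_\infty^\delta=\overline u$ (i.e. $R_\infty=0$). Defect: $r_\alpha^\delta=Au_\alpha^\delta-f^\delta$. Discrepancy principle (with fixed constants $b_1\ge b_0>e_0$): (a) if $\|A\overline u-f^\delta\|\le b_1\delta$, set $\alpha_\delta=\infty$; (b) otherwise, i.e. if $\|A\overline u-f^\delta\|>b_1\delta$, choose $0<\alpha_\delta<\infty$ such that $b_0\delta\le\|r_{\alpha_\delta}^\delta\|\le b_1\delta$. *)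

(* Defs.v *)
From Stdlib Require Import Reals FinFun.
From Coquelicot Require Import Coquelicot.
Open Scope R_scope.

(** A Banach space is a [CompleteNormedModule R_AbsRing].  Complex Banach
    spaces are covered by restriction of scalars: only real scalars occur in
    the notions below, and restriction changes neither norms nor operators.
    Coquelicot's [is_linear] already includes boundedness. *)

Section Operators.

Context {X : CompleteNormedModule R_AbsRing}.
Implicit Types (A T : X -> X) (u v w : X).

Definition opnorm T : Rbar :=
  Lub_Rbar (fun r => exists u, norm u <= 1 /\ r = norm (T u)).

Definition shift A (s : R) : X -> X := fun u => plus (A u) (scal s u).

(** [iota P] is the unique element satisfying [P], so [resolvent A s] is
    (A + s I)^-1 whenever [shift A s] is bijective. *)
Definition resolvent A (s : R) : X -> X :=
  fun y => iota (fun u => shift A s u = y).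

Definition positive_type A : Prop :=
  is_linear A /\
  exists kappa : R, 0 < kappa /\
    forall a : R, 0 < a ->
      Injective (shift A a) /\ Surjective (shift A a) /\
      Rbar_le (opnorm (resolvent A a)) (kappa / a).

(** The inverse A^-1 : R(A) -> X of an injective [A] is not bounded. *)
Definition unbounded_inverse A : Prop :=
  ~ exists C : R, forall y u : X, A u = y -> norm u <= C * norm y.

(** Fractional power for 0 < q < 1.  For [A] of positive type the integrand is
    norm continuous on (0, oo), so on compact subintervals its Bochner and
    Riemann integrals coincide; the endpoints 0 and oo are improper. *)
Definition frac_pow01 A (q : R) : X -> X := fun u =>
  scal (sin (PI * q) / PI)
    (RInt_gen (fun s => scal (Rpower s (q - 1)) (resolvent A s (A u)))
       (at_right 0) (Rbar_locally p_infty)).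

(** A^p = A^(p - floor p) A^(floor p), meaningful for p >= 0 only;
    [Int_part] is the floor function and [frac_part p = p - floor p]. *)
Definition frac_pow A (p : R) : X -> X := fun u =>
  let u' := Nat.iter (Z.to_nat (Int_part p)) A u in
  if Req_EM_T (frac_part p) 0 then u' else frac_pow01 A (frac_part p) u'.

(** Graph of log A: [u] is in the domain and (log A) u = [w]. *)
Definition is_log A u w : Prop :=
  filterlim (fun p => scal (/ p) (minus (frac_pow A p u) u))
    (at_right 0) (locally w).

(** Graph of the [n]-fold composition (log A)^n, with its natural domain. *)
Fixpoint is_log_iter A (n : nat) u w : Prop :=
  match n with
  | O => w = u
  | S n => exists v, is_log_iter A n u v /\ is_log A v w
  end.

Definition dom_log_iter A (n : nat) u : Prop := exists w, is_log_iter A n u w.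

Definition residual A (Reg : R -> X -> X) (a : R) : X -> X :=
  fun u => minus u (Reg a (A u)).

(** [Reg a] is R_a and [e p] is the constant e_p; [e] matters only on
    [0, p0] (on [0, oo) if [p0] is infinite). *)
Record regularization A (Reg : R -> X -> X) (e : R -> R) (p0 : Rbar) : Prop := {
  reg_linear : forall a, 0 < a -> is_linear (Reg a);
  reg_bound : exists estar : R,
    forall a, 0 < a -> Rbar_le (opnorm (Reg a)) (estar / a);
  reg_saturation : forall a p, 0 < a -> 0 <= p -> Rbar_le p p0 ->
    Rbar_le (opnorm (fun u => residual A Reg a (frac_pow A p u)))
      (e p * Rpower a p);
  reg_const_bounded : forall b : R, exists M : R,
    forall p, 0 <= p <= b -> Rbar_le p p0 -> Rabs (e p) <= M;
  reg_commute : forall a u, 0 < a -> Reg a (A u) = A (Reg a u)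
}.

(** Regularizing element for a parameter in (0, oo], with R_oo = 0. *)
Definition reg_element A (Reg : R -> X -> X) (ubar fd : X) (alpha : Rbar) : X :=
  match alpha with
  | Finite a => minus ubar (Reg a (minus (A ubar) fd))
  | _ => ubar
  end.

Definition defect A (Reg : R -> X -> X) (ubar fd : X) (alpha : Rbar) : X :=
  minus (A (reg_element A Reg ubar fd alpha)) fd.

(** [alpha] is an admissible choice of the discrepancy principle. *)
Definition discrepancy A (Reg : R -> X -> X) (b0 b1 : R) (ubar fd : X)
    (delta : R) (alpha : Rbar) : Prop :=
  (norm (minus (A ubar) fd) <= b1 * delta -> alpha = p_infty) /\
  (norm (minus (A ubar) fd) > b1 * delta ->
    Rbar_lt 0 alpha /\ Rbar_lt alpha p_infty /\
    b0 * delta <= norm (defect A Reg ubar fd alpha) <= b1 * delta).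

End Operators.

(* Main.v *)
Require Import Defs.
From Stdlib Require Import Reals FinFun Znat Lra Lia List.
From Coquelicot Require Import Coquelicot.
Open Scope R_scope.

(** Proof idea.  Put [S_a = I - R_a A], [L = ln (1/a)].  For [x] in the domain
    of [(log A)^n] one has [|S_a A^q x| = O(a^q L^(-n))] as long as [q < p0]:
    since [d/dt A^t x = A^t (log A) x], the vector [S_a A^q x] differs from
    [S_a A^(q+h) x = O(a^(q+h))] by the integral over [0 <= t <= h] of
    [S_a A^(q+t) (log A) x], which by induction on [n] is at most the integral
    of [a^(q+t) L^(-(n-1))], and each integration of [a^t] gains a factor [1/L].
    With [q = p+1] this turns [(b0 - e_0) delta <= |S_a A^(p+1) v|] into the
    lower bound for the parameter, which also controls the noise term.  The
    remaining term is [S_a A^p v = A^p x] with [x = S_a v] and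
    [|A^(p+1) x| = O(delta)]; writing [A^p x = S_b A^p x + R_b A^(p+1) x] with
    [b^(p+1) = delta (ln (1/delta))^nu], up to a constant, gives the rate.

    The semigroup law for [A^t] avoids double integrals: the operators
    [(A + e I)^k] solve the linear equation [T' = k (A + e I)^(-1) T] in [e],
    so a product of them whose exponents add up to [0] is constant in [e] and
    is found from its limit as [e] tends to infinity; then [e] tends to [0]. *)

(** * Vectors and improper integrals *)

(** The generator is only given through the one-sided limit [is_log] at a fixed vector, so the
    integral over [t] is never formed: [decay_step] telescopes over equal small steps, and the
    semigroup law carries the limit at exponent 0 to every intermediate exponent. Exponents with sum
    below 1 suffice for this, because the integer part of [q] stays a fixed power of [A]. The strict
    inequality [q < p0] supplies the room to the right of [q] that telescoping requires. The law has
    to hold exactly, while the integral defining a power carries a sine factor. Normalizing the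
    integral by its scalar value [beta q] makes the law exact without evaluating [beta]; the price
    is explicit bounds on [beta] near 0 and away from 1. The range of [A] need not be dense, so
    [e R_e] need not tend to 0 at every vector as [e] tends to 0. The passage to the limit therefore
    estimates each error by an explicit power of [e], using that the vectors involved have the form
    [A z]. Decay is applied not only to [v] but also to [S_a v], with constants independent of [a];
    this is why one bound on the whole chain of logarithms is carried along. *)

Section LinearCombinations.

Context {V : NormedModule R_AbsRing}.

(** Reflection: a vector expression is mapped to its coefficient function, so an identity in the
    module becomes one real identity per atom, within reach of [ring] and [field]. *)
Inductive lexp :=
| LAtom (n : nat) | LZero | LPlus (a b : lexp) | LOpp (a : lexp)
| LMinus (a b : lexp) | LScal (r : R) (a : lexp).

Fixpoint leval (env : list V) (e : lexp) : V :=
  match e with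
  | LAtom n => nth n env zero
  | LZero => zero
  | LPlus a b => plus (leval env a) (leval env b)
  | LOpp a => opp (leval env a)
  | LMinus a b => minus (leval env a) (leval env b)
  | LScal r a => scal r (leval env a)
  end.

Fixpoint lcoef (e : lexp) (k : nat) : R :=
  match e with
  | LAtom n => if Nat.eqb n k then 1 else 0
  | LZero => 0
  | LPlus a b => lcoef a k + lcoef b k
  | LOpp a => - lcoef a k
  | LMinus a b => lcoef a k - lcoef b k
  | LScal r a => r * lcoef a k
  end.

Fixpoint lcomb (c : nat -> R) (env : list V) : V :=
  match env with
  | nil => zero
  | x :: t => plus (scal (c O) x) (lcomb (fun k => c (S k)) t)
  end.

Lemma lcomb_ext c d env :
  (forall k, (k < length env)%nat -> c k = d k) -> lcomb c env = lcomb d env.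
Proof.
revert c d; induction env as [|x t IH]; intros c d H; simpl; trivial.
rewrite (H O) by (simpl; lia). f_equal. apply IH; intros k Hk; apply H; simpl; lia.
Qed.

Lemma lcomb_zero env : lcomb (fun _ => 0) env = zero.
Proof.
induction env as [|x t IH]; simpl; trivial.
rewrite IH, plus_zero_r. exact (scal_zero_l x).
Qed.

Lemma lcomb_plus c d env :
  lcomb (fun k => c k + d k) env = plus (lcomb c env) (lcomb d env).
Proof.
revert c d; induction env as [|x t IH]; intros c d; simpl.
- now rewrite plus_zero_r.
- rewrite (IH (fun k => c (S k)) (fun k => d (S k))).
  rewrite (scal_distr_r (K := R_AbsRing) (c O) (d O) x
           : scal (c O + d O) x = plus (scal (c O) x) (scal (d O) x)).
  rewrite <- !plus_assoc. f_equal.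
  rewrite !plus_assoc. f_equal. apply plus_comm.
Qed.

Lemma lcomb_scal r c env : lcomb (fun k => r * c k) env = scal r (lcomb c env).
Proof.
revert c; induction env as [|x t IH]; intros c; simpl.
- symmetry; apply (@scal_zero_r R_AbsRing).
- rewrite (IH (fun k => c (S k))), scal_distr_l. f_equal.
  symmetry; apply (@scal_assoc R_AbsRing).
Qed.

Lemma lcomb_opp c env : lcomb (fun k => - c k) env = opp (lcomb c env).
Proof.
transitivity (scal (-1) (lcomb c env)).
- rewrite <- lcomb_scal. apply lcomb_ext; intros; ring.
- exact (scal_opp_one (K := R_AbsRing) (lcomb c env)).
Qed.

Lemma leval_lcomb env e : leval env e = lcomb (lcoef e) env.
Proof.
induction e as [n| |a IHa b IHb|a IHa|a IHa b IHb|r a IHa]; simpl.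
- revert n; induction env as [|x t IH]; intros n; simpl.
  + now destruct n.
  + destruct n as [|n]; simpl.
    * rewrite lcomb_zero, plus_zero_r. symmetry. exact (scal_one x).
    * rewrite (IH n). rewrite (scal_zero_l (K := R_AbsRing) x : scal 0 x = zero).
      now rewrite plus_zero_l.
- now rewrite lcomb_zero.
- now rewrite IHa, IHb, lcomb_plus.
- now rewrite IHa, lcomb_opp.
- unfold minus, Rminus. now rewrite IHa, IHb, lcomb_plus, lcomb_opp.
- now rewrite IHa, lcomb_scal.
Qed.

(** A recursive conjunction rather than a bounded quantifier, so that [lazy] unfolds it into
    finitely many real equations once the environment is concrete. *)
Fixpoint lsame (a b : lexp) (n : nat) : Prop :=
  match n with
  | O => True
  | S m => lcoef a m = lcoef b m /\ lsame a b m
  end.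

Lemma lsame_eq env a b : lsame a b (length env) -> leval env a = leval env b.
Proof.
intros H. rewrite !leval_lcomb. apply lcomb_ext.
revert H. generalize (length env) as n. induction n as [|n IH]; simpl; intros H k Hk.
- lia.
- destruct H as [H1 H2]. destruct (Nat.eq_dec k n) as [->|Hn]; trivial.
  apply IH; trivial; lia.
Qed.

End LinearCombinations.

Ltac lin_insert x env :=
  let rec go l := match l with
    | nil => constr:(x :: env)
    | x :: _ => env
    | _ :: ?t => go t
  end in go env.

Ltac lin_atoms e env :=
  match e with
  | plus ?a ?b => let env := lin_atoms a env in lin_atoms b env
  | minus ?a ?b => let env := lin_atoms a env in lin_atoms b env
  | opp ?a => lin_atoms a env
  | scal _ ?a => lin_atoms a env
  | zero => env
  | _ => lin_insert e env
  end.

Ltac lin_index x env :=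
  match env with
  | x :: _ => constr:(O)
  | _ :: ?t => let n := lin_index x t in constr:(S n)
  end.

Ltac lin_quote e env :=
  match e with
  | plus ?a ?b =>
      let a := lin_quote a env in let b := lin_quote b env in constr:(LPlus a b)
  | minus ?a ?b =>
      let a := lin_quote a env in let b := lin_quote b env in constr:(LMinus a b)
  | opp ?a => let a := lin_quote a env in constr:(LOpp a)
  | scal ?r ?a => let a := lin_quote a env in constr:(LScal r a)
  | zero => constr:(LZero)
  | _ => let n := lin_index e env in constr:(LAtom n)
  end.

Ltac lin_reduce :=
  lazymatch goal with
  | |- @eq ?T ?a ?b =>
      let env := lin_atoms a (@nil T) in
      let env := lin_atoms b env in
      let qa := lin_quote a env in
      let qb := lin_quote b env in
      refine (lsame_eq env qa qb _);
      lazy [lsame lcoef length Nat.eqb]; repeat apply conj; try exact I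
  end.

(* Proves an equality of linear combinations by comparing the coefficient of each atom. *)
Ltac lin := lin_reduce; try ring; try (field; repeat split; lra).


Section Norms.

Context {V : CompleteNormedModule R_AbsRing}.
Implicit Types x y z : V.

Lemma norm_scal_le (a : R) x : norm (scal a x) <= Rabs a * norm x.
Proof. exact (norm_scal a x). Qed.

(** The reverse inequality is the first one applied to [scal (/ a) (scal a x)]. *)
Lemma norm_scal_eq (a : R) x : norm (scal a x) = Rabs a * norm x.
Proof.
destruct (Req_dec a 0) as [->|Ha].
- rewrite Rabs_R0, Rmult_0_l.
  replace (scal 0 x) with (zero : V) by (symmetry; exact (scal_zero_l x)).
  exact norm_zero.
- apply Rle_antisym; [apply norm_scal_le|].
  replace x with (scal (/ a) (scal a x)) at 1 by (lin_reduce; field; trivial).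
  eapply Rle_trans.
  + apply Rmult_le_compat_l; [apply Rabs_pos|apply norm_scal_le].
  + rewrite <- Rmult_assoc, <- Rabs_mult, Rinv_r, Rabs_R1 by trivial. lra.
Qed.

Lemma norm_plus_le x y : norm (plus x y) <= norm x + norm y.
Proof. exact (norm_triangle x y). Qed.

Lemma norm_minus_le x y : norm (minus x y) <= norm x + norm y.
Proof.
replace (norm y) with (norm (opp y)) by exact (norm_opp y). apply norm_plus_le.
Qed.

Lemma norm_minus_zero x : norm (minus x zero) = norm x.
Proof. f_equal. lin. Qed.

Lemma norm_minus_sym x y : norm (minus x y) = norm (minus y x).
Proof.
transitivity (norm (opp (minus x y))); [symmetry; exact (norm_opp _)|]. f_equal. lin.
Qed.

Lemma norm_le_minus x y : norm x <= norm y + norm (minus x y).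
Proof.
replace x with (plus y (minus x y)) at 1 by lin. apply norm_plus_le.
Qed.

Lemma norm_minus_trans y x z : norm (minus x z) <= norm (minus x y) + norm (minus y z).
Proof.
replace (minus x z) with (plus (minus x y) (minus y z)) by lin. apply norm_plus_le.
Qed.

Lemma norm_le_epsilon x : (forall eps, 0 < eps -> norm x <= eps) -> x = zero.
Proof.
intros H. apply (norm_eq_zero (V := V)). apply Rle_antisym; [|exact (norm_ge_0 x)].
apply le_epsilon; intros eps He. rewrite Rplus_0_l. auto.
Qed.

Lemma minus_eq_zero_eq x y : minus x y = zero -> x = y.
Proof.
intros H. transitivity (plus (minus x y) y); [lin|]. rewrite H. lin.
Qed.

Lemma is_derive_intro (f : R -> V) (x : R) (l : V) :
  (forall eps, 0 < eps -> exists d, 0 < d /\ forall y : R, Rabs (y - x) < d ->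
     norm (minus (minus (f y) (f x)) (scal (y - x) l)) <= eps * Rabs (y - x)) ->
  is_derive f x l.
Proof.
intros H. split; [apply is_linear_scal_l|].
intros x' Hx'. assert (x = x') as <-.
{ exact (is_filter_lim_locally_unique x x' Hx'). }
intros eps. destruct (H eps (cond_pos eps)) as [d [Hd1 Hd2]].
exists (mkposreal d Hd1). intros y Hy. apply Hd2. exact Hy.
Qed.

Lemma is_derive_elim (f : R -> V) (x : R) (l : V) :
  is_derive f x l ->
  forall eps, 0 < eps -> exists d, 0 < d /\ forall y : R, Rabs (y - x) < d ->
     norm (minus (minus (f y) (f x)) (scal (y - x) l)) <= eps * Rabs (y - x).
Proof.
intros [_ H] eps He.
destruct (H x (fun P HP => HP) (mkposreal eps He)) as [d Hd].
exists d. split; [apply cond_pos|]. intros y Hy. apply Hd. exact Hy.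
Qed.

Lemma continuous_intro (f : R -> V) (x : R) :
  (forall eps, 0 < eps -> exists d, 0 < d /\ forall y : R, Rabs (y - x) < d ->
     norm (minus (f y) (f x)) <= eps) ->
  continuous f x.
Proof.
intros H. apply filterlim_locally. intros eps.
destruct (H (eps / 2)) as [d [Hd1 Hd2]].
{ generalize (cond_pos eps); lra. }
exists (mkposreal d Hd1). intros y Hy. apply (norm_compat1 (V := V) (f x) (f y)).
eapply Rle_lt_trans; [apply Hd2; exact Hy|]. generalize (cond_pos eps); lra.
Qed.

Lemma continuous_elim (f : R -> V) (x : R) :
  continuous f x ->
  forall eps, 0 < eps -> exists d, 0 < d /\ forall y : R, Rabs (y - x) < d ->
     norm (minus (f y) (f x)) < eps.
Proof.
intros H eps He.
destruct (proj1 (filterlim_locally_ball_norm f (f x)) H (mkposreal eps He)) as [d Hd].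
exists d. split; [apply cond_pos|]. intros y Hy. apply Hd. exact Hy.
Qed.

Lemma is_derive_scal_fct (f : R -> R) (g : R -> V) (t f' : R) (g' : V) :
  is_derive f t f' -> is_derive g t g' ->
  is_derive (fun t => scal (f t) (g t)) t (plus (scal f' (g t)) (scal (f t) g')).
Proof.
intros Hf Hg.
apply (filterdiff_ext_lin (U := R_NormedModule) (V := V) (fun t => scal (f t) (g t))
  (fun y : R => plus (scal (y * f') (g t)) (scal (f t) (scal y g')))).
- exact (filterdiff_scal_fct (U := R_NormedModule) (V := V) t f g _ _ Rmult_comm Hf Hg).
- intros y. lin.
Qed.

End Norms.

(** A relation rather than a value: [RInt_gen] is total, so convergence has to be carried along.
    [impint_RInt_gen] recovers the value. *)
Definition impint {V : CompleteNormedModule R_AbsRing} (f : R -> V) (l : V) : Prop :=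
  is_RInt_gen f (at_right 0) (Rbar_locally p_infty) l.

Lemma filter_prod_half_line (P : R * R -> Prop) (r : R) :
  0 < r -> (forall a b, 0 < a < r -> r < b -> P (a, b)) ->
  filter_prod (at_right 0) (Rbar_locally p_infty) P.
Proof.
intros Hr HP.
apply (Filter_prod _ _ _ (fun a => 0 < a < r) (fun b => r < b)); auto.
- exists (mkposreal r Hr). intros y Hy Hy0. split; trivial.
  change (Rabs (y - 0) < r) in Hy. apply Rabs_def2 in Hy. lra.
- exists r. auto.
Qed.

Section ImproperIntegrals.

Context {V : CompleteNormedModule R_AbsRing}.
Implicit Types f : R -> V.

Lemma impint_RInt_gen f l :
  impint f l -> RInt_gen f (at_right 0) (Rbar_locally p_infty) = l.
Proof. apply is_RInt_gen_unique. Qed.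

Lemma impint_ext f g l : (forall s, 0 < s -> f s = g s) -> impint f l -> impint g l.
Proof.
intros H. apply is_RInt_gen_ext; try typeclasses eauto.
apply (filter_prod_half_line _ 1 Rlt_0_1). intros a b Ha Hb x.
simpl. rewrite Rmin_left by lra. intros. apply H. lra.
Qed.

Lemma impint_plus f g lf lg :
  impint f lf -> impint g lg -> impint (fun s => plus (f s) (g s)) (plus lf lg).
Proof. intros H1 H2. exact (is_RInt_gen_plus f g lf lg H1 H2). Qed.

Lemma impint_minus f g lf lg :
  impint f lf -> impint g lg -> impint (fun s => minus (f s) (g s)) (minus lf lg).
Proof. intros H1 H2. exact (is_RInt_gen_minus f g lf lg H1 H2). Qed.

Lemma impint_scal (k : R) f l :
  impint f l -> impint (fun s => scal k (f s)) (scal k l).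
Proof. intros H. exact (is_RInt_gen_scal f k l H). Qed.

Lemma impint_norm_le f (g : R -> R) l K :
  (forall s, 0 < s -> norm (f s) <= g s) ->
  impint f l -> impint (V := R_CompleteNormedModule) g K -> norm l <= K.
Proof.
intros H. apply RInt_gen_norm; try typeclasses eauto;
  apply (filter_prod_half_line _ 1 Rlt_0_1); simpl; intros; [lra|].
apply H; lra.
Qed.

Lemma is_RInt_linear {W : CompleteNormedModule R_AbsRing} (T : V -> W) f a b l :
  is_linear T -> is_RInt f a b l -> is_RInt (fun s => T (f s)) a b (T l).
Proof.
intros HT H. unfold is_RInt in *.
apply filterlim_ext with
  (f := fun ptd => T (scal (sign (b - a)) (Riemann_sum f ptd))).
- intros ptd. etransitivity; [apply (linear_scal T HT)|]. f_equal.
  apply (SF_cons_ind (fun s => T (Riemann_sum f s) = Riemann_sum (fun y => T (f y)) s)).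
  + intros x. unfold Riemann_sum; simpl. apply (linear_zero T HT).
  + intros h s Hs. rewrite !Riemann_sum_cons.
    etransitivity; [apply (linear_plus T HT)|]. f_equal; trivial.
    apply (linear_scal T HT).
- eapply filterlim_comp; [exact H|]. exact (linear_cont T l HT).
Qed.

Lemma impint_linear {W : CompleteNormedModule R_AbsRing} (T : V -> W) f l :
  is_linear T -> impint f l -> impint (fun s => T (f s)) (T l).
Proof.
intros HT H P HP. specialize (H (fun y => P (T y)) (linear_cont T l HT P HP)).
unfold filtermapi in *. revert H. apply filter_imp. intros ab [y [Hy1 Hy2]].
exists (T y). split; trivial. now apply is_RInt_linear.
Qed.

Lemma impint_derive (F f : R -> V) (l0 l1 : V) :
  (forall s, 0 < s -> is_derive F s (f s)) ->
  (forall s, 0 < s -> continuous f s) ->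
  filterlim F (at_right 0) (locally l0) ->
  filterlim F (Rbar_locally p_infty) (locally l1) ->
  impint f (minus l1 l0).
Proof.
intros Hd Hc H0 H1.
apply filterlimi_lim_ext_loc with (f := fun ab => minus (F (snd ab)) (F (fst ab))).
- apply (filter_prod_half_line _ 1 Rlt_0_1). intros a b Ha Hb. simpl.
  apply is_RInt_derive; rewrite Rmin_left, Rmax_right by lra; intros;
    [apply Hd|apply Hc]; lra.
- refine (filterlim_comp_2 (fun ab => F (snd ab)) (fun ab => opp (F (fst ab))) plus _ _
            (filterlim_plus l1 (opp l0))).
  + exact (filterlim_comp _ _ _ _ _ _ _ _ filterlim_snd H1).
  + refine (filterlim_comp _ _ _ fst (fun a => opp (F a)) _ _ _ filterlim_fst _).
    exact (filterlim_comp _ _ _ _ _ _ _ _ H0 (filterlim_opp l0)).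
Qed.

Lemma norm_RInt_swap f a b : ex_RInt f b a -> norm (RInt f a b) = norm (RInt f b a).
Proof.
intros H. transitivity (norm (opp (RInt f b a))); [|apply (norm_opp (RInt f b a))].
f_equal. symmetry. now apply opp_RInt_swap.
Qed.

(** Comparison test through the Cauchy criterion: between two endpoints near the same end of the
    half line, the integral of [f] is bounded by a difference of two integrals of [g], both close to
    [K]. *)
Lemma ex_impint_dominated f (g : R -> R) K :
  (forall s, 0 < s -> continuous f s) ->
  (forall s, 0 < s -> norm (f s) <= g s) ->
  impint (V := R_CompleteNormedModule) g K -> exists l, impint f l /\ norm l <= K.
Proof.
intros Hc Hle Hg.
assert (Hex : exists l, impint f l).
2:{ destruct Hex as [l Hl]. exists l. split; trivial. eapply impint_norm_le; eauto. }
assert (Hi : forall a b, 0 < a -> 0 < b -> is_RInt f a b (RInt f a b)).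
{ intros a b Ha Hb. apply (RInt_correct f), ex_RInt_continuous.
  intros z Hz. apply Hc. apply Rlt_le_trans with (2 := proj1 Hz).
  now apply Rmin_glb_lt. }
apply (filterlimi_locally_cauchy (U := V)).
{ apply (filter_prod_half_line _ 1 Rlt_0_1). intros a b Ha Hb. simpl. split.
  - exists (RInt f a b). apply Hi; lra.
  - intros y1 y2 H1 H2. rewrite <- (is_RInt_unique f a b _ H1).
    now apply is_RInt_unique. }
intros eps.
(* Each end of the half line costs two integrals of [g] within [eps / 5] of [K]; both ends together
   cost [4 * (eps / 5) < eps]. *)
assert (He : 0 < eps / 5) by (generalize (cond_pos eps); lra).
assert (Hg' := proj1 (filterlimi_locally (U := R_CompleteNormedModule) _ K) Hg (mkposreal _ He)).
destruct Hg' as [Q S HQ HS HQS]. simpl in HQS.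
assert (HQ' : at_right 0 (fun a => Q a /\ 0 < a < 1)).
{ apply filter_and; trivial. exists (mkposreal 1 Rlt_0_1). intros y Hy Hy0.
  split; trivial. change (Rabs (y - 0) < 1) in Hy. apply Rabs_def2 in Hy. lra. }
assert (HS' : Rbar_locally p_infty (fun b => S b /\ 1 < b)).
{ apply filter_and; trivial. exists 1. auto. }
exists (fun ab => (Q (fst ab) /\ 0 < fst ab < 1) /\ (S (snd ab) /\ 1 < snd ab)).
split.
{ now apply (Filter_prod _ _ _ _ _ HQ' HS'). }
(* A common right endpoint [b] is needed: the integral of [g] over [[a, a']] is the difference of
   those over [[a, b]] and [[a', b]]. *)
assert (Hleft : forall a a' b, Q a -> Q a' -> S b -> 0 < a -> a <= a' -> a' < b ->
          norm (RInt f a a') <= 2 * (eps / 5)).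
{ intros a a' b Qa Qa' Sb Ha Haa Hab.
  destruct (HQS a b Qa Sb) as [I [HI BI]]. destruct (HQS a' b Qa' Sb) as [J [HJ BJ]].
  apply Rle_trans with (I - J).
  - eapply (norm_RInt_le f g a a'); trivial.
    + intros x Hx. apply Hle. lra.
    + apply Hi; lra.
    + apply (is_RInt_Chasles g a b a' I (opp J)); trivial. exact (is_RInt_swap g _ _ _ HJ).
  - change (Rabs (I - K) < eps / 5) in BI. change (Rabs (J - K) < eps / 5) in BJ.
    apply Rabs_def2 in BI. apply Rabs_def2 in BJ. lra. }
assert (Hright : forall a b b', Q a -> S b -> S b' -> 0 < a -> a < b -> b <= b' ->
          norm (RInt f b b') <= 2 * (eps / 5)).
{ intros a b b' Qa Sb Sb' Ha Haa Hab.
  destruct (HQS a b Qa Sb) as [I [HI BI]]. destruct (HQS a b' Qa Sb') as [J [HJ BJ]].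
  apply Rle_trans with (- I + J).
  - eapply (norm_RInt_le f g b b'); trivial.
    + intros x Hx. apply Hle. lra.
    + apply Hi; lra.
    + apply (is_RInt_Chasles g b a b' (opp I) J); trivial. exact (is_RInt_swap g _ _ _ HI).
  - change (Rabs (I - K) < eps / 5) in BI. change (Rabs (J - K) < eps / 5) in BJ.
    apply Rabs_def2 in BI. apply Rabs_def2 in BJ. lra. }
assert (Hl2 : forall a a' b, Q a -> Q a' -> S b -> 0 < a -> 0 < a' -> a < b -> a' < b ->
          norm (RInt f a a') <= 2 * (eps / 5)).
{ intros a a' b Qa Qa' Sb Ha Ha' Hab Hab'. destruct (Rle_dec a a').
  - now apply Hleft with b.
  - rewrite norm_RInt_swap by (eexists; apply Hi; trivial).
    apply Hleft with b; trivial; lra. }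
assert (Hr2 : forall a b b', Q a -> S b -> S b' -> 0 < a -> a < b -> a < b' ->
          norm (RInt f b b') <= 2 * (eps / 5)).
{ intros a b b' Qa Sb Sb' Ha Hab Hab'. destruct (Rle_dec b b').
  - now apply Hright with a.
  - rewrite norm_RInt_swap by (eexists; apply Hi; lra).
    apply Hright with a; trivial; lra. }
intros [a b] [a' b']; simpl. intros [[Qa Ha] [Sb Hb]] [[Qa' Ha'] [Sb' Hb']] u v Hu Hv.
apply (norm_compat1 (V := V) u v).
assert (Hv' : is_RInt f a' b' (plus (RInt f a' a) (plus u (RInt f b b')))).
{ apply (is_RInt_Chasles f a' a b'); [apply Hi; lra|].
  apply (is_RInt_Chasles f a b b'); [trivial|apply Hi; lra]. }
rewrite <- (is_RInt_unique f a' b' _ Hv), (is_RInt_unique f a' b' _ Hv').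
replace (minus _ u) with (plus (RInt f a' a) (RInt f b b')) by lin.
eapply Rle_lt_trans; [apply norm_plus_le|].
apply Rle_lt_trans with (2 * (eps / 5) + 2 * (eps / 5)).
- apply Rplus_le_compat; [apply Hl2 with b|apply Hr2 with a]; trivial; lra.
- generalize (cond_pos eps); lra.
Qed.

End ImproperIntegrals.

(** * The beta integral *)

Lemma Rpower_gt_0 x y : 0 < Rpower x y.
Proof. apply exp_pos. Qed.

Lemma Rpower_sub_1 s q : 0 < s -> Rpower s q = s * Rpower s (q - 1).
Proof.
intros Hs. replace q with (1 + (q - 1)) at 1 by ring.
rewrite Rpower_plus, Rpower_1; trivial.
Qed.

Lemma Rpower_inv_base x y : 0 < x -> Rpower (/ x) y = Rpower x (- y).
Proof. intros Hx. unfold Rpower. rewrite ln_Rinv by trivial. f_equal; ring. Qed.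

Lemma Rpower_le_1 x c : 0 < x <= 1 -> 0 <= c -> Rpower x c <= 1.
Proof.
intros [Hx Hx1] Hc. rewrite <- (exp_0). unfold Rpower.
assert (ln x <= 0). { rewrite <- ln_1. now apply ln_le. }
apply Rle_trans with (exp 0); [|lra].
destruct (Req_dec (c * ln x) 0) as [->|Hn]; [lra|].
left. apply exp_increasing. assert (c * ln x <= 0) by nra. lra.
Qed.

Lemma Rpower_ge_1 x c : 1 <= x -> 0 <= c -> 1 <= Rpower x c.
Proof.
intros Hx Hc. rewrite <- (Rpower_O x) by lra. now apply Rle_Rpower.
Qed.

Lemma is_derive_Rpower q s :
  0 < s -> is_derive (fun s => Rpower s q) s (q * Rpower s (q - 1)).
Proof. intros Hs. apply is_derive_Reals. now apply derivable_pt_lim_power. Qed.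

Section Limits.

Context {V : CompleteNormedModule R_AbsRing}.

Lemma filterlim_at_right_power (F : R -> V) (l : V) C c :
  0 < c -> (forall s, 0 < s < 1 -> norm (minus (F s) l) <= C * Rpower s c) ->
  filterlim F (at_right 0) (locally l).
Proof.
intros Hc HF. apply (filterlim_locally_ball_norm (U := V) F l). intros eps.
assert (HC : 0 < Rmax C 1) by (eapply Rlt_le_trans, Rmax_r; lra).
assert (He : 0 < eps / Rmax C 1) by (apply Rdiv_lt_0_compat; [apply cond_pos|trivial]).
assert (Hd : 0 < Rmin 1 (Rpower (eps / Rmax C 1) (/ c))).
{ apply Rmin_glb_lt; [lra|apply Rpower_gt_0]. }
exists (mkposreal _ Hd). intros y Hy Hy0.
change (Rabs (y - 0) < Rmin 1 (Rpower (eps / Rmax C 1) (/ c))) in Hy.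
apply Rabs_def2 in Hy. destruct Hy as [Hy _]. rewrite Rminus_0_r in Hy.
unfold ball_norm. eapply Rle_lt_trans; [apply HF; split; trivial|].
{ eapply Rlt_le_trans; [exact Hy|apply Rmin_l]. }
apply Rle_lt_trans with (Rmax C 1 * Rpower y c).
{ apply Rmult_le_compat_r; [left; apply Rpower_gt_0|apply Rmax_l]. }
replace (pos eps) with (Rmax C 1 * (eps / Rmax C 1)) by (field; lra).
apply Rmult_lt_compat_l; trivial.
replace (eps / Rmax C 1) with (Rpower (Rpower (eps / Rmax C 1) (/ c)) c).
- apply Rlt_Rpower_l; trivial. split; trivial.
  eapply Rlt_le_trans; [exact Hy|apply Rmin_r].
- rewrite Rpower_mult, Rinv_l, Rpower_1; trivial. lra.
Qed.

Lemma filterlim_infty_power (F : R -> V) (l : V) C c :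
  0 < c -> (forall s, 1 < s -> norm (minus (F s) l) <= C * Rpower s (- c)) ->
  filterlim F (Rbar_locally p_infty) (locally l).
Proof.
intros Hc HF.
assert (H : filterlim (fun s => F (/ s)) (at_right 0) (locally l)).
{ apply (filterlim_at_right_power _ _ C c); trivial. intros s Hs.
  replace (Rpower s c) with (Rpower (/ s) (- c)).
  - apply HF. rewrite <- Rinv_1. apply Rinv_lt_contravar; lra.
  - rewrite Rpower_inv_base by lra. f_equal; ring. }
intros P HP. destruct (H P HP) as [d Hd]. exists (/ d). intros x Hx.
assert (Hd0 := cond_pos d). assert (0 < / d) by (now apply Rinv_0_lt_compat).
rewrite <- (Rinv_inv x). apply Hd.
- change (Rabs (/ x - 0) < d). rewrite Rminus_0_r, Rabs_pos_eq.
  + rewrite <- (Rinv_inv d). apply Rinv_lt_contravar; trivial.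
    apply Rmult_lt_0_compat; lra.
  + left. apply Rinv_0_lt_compat. lra.
- apply Rinv_0_lt_compat. lra.
Qed.

Lemma impint_scale (f : R -> V) (l : V) (c : R) :
  0 < c -> impint f l -> impint (fun s => scal c (f (c * s))) l.
Proof.
intros Hc H P HP. destruct (H P HP) as [Q S HQ HS HQS].
apply (Filter_prod _ _ _ (fun a => Q (c * a)) (fun b => S (c * b))).
- destruct HQ as [d Hd]. assert (Hd' : 0 < d / c) by (apply Rdiv_lt_0_compat; [apply cond_pos|trivial]).
  exists (mkposreal _ Hd'). intros y Hy Hy0.
  change (Rabs (y - 0) < d / c) in Hy. rewrite Rminus_0_r, Rabs_pos_eq in Hy by lra.
  assert (Hcy : 0 < c * y) by now apply Rmult_lt_0_compat.
  apply Hd; trivial. change (Rabs (c * y - 0) < d).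
  rewrite Rminus_0_r, Rabs_pos_eq by lra.
  replace (pos d) with (c * (d / c)) by (field; lra). now apply Rmult_lt_compat_l.
- destruct HS as [M HM]. exists (M / c). intros x Hx. apply HM.
  replace M with (c * (M / c)) by (field; lra). now apply Rmult_lt_compat_l.
- intros a b Ha Hb. destruct (HQS _ _ Ha Hb) as [y [Hy1 Hy2]]. exists y. split; trivial.
  simpl in *.
  assert (Hy3 : is_RInt f (c * a + 0) (c * b + 0) y) by now rewrite !Rplus_0_r.
  apply (is_RInt_comp_lin f c 0 a b y) in Hy3.
  eapply is_RInt_ext; [|exact Hy3]. intros x _. simpl. now rewrite Rplus_0_r.
Qed.

End Limits.

Notation impintR := (impint (V := R_CompleteNormedModule)).

Lemma impintR_scal (k : R) (f : R -> R) (l : R) :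
  impintR f l -> impintR (fun s => k * f s) (k * l).
Proof. exact (impint_scal (V := R_CompleteNormedModule) k f l). Qed.

(** Euler's beta function at [(q, 1 - q)]; it is the integral in [frac_pow01] when [A] is the
    identity of the real line and [u] is 1. *)
Definition beta (q : R) : R :=
  RInt_gen (V := R_CompleteNormedModule)
    (fun s => Rpower s (q - 1) * / (s + 1)) (at_right 0) (Rbar_locally p_infty).

Lemma norm_R (x : R) : norm (x : R_CompleteNormedModule) = Rabs x.
Proof. reflexivity. Qed.

Lemma impintR_derive (F f : R -> R) (l0 l1 l : R) :
  l = l1 - l0 ->
  (forall s, 0 < s -> is_derive F s (f s)) ->
  (forall s, 0 < s -> continuous f s) ->
  filterlim F (at_right 0) (locally (l0 : R_CompleteNormedModule)) ->
  filterlim F (Rbar_locally p_infty) (locally (l1 : R_CompleteNormedModule)) ->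
  impintR f l.
Proof. intros ->. exact (impint_derive (V := R_CompleteNormedModule) F f l0 l1). Qed.

(** The primitive is [(s / (s + 1))^q], which increases from 0 to 1. Up to constants the integrand
    bounds that of [beta] from below everywhere and from above on [(0, 1]]. *)
Lemma impint_unit_dominator q :
  0 < q < 1 ->
  impintR (fun s => q * (Rpower s (q - 1) * Rpower (s + 1) (- q) * / (s + 1))) 1.
Proof.
intros Hq.
apply (impintR_derive (fun s => Rpower s q * Rpower (s + 1) (- q)) _ 0 1); [ring| | | |].
- intros s Hs. unfold Rpower. auto_derive; [lra|].
  change (exp (q * ln s)) with (Rpower s q).
  change (exp (- q * ln (s + 1))) with (Rpower (s + 1) (- q)).
  change (exp ((q - 1) * ln s)) with (Rpower s (q - 1)).
  rewrite (Rpower_sub_1 s q) by trivial. field. lra.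
- intros s Hs. apply (ex_derive_continuous (V := R_NormedModule)). unfold Rpower. auto_derive. lra.
- apply (filterlim_at_right_power (V := R_CompleteNormedModule) _ _ 1 q); [lra|]. intros s Hs.
  rewrite norm_R. unfold minus, plus, opp; simpl. rewrite Ropp_0, Rplus_0_r, Rabs_pos_eq.
  + rewrite Rmult_comm. apply Rmult_le_compat_r; [left; apply Rpower_gt_0|].
    rewrite Rpower_Ropp. rewrite <- Rinv_1. apply Rinv_le_contravar; [lra|].
    apply Rpower_ge_1; lra.
  + left. apply Rmult_lt_0_compat; apply Rpower_gt_0.
- apply (filterlim_infty_power (V := R_CompleteNormedModule) _ _ 1 1); [lra|]. intros s Hs.
  rewrite norm_R. unfold minus, plus, opp; simpl.
  rewrite Rpower_Ropp, Rpower_Ropp, Rpower_1 by lra.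
  assert (E : Rpower s q * / Rpower (s + 1) q = Rpower (s / (s + 1)) q).
  { rewrite <- Rpower_Ropp, <- Rpower_inv_base by lra.
    rewrite Rpower_mult_distr; [reflexivity|lra|apply Rinv_0_lt_compat; lra]. }
  rewrite E.
  assert (H0 : 0 < s / (s + 1) <= 1).
  { split; [apply Rdiv_lt_0_compat; lra|]. apply Rle_div_l; lra. }
  assert (H1 := Rpower_le_1 _ q H0 ltac:(lra)).
  rewrite Rabs_left1 by lra.
  (* For a base at most 1 the exponent [q < 1] increases the value, so the distance to the limit 1
     is at most [1 - s / (s + 1) = / (s + 1)]. *)
  assert (H2 : s / (s + 1) <= Rpower (s / (s + 1)) q).
  { rewrite (Rpower_sub_1 _ q) by lra. rewrite <- (Rmult_1_r (s / (s + 1))) at 1.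
    apply Rmult_le_compat_l; [lra|].
    replace (q - 1) with (- (1 - q)) by ring. rewrite Rpower_Ropp.
    rewrite <- Rinv_1 at 1. apply Rinv_le_contravar; [apply Rpower_gt_0|].
    apply Rpower_le_1; lra. }
  apply Rle_trans with (1 - s / (s + 1)); [lra|].
  replace (1 - s / (s + 1)) with (/ (s + 1)) by (field; lra).
  rewrite Rmult_1_l. apply Rinv_le_contravar; lra.
Qed.

(** The primitive is [- (s + 1)^(q - 1)]. This dominates the integrand of [beta] on [[1, oo)] up to
    a constant. *)
Lemma impint_tail_dominator q :
  0 < q < 1 -> impintR (fun s => (1 - q) * Rpower (s + 1) (q - 2)) 1.
Proof.
intros Hq.
apply (impintR_derive (fun s => - Rpower (s + 1) (q - 1)) _ (-1) 0); [ring| | | |].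
- intros s Hs. unfold Rpower. auto_derive; [lra|].
  change (exp ((q - 1) * ln (s + 1))) with (Rpower (s + 1) (q - 1)).
  change (exp ((q - 2) * ln (s + 1))) with (Rpower (s + 1) (q - 2)).
  rewrite (Rpower_sub_1 (s + 1) (q - 1)) by lra.
  replace (q - 1 - 1) with (q - 2) by ring. field. lra.
- intros s Hs. apply (ex_derive_continuous (V := R_NormedModule)). unfold Rpower. auto_derive. lra.
- apply (filterlim_at_right_power (V := R_CompleteNormedModule) _ _ 1 1); [lra|]. intros s Hs.
  rewrite norm_R. unfold minus, plus, opp; simpl. rewrite Rpower_1 by lra.
  assert (H0 : 0 < / (s + 1) <= 1).
  { split; [apply Rinv_0_lt_compat; lra|]. rewrite <- Rinv_1. apply Rinv_le_contravar; lra. }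
  assert (H1 : Rpower (s + 1) (q - 1) = Rpower (/ (s + 1)) (1 - q)).
  { rewrite Rpower_inv_base by lra. f_equal; ring. }
  assert (H2 := Rpower_le_1 _ (1 - q) H0 ltac:(lra)).
  assert (H3 : / (s + 1) <= Rpower (/ (s + 1)) (1 - q)).
  { rewrite (Rpower_sub_1 _ (1 - q)) by lra. rewrite <- (Rmult_1_r (/ (s + 1))) at 1.
    apply Rmult_le_compat_l; [lra|].
    replace (1 - q - 1) with (- q) by ring. rewrite Rpower_Ropp.
    rewrite <- Rinv_1 at 1. apply Rinv_le_contravar; [apply Rpower_gt_0|].
    apply Rpower_le_1; lra. }
  rewrite H1, Rabs_pos_eq by lra.
  assert (1 - s <= / (s + 1)).
  { apply Rmult_le_reg_r with (s + 1); [lra|]. rewrite Rinv_l by lra. nra. }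
  lra.
- apply (filterlim_infty_power (V := R_CompleteNormedModule) _ _ 1 (1 - q)); [lra|]. intros s Hs.
  rewrite norm_R. unfold minus, plus, opp; simpl.
  rewrite Ropp_0, Rplus_0_r, Rabs_Ropp, Rabs_pos_eq, Rmult_1_l by (left; apply Rpower_gt_0).
  replace (q - 1) with (- (1 - q)) by ring. rewrite !Rpower_Ropp.
  apply Rinv_le_contravar; [apply Rpower_gt_0|]. apply Rle_Rpower_l; lra.
Qed.

(** The integrand is at most twice [s^(q-1) (s+1)^(-q-1)] for [s <= 1] and at most twice
    [(s+1)^(q-2)] for [s > 1]; dividing the two dominators by [q] and [1 - q] gives the upper bound.
    The lower bound uses [(s+1)^(-q) <= 1]. *)
Lemma beta_spec q :
  0 < q < 1 ->
  impintR (fun s => Rpower s (q - 1) * / (s + 1)) (beta q) /\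
  / q <= beta q <= 2 / q + 2 / (1 - q).
Proof.
intros Hq.
assert (Hg := impint_plus (V := R_CompleteNormedModule) _ _ _ _
  (impint_scal (V := R_CompleteNormedModule) (2 / q) _ _ (impint_unit_dominator q Hq))
  (impint_scal (V := R_CompleteNormedModule) (2 / (1 - q)) _ _ (impint_tail_dominator q Hq))).
destruct (fun Hc Hle => ex_impint_dominated (V := R_CompleteNormedModule)
  (fun s => Rpower s (q - 1) * / (s + 1)) _ _ Hc Hle Hg) as [l [Hl1 Hl2]].
- intros s Hs. apply (ex_derive_continuous (V := R_NormedModule)). unfold Rpower. auto_derive. lra.
- intros s Hs. unfold plus, scal; simpl; unfold mult; simpl. rewrite norm_R.
  assert (Ha := Rpower_gt_0 s (q - 1)). assert (Hb := Rpower_gt_0 (s + 1) (- q)).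
  assert (Hc := Rpower_gt_0 (s + 1) (q - 2)). assert (Hd : 0 < / (s + 1)) by (apply Rinv_0_lt_compat; lra).
  rewrite Rabs_pos_eq by (left; now apply Rmult_lt_0_compat).
  replace (2 / q * (q * (Rpower s (q - 1) * Rpower (s + 1) (- q) * / (s + 1))))
    with (2 * Rpower (s + 1) (- q) * (Rpower s (q - 1) * / (s + 1))) by (field; lra).
  replace (2 / (1 - q) * ((1 - q) * Rpower (s + 1) (q - 2)))
    with (2 * Rpower (s + 1) (q - 2)) by (field; lra).
  destruct (Rle_dec s 1) as [Hs1|Hs1].
  + assert (1 <= 2 * Rpower (s + 1) (- q)).
    { apply Rle_trans with (2 * Rpower (s + 1) (- (1))).
      - rewrite Rpower_Ropp, Rpower_1 by lra. apply Rmult_le_reg_r with (s + 1); [lra|].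
        rewrite Rmult_assoc, Rinv_l by lra. lra.
      - apply Rmult_le_compat_l; [lra|]. apply Rle_Rpower; lra. }
    assert (0 < Rpower s (q - 1) * / (s + 1)) by now apply Rmult_lt_0_compat.
    nra.
  + assert (Rpower s (q - 1) * / (s + 1) <= 2 * Rpower (s + 1) (q - 2)).
    2:{ assert (0 < Rpower (s + 1) (- q) * (Rpower s (q - 1) * / (s + 1)))
          by (repeat apply Rmult_lt_0_compat; trivial). lra. }
    replace (q - 2) with ((q - 1) + - (1)) by ring. rewrite Rpower_plus, Rpower_Ropp, Rpower_1 by lra.
    rewrite <- Rmult_assoc. apply Rmult_le_compat_r; [lra|].
    replace (q - 1) with (- (1 - q)) by ring. rewrite !Rpower_Ropp.
    apply Rmult_le_reg_r with (Rpower s (1 - q) * Rpower (s + 1) (1 - q)).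
    { apply Rmult_lt_0_compat; apply Rpower_gt_0. }
    assert (Hx := Rpower_gt_0 s (1 - q)). assert (Hy := Rpower_gt_0 (s + 1) (1 - q)).
    replace (/ Rpower s (1 - q) * (Rpower s (1 - q) * Rpower (s + 1) (1 - q)))
      with (Rpower (s + 1) (1 - q)) by (field; lra).
    replace (2 * / Rpower (s + 1) (1 - q) * (Rpower s (1 - q) * Rpower (s + 1) (1 - q)))
      with (2 * Rpower s (1 - q)) by (field; lra).
    apply Rle_trans with (Rpower (2 * s) (1 - q)).
    { apply Rle_Rpower_l; lra. }
    rewrite <- Rpower_mult_distr by lra. apply Rmult_le_compat_r; [lra|].
    rewrite <- (Rpower_1 2) at 2 by lra. apply Rle_Rpower; lra.
- assert (Hb : beta q = l) by exact (impint_RInt_gen (V := R_CompleteNormedModule) _ _ Hl1).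
  rewrite Hb. split; trivial. split.
  + assert (Hu := impint_unit_dominator q Hq).
    apply (impint_scal (V := R_CompleteNormedModule) (/ q)) in Hu.
    assert (Hle : norm (scal (/ q) 1 : R_CompleteNormedModule) <= l).
    { refine (impint_norm_le _ _ _ _ _ Hu Hl1). intros s Hs.
      unfold scal; simpl; unfold mult; simpl. rewrite norm_R.
      rewrite <- Rmult_assoc, Rinv_l, Rmult_1_l by lra.
      assert (Ha := Rpower_gt_0 s (q - 1)). assert (Hc := Rpower_gt_0 (s + 1) (- q)).
      assert (Hd : 0 < / (s + 1)) by (apply Rinv_0_lt_compat; lra).
      rewrite Rabs_pos_eq by (left; repeat apply Rmult_lt_0_compat; trivial).
      apply Rmult_le_compat_r; [lra|]. rewrite <- (Rmult_1_r (Rpower s (q - 1))) at 2.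
      apply Rmult_le_compat_l; [lra|]. rewrite Rpower_Ropp, <- Rinv_1.
      apply Rinv_le_contravar; [lra|]. apply Rpower_ge_1; lra. }
    rewrite norm_R in Hle. unfold scal in Hle; simpl in Hle; unfold mult in Hle; simpl in Hle.
    rewrite Rmult_1_r, Rabs_pos_eq in Hle; trivial. left. apply Rinv_0_lt_compat; lra.
  + rewrite norm_R in Hl2. unfold plus, scal in Hl2; simpl in Hl2; unfold mult in Hl2; simpl in Hl2.
    assert (H := Rle_abs l). lra.
Qed.

Lemma impint_beta_shift q eps :
  0 < q < 1 -> 0 < eps ->
  impintR (fun s => Rpower s (q - 1) * / (s + eps)) (Rpower eps (q - 1) * beta q).
Proof.
intros Hq He. destruct (beta_spec q Hq) as [Hb _].
assert (He' : 0 < / eps) by now apply Rinv_0_lt_compat.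
apply (impint_scale (V := R_CompleteNormedModule) _ _ (/ eps) He') in Hb.
apply (impint_scal (V := R_CompleteNormedModule) (Rpower eps (q - 1))) in Hb.
refine (impint_ext (V := R_CompleteNormedModule) _ _ _ _ Hb). intros s Hs.
unfold scal; simpl; unfold mult; simpl.
rewrite <- (Rpower_mult_distr (/ eps) s), Rpower_inv_base by trivial.
rewrite Rpower_Ropp. field. repeat split; try lra.
apply Rgt_not_eq, Rpower_gt_0.
Qed.

Lemma ex_impint_power {V : CompleteNormedModule R_AbsRing} (f : R -> V) M q eps :
  0 < q < 1 -> 0 < eps ->
  (forall s, 0 < s -> continuous f s) ->
  (forall s, 0 < s -> norm (f s) <= M * (Rpower s (q - 1) * / (s + eps))) ->
  exists l, impint f l /\ norm l <= M * (Rpower eps (q - 1) * beta q).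
Proof.
intros Hq He Hc Hle. refine (ex_impint_dominated _ _ _ Hc Hle _).
exact (impint_scal (V := R_CompleteNormedModule) M _ _ (impint_beta_shift q eps Hq He)).
Qed.

(* Subtract from [beta q] the integral [1 / q] of [s^(q-1) / (s+1)^(q+1)] and
   bound [1 - (s+1)^(-q)] by [q ln (s+1) <= 2 q s^(1/2)]. *)
Lemma beta_asymptotic q : 0 < q <= 1 / 4 -> 1 <= q * beta q <= 1 + 24 * q ^ 2.
Proof.
intros Hq. assert (Hq1 : 0 < q < 1) by lra.
destruct (beta_spec q Hq1) as [Hb [Hb1 _]].
assert (Hq2 : 0 < q + / 2 < 1) by lra.
destruct (beta_spec (q + / 2) Hq2) as [Hc [_ Hc1]].
(* The factor [s^(1/2)] shifts the exponent to [q + / 2], which [q <= 1 / 4] keeps away from 1. The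
   24 of the statement is [2 * 12]. *)
assert (Hc2 : beta (q + / 2) <= 12).
{ eapply Rle_trans; [exact Hc1|].
  assert (2 / (q + / 2) <= 4) by (apply Rle_div_l; lra).
  assert (2 / (1 - (q + / 2)) <= 8) by (apply Rle_div_l; lra). lra. }
split.
{ replace 1 with (q * / q) by (field; lra). apply Rmult_le_compat_l; lra. }
assert (Hu := impint_scal (V := R_CompleteNormedModule) (/ q) _ _ (impint_unit_dominator q Hq1)).
assert (Hd := impint_minus (V := R_CompleteNormedModule) _ _ _ _ Hb Hu).
assert (Hm := impint_scal (V := R_CompleteNormedModule) (2 * q) _ _ Hc).
assert (H := fun Hle => impint_norm_le (V := R_CompleteNormedModule) _ _ _ _ Hle Hd Hm).
assert (H' : Rabs (beta q + - (/ q * 1)) <= 2 * q * beta (q + / 2)).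
{ apply H. clear - Hq. intros s Hs.
  unfold minus, plus, opp, scal; simpl; unfold mult; simpl. rewrite norm_R.
  replace (q + / 2 - 1) with ((q - 1) + / 2) by ring. rewrite Rpower_plus.
  assert (Ha := Rpower_gt_0 s (q - 1)). assert (Hd : 0 < / (s + 1)) by (apply Rinv_0_lt_compat; lra).
  replace (Rpower s (q - 1) * / (s + 1) +
     - (/ q * (q * (Rpower s (q - 1) * Rpower (s + 1) (- q) * / (s + 1)))))
    with (Rpower s (q - 1) * / (s + 1) * (1 - Rpower (s + 1) (- q))) by (field; lra).
  assert (Hle1 : Rpower (s + 1) (- q) <= 1).
  { rewrite Rpower_Ropp, <- Rinv_1. apply Rinv_le_contravar; [lra|]. apply Rpower_ge_1; lra. }
  assert (Hpos : 0 < Rpower s (q - 1) * / (s + 1)) by now apply Rmult_lt_0_compat.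
  rewrite Rabs_pos_eq by (apply Rmult_le_pos; lra).
  replace (2 * q * (Rpower s (q - 1) * Rpower s (/ 2) * / (s + 1)))
    with (Rpower s (q - 1) * / (s + 1) * (q * (2 * Rpower s (/ 2)))) by ring.
  apply Rmult_le_compat_l; [lra|].
  apply Rle_trans with (q * ln (s + 1)).
  - unfold Rpower. assert (He := exp_ineq1_le (- q * ln (s + 1))). lra.
  - apply Rmult_le_compat_l; [lra|].
    assert (Hs2 : Rpower s (/ 2) * Rpower s (/ 2) = s).
    { rewrite <- Rpower_plus. replace (/ 2 + / 2) with 1 by field. now apply Rpower_1. }
    assert (Hs3 := Rpower_gt_0 s (/ 2)). set (r := Rpower s (/ 2)) in *.
    (* With [r^2 = s], the inequality [exp (2 * r) >= (1 + r)^2 >= 1 + s] gives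
       [ln (s + 1) <= 2 * r]. *)
    rewrite <- (ln_exp (2 * r)). apply ln_le; [lra|].
    replace (2 * r) with (r + r) by ring. rewrite exp_plus.
    assert (He := exp_ineq1_le r). nra. }
assert (H2 := Rle_abs (beta q + - (/ q * 1))).
assert (H3 : beta q <= / q + 24 * q) by nra.
replace (1 + 24 * q ^ 2) with (q * (/ q + 24 * q)) by (field; lra).
apply Rmult_le_compat_l; lra.
Qed.

(* By Euler's reflection formula [gamma q = 1].  Only the bounds below are needed:
   [A^q] is [gamma q] times a semigroup, and [gamma q = 1 + O(q^2)] shows that the
   generator is unaffected. *)
Definition gamma (q : R) : R := sin (PI * q) / PI * beta q.

(** [gamma q] is the product of [sin (PI * q) / (PI * q)], which is [1 - O(q^2)] by Taylor's
    formula, and [q * beta q], handled by [beta_asymptotic]. The bound [PI <= 4] makes the constants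
    rational. *)
Lemma gamma_near_0 q : 0 < q <= 1 / 4 -> Rabs (gamma q - 1) <= 30 * q ^ 2.
Proof.
intros Hq. assert (Hb := beta_asymptotic q Hq).
assert (HPI := PI_RGT_0). assert (HPI4 := PI_4).
assert (Hx : 0 < PI * q) by (apply Rmult_lt_0_compat; lra).
assert (Hs1 : sin (PI * q) < PI * q) by now apply sin_lt_x.
assert (Hs2 : PI * q - (PI * q) ^ 3 / 6 <= sin (PI * q)).
{ assert (Hl := pre_sin_bound (PI * q) 0 ltac:(lra) ltac:(nra)).
  unfold sin_approx, sin_term in Hl. simpl in Hl. lra. }
set (r := sin (PI * q) / (PI * q)).
assert (Hg : gamma q = r * (q * beta q)) by (unfold gamma, r; field; lra).
assert (Hr1 : r <= 1) by (unfold r; apply Rle_div_l; lra).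
assert (Hr2 : 1 - (PI * q) ^ 2 / 6 <= r).
{ unfold r. apply Rle_div_r; trivial.
  replace ((1 - (PI * q) ^ 2 / 6) * (PI * q)) with (PI * q - (PI * q) ^ 3 / 6) by field. lra. }
assert (Hp : (PI * q) ^ 2 <= 16 * q ^ 2).
{ rewrite Rpow_mult_distr. apply Rmult_le_compat_r; [apply pow2_ge_0|]. nra. }
assert (Hq2 : 0 < q ^ 2 <= 1 / 16) by (split; nra).
rewrite Hg. apply Rabs_le. split; nra.
Qed.

(** Lets [gamma] be divided out uniformly for exponents up to [t1 < 1]. The half-angle formula
    isolates the cosine, the factor of the sine that vanishes as [q] tends to 1; the rest follows
    from [sin x >= x / 3] on [(0, 2]] and [beta q >= / q]. *)
Lemma gamma_lower q t1 :
  0 < q <= t1 -> t1 < 1 -> cos (PI * t1 / 2) / 4 <= gamma q /\ 0 < cos (PI * t1 / 2).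
Proof.
intros Hq Ht. assert (HPI := PI_RGT_0). assert (HPI4 := PI_4).
assert (Hc0 : 0 < cos (PI * t1 / 2)) by (apply cos_gt_0; nra).
split; trivial.
destruct (beta_spec q ltac:(lra)) as [_ [Hb _]].
assert (Hc : cos (PI * t1 / 2) <= cos (PI * q / 2)).
{ destruct (Req_dec q t1) as [->|Hn]; [lra|]. left. apply cos_decreasing_1; nra. }
assert (Hx : 0 < PI * q / 2 <= 2) by nra.
assert (Hs : (PI * q / 2) / 3 <= sin (PI * q / 2)).
{ assert (Hl := pre_sin_bound (PI * q / 2) 0 ltac:(lra) ltac:(lra)).
  unfold sin_approx, sin_term in Hl. simpl in Hl.
  set (x := PI * q / 2) in *. assert (Hx3 : x - x ^ 3 / 6 <= sin x) by (simpl; lra).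
  assert (0 <= x * ((2 - x) * (2 + x))).
  { apply Rmult_le_pos; [lra|]. apply Rmult_le_pos; lra. }
  nra. }
assert (Hd : sin (PI * q) = 2 * sin (PI * q / 2) * cos (PI * q / 2)).
{ rewrite <- sin_2a. f_equal. field. }
unfold gamma. rewrite Hd.
assert (H1 : q / 3 * cos (PI * t1 / 2) <= 2 * sin (PI * q / 2) * cos (PI * q / 2) / PI).
{ apply (proj1 (Rle_div_r _ _ PI HPI)).
  replace (q / 3 * cos (PI * t1 / 2) * PI)
    with (2 * (PI * q / 2 / 3) * cos (PI * t1 / 2)) by field.
  apply Rmult_le_compat; lra. }
assert (Hq1 : 0 < / q) by (apply Rinv_0_lt_compat; lra).
apply Rle_trans with (q / 3 * cos (PI * t1 / 2) * / q).
- replace (q / 3 * cos (PI * t1 / 2) * / q) with (cos (PI * t1 / 2) / 3) by (field; lra). lra.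
- apply Rmult_le_compat; try lra. apply Rmult_le_pos; lra.
Qed.

(** * Resolvents *)

Section BoundedOperators.

Context {X : CompleteNormedModule R_AbsRing}.
Implicit Types (T : X -> X) (x y u : X).

(** Homogeneity alone is assumed, because [is_linear] contains boundedness, which [resolvent_linear]
    derives from this very bound. *)
Lemma opnorm_bound T (c : R) x :
  (forall (k : R) u, T (scal k u) = scal k (T u)) ->
  Rbar_le (opnorm T) c -> norm (T x) <= c * norm x.
Proof.
intros HT Hc.
assert (Hle : forall u, norm u <= 1 -> norm (T u) <= c).
{ intros u Hu. apply (Rbar_le_trans (norm (T u)) (opnorm T) c); trivial.
  apply (proj1 (Lub_Rbar_correct _)). now exists u. }
destruct (Req_dec (norm x) 0) as [H0|H0].
- replace (T x) with (scal 0 (T x)).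
  + rewrite norm_scal_eq, Rabs_R0, H0. lra.
  + rewrite <- HT. f_equal.
    assert (Hx : x = zero) by exact (norm_eq_zero x H0). rewrite Hx. lin.
- assert (Hp : 0 < norm x).
  { assert (Hx : 0 <= norm x) by exact (norm_ge_0 x). lra. }
  assert (Hn : norm (T (scal (/ norm x) x)) <= c).
  { apply Hle. rewrite norm_scal_eq, Rabs_pos_eq, Rinv_l; trivial; [lra|].
    left. now apply Rinv_0_lt_compat. }
  rewrite HT, norm_scal_eq, Rabs_pos_eq in Hn by (left; now apply Rinv_0_lt_compat).
  apply Rmult_le_reg_l with (/ norm x); [now apply Rinv_0_lt_compat|].
  replace (/ norm x * (c * norm x)) with c by (field; trivial). trivial.
Qed.

Lemma opnorm_ge_0 T (c : R) : Rbar_le (opnorm T) c -> 0 <= c.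
Proof.
intros Hc. apply Rle_trans with (norm (T zero)); [exact (norm_ge_0 _)|].
apply (Rbar_le_trans (norm (T zero)) (opnorm T) c); trivial.
apply (proj1 (Lub_Rbar_correct _)). exists zero. split; trivial.
replace (norm (zero : X)) with 0; [lra|]. symmetry. exact norm_zero.
Qed.

Lemma linear_bound T : is_linear T -> exists M, 0 < M /\ forall x, norm (T x) <= M * norm x.
Proof. intros HT. exact (linear_norm T HT). Qed.

Lemma lin_plus T x y : is_linear T -> T (plus x y) = plus (T x) (T y).
Proof. intros HT. exact (linear_plus T HT x y). Qed.

Lemma lin_scal T (k : R) x : is_linear T -> T (scal k x) = scal k (T x).
Proof. intros HT. exact (linear_scal T HT k x). Qed.

Lemma lin_minus T x y : is_linear T -> T (minus x y) = minus (T x) (T y).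
Proof. intros HT. exact (linear_minus T x y HT). Qed.

Lemma lin_opp T x : is_linear T -> T (opp x) = opp (T x).
Proof. intros HT. exact (linear_opp T x HT). Qed.

End BoundedOperators.

(** [positive_type] with its constant exposed, so that later constants can be written in terms of
    [kappa]. *)
Record resolvent_bound {X : CompleteNormedModule R_AbsRing} (A : X -> X) (kappa : R) : Prop := {
  rb_linear : is_linear A;
  rb_pos : 0 < kappa;
  rb_inj : forall a, 0 < a -> Injective (shift A a);
  rb_surj : forall a, 0 < a -> Surjective (shift A a);
  rb_opnorm : forall a, 0 < a -> Rbar_le (opnorm (resolvent A a)) (kappa / a)
}.

Section Resolvents.

Context {X : CompleteNormedModule R_AbsRing} {A : X -> X} {kappa : R}.
Context (HA : resolvent_bound A kappa).
Implicit Types (T : X -> X) (x y u : X) (s t : R).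

Local Notation Rs := (resolvent A).
Let A_linear : is_linear A := rb_linear A kappa HA.

Lemma shift_resolvent s y : 0 < s -> shift A s (Rs s y) = y.
Proof.
intros Hs. apply (iota_correct (fun u => shift A s u = y)).
destruct (rb_surj A kappa HA s Hs y) as [x Hx]. exists x. split; trivial.
intros x' Hx'. apply (rb_inj A kappa HA s Hs). congruence.
Qed.

Lemma resolvent_unique s u y : 0 < s -> shift A s u = y -> u = Rs s y.
Proof.
intros Hs H. apply (rb_inj A kappa HA s Hs). now rewrite shift_resolvent.
Qed.

Lemma A_resolvent s y : 0 < s -> A (Rs s y) = minus y (scal s (Rs s y)).
Proof.
intros Hs. assert (H := shift_resolvent s y Hs). unfold shift in H.
transitivity (minus (plus (A (Rs s y)) (scal s (Rs s y))) (scal s (Rs s y))); [lin|].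
now rewrite H.
Qed.

Lemma resolvent_commute T s x :
  is_linear T -> (forall u, T (A u) = A (T u)) -> 0 < s -> T (Rs s x) = Rs s (T x).
Proof.
intros HT Hc Hs. apply resolvent_unique; trivial. unfold shift.
rewrite <- Hc, <- (lin_scal T), <- (lin_plus T) by trivial. f_equal. now apply shift_resolvent.
Qed.

Lemma resolvent_A s x : 0 < s -> Rs s (A x) = A (Rs s x).
Proof. intros Hs. symmetry. now apply resolvent_commute. Qed.

Lemma resolvent_linear s : 0 < s -> is_linear (Rs s).
Proof.
intros Hs.
assert (Hscal : forall (k : R) x, Rs s (scal k x) = scal k (Rs s x)).
{ intros k x. symmetry. apply resolvent_unique; trivial. unfold shift.
  rewrite (lin_scal A) by trivial.
  transitivity (scal k (shift A s (Rs s x))); [unfold shift; lin|].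
  now rewrite shift_resolvent. }
split; trivial.
- intros x y. symmetry. apply resolvent_unique; trivial. unfold shift.
  rewrite (lin_plus A) by trivial.
  transitivity (plus (shift A s (Rs s x)) (shift A s (Rs s y))); [unfold shift; lin|].
  now rewrite !shift_resolvent.
- exists (kappa / s). split.
  + apply Rdiv_lt_0_compat; trivial. apply (rb_pos A kappa HA).
  + intros x. apply opnorm_bound; trivial. now apply (rb_opnorm A kappa HA).
Qed.

Lemma resolvent_norm s x : 0 < s -> norm (Rs s x) <= kappa / s * norm x.
Proof.
intros Hs. apply opnorm_bound.
- intros k u. apply lin_scal. now apply resolvent_linear.
- now apply (rb_opnorm A kappa HA).
Qed.

Lemma A_resolvent_norm s x : 0 < s -> norm (A (Rs s x)) <= (1 + kappa) * norm x.
Proof.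
intros Hs. rewrite A_resolvent by trivial.
eapply Rle_trans; [apply norm_minus_le|]. rewrite norm_scal_eq, Rabs_pos_eq by lra.
assert (H := resolvent_norm s x Hs).
assert (H1 : s * norm (Rs s x) <= s * (kappa / s * norm x)) by (apply Rmult_le_compat_l; lra).
replace (s * (kappa / s * norm x)) with (kappa * norm x) in H1 by (field; lra). lra.
Qed.

Lemma resolvent_commutes s t x : 0 < s -> 0 < t -> Rs s (Rs t x) = Rs t (Rs s x).
Proof.
intros Hs Ht. apply resolvent_commute; trivial; [now apply resolvent_linear|].
intros u. now apply resolvent_A.
Qed.

Lemma resolvent_identity s t x :
  0 < s -> 0 < t -> minus (Rs s x) (Rs t x) = scal (t - s) (Rs s (Rs t x)).
Proof.
intros Hs Ht. assert (HL := resolvent_linear s Hs).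
transitivity (minus (Rs s (shift A t (Rs t x))) (Rs t x)); [now rewrite shift_resolvent|].
unfold shift. rewrite (lin_plus (Rs s)), (lin_scal (Rs s)), resolvent_A, A_resolvent by trivial. lin.
Qed.

Lemma resolvent_bound_mono s t x : 0 < t -> t <= s -> norm (Rs s x) <= kappa / t * norm x.
Proof.
intros Ht Hs. eapply Rle_trans; [apply resolvent_norm; lra|].
apply Rmult_le_compat_r; [exact (norm_ge_0 x)|].
apply Rmult_le_compat_l; [left; apply (rb_pos A kappa HA)|]. now apply Rinv_le_contravar.
Qed.

Lemma resolvent_derive s x : 0 < s -> is_derive (fun s => Rs s x) s (opp (Rs s (Rs s x))).
Proof.
intros Hs. apply is_derive_intro. intros eps He.
assert (Hk := rb_pos A kappa HA).
(* [C] bounds the norm of [R_y R_s R_s x] for [y >= s / 2]; the added 1 keeps it positive. *)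
set (C := (kappa / (s / 2)) * (kappa / s * (kappa / s * norm x)) + 1).
assert (HC0 : 0 <= kappa / (s / 2) * (kappa / s * (kappa / s * norm x))).
{ repeat apply Rmult_le_pos; try (left; apply Rinv_0_lt_compat); try lra. exact (norm_ge_0 x). }
exists (Rmin (s / 2) (eps / C)). split.
{ apply Rmin_glb_lt; [lra|]. apply Rdiv_lt_0_compat; unfold C; lra. }
intros y Hy.
assert (Hy1 : Rabs (y - s) < s / 2) by (eapply Rlt_le_trans; [exact Hy|apply Rmin_l]).
assert (Hy2 : Rabs (y - s) <= eps / C) by (left; eapply Rlt_le_trans; [exact Hy|apply Rmin_r]).
apply Rabs_def2 in Hy1.
(* Two uses of the resolvent identity turn the remainder of first order into exactly
   [(y - s)^2 R_y R_s R_s x]. *)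
replace (minus (minus (Rs y x) (Rs s x)) (scal (y - s) (opp (Rs s (Rs s x)))))
  with (scal ((y - s) * (y - s)) (Rs y (Rs s (Rs s x)))).
- rewrite norm_scal_eq, Rabs_mult, Rmult_assoc, (Rmult_comm eps).
  apply Rmult_le_compat_l; [apply Rabs_pos|].
  apply Rle_trans with (eps / C * C); [|right; field; unfold C; lra].
  apply Rmult_le_compat; [apply Rabs_pos|exact (norm_ge_0 _)|trivial|].
  unfold C. apply Rle_trans with (kappa / (s / 2) * norm (Rs s (Rs s x))).
  + apply resolvent_bound_mono; lra.
  + apply Rle_trans with (kappa / (s / 2) * (kappa / s * (kappa / s * norm x))); [|lra].
    apply Rmult_le_compat_l; [apply Rdiv_le_0_compat; lra|].
    eapply Rle_trans; [now apply resolvent_norm|].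
    apply Rmult_le_compat_l; [apply Rdiv_le_0_compat; lra|]. now apply resolvent_norm.
- rewrite (resolvent_identity y s x) by lra.
  transitivity (plus (scal (y - s) (minus (Rs s (Rs s x)) (Rs y (Rs s x)))) zero).
  + rewrite (resolvent_identity s y (Rs s x)) by lra.
    rewrite (resolvent_commutes y s (Rs s x)) by lra. lin.
  + lin.
Qed.

Lemma resolvent_continuous s x : 0 < s -> continuous (fun s => Rs s x) s.
Proof.
intros Hs. apply (ex_derive_continuous (V := X)). eexists. now apply resolvent_derive.
Qed.

Lemma resolvent_shift_continuous s e x :
  0 < s + e -> continuous (fun s => Rs (s + e) x) s.
Proof.
intros Hs. apply (continuous_comp (fun s => s + e) (fun s => Rs s x)).
- apply (ex_derive_continuous (V := R_NormedModule)). auto_derive. trivial.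
- now apply resolvent_continuous.
Qed.

End Resolvents.

(** * Powers of [A + e I] *)

(* [T e] behaves like [b (A + e I)^k]: it solves the same linear differential
   equation in [e] and has the same asymptotics as [e] tends to infinity. *)
Record power_family {X : CompleteNormedModule R_AbsRing} (A : X -> X)
    (T : R -> X -> X) (k b : R) : Prop := {
  pf_linear : forall e, 0 < e -> is_linear (T e);
  pf_commute : forall e x, 0 < e -> T e (A x) = A (T e x);
  pf_bound : forall a, 0 < a -> exists M, 0 < M /\
    forall e x, a <= e -> norm (T e x) <= M * Rpower e k * norm x;
  pf_derive : forall e x, 0 < e ->
    is_derive (fun e => T e x) e (scal k (resolvent A e (T e x)));
  pf_limit : exists C, 0 <= C /\ forall e x, 1 <= e ->
    norm (minus (scal (Rpower e (- k)) (T e x)) (scal b x)) <= C / e * norm x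
}.

Section PowerFamilies.

Context {X : CompleteNormedModule R_AbsRing} {A : X -> X} {kappa : R}.
Context (HA : resolvent_bound A kappa).
Implicit Types (T : R -> X -> X) (x u : X).

Local Notation Rs := (resolvent A).
Let A_linear : is_linear A := rb_linear A kappa HA.

Lemma pf_continuous T k b e x :
  power_family A T k b -> 0 < e -> continuous (fun e => T e x) e.
Proof.
intros HT He. apply (ex_derive_continuous (V := X)). eexists. now apply (pf_derive A T k b HT).
Qed.

Lemma Rpower_between a e c k : 0 < a -> a <= e <= c -> Rpower e k <= Rpower a k + Rpower c k.
Proof.
intros Ha He. assert (H1 := Rpower_gt_0 a k). assert (H2 := Rpower_gt_0 c k).
destruct (Rle_dec 0 k) as [Hk|Hk].
- assert (Rpower e k <= Rpower c k) by (apply Rle_Rpower_l; lra). lra.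
- assert (Rpower e k <= Rpower a k); [|lra].
  replace k with (- - k) by ring. rewrite !(Rpower_Ropp _ (- k)).
  apply Rinv_le_contravar; [apply Rpower_gt_0|]. apply Rle_Rpower_l; lra.
Qed.

(** A product rule for strong derivatives: [T1] is differentiable at fixed vectors while [T2 e x]
    moves, so the remainder of [T2] is controlled by the local bound on [T1]. Commutation with [A]
    pulls the resolvent out of [T1 e], and the two derivatives add up to the factor [k1 + k2]. *)
Lemma power_family_comp T1 T2 k1 k2 b1 b2 :
  power_family A T1 k1 b1 -> power_family A T2 k2 b2 ->
  power_family A (fun e x => T1 e (T2 e x)) (k1 + k2) (b1 * b2).
Proof.
intros H1 H2. split.
- intros e He. apply (is_linear_comp (T2 e) (T1 e));
    [apply (pf_linear A T2 k2 b2 H2)|apply (pf_linear A T1 k1 b1 H1)]; trivial.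
- intros e x He. rewrite (pf_commute A T2 k2 b2 H2) by trivial. now apply (pf_commute A T1 k1 b1 H1).
- intros a Ha. destruct (pf_bound A T1 k1 b1 H1 a Ha) as [M1 [HM1 HB1]].
  destruct (pf_bound A T2 k2 b2 H2 a Ha) as [M2 [HM2 HB2]].
  exists (M1 * M2). split; [now apply Rmult_lt_0_compat|]. intros e x He.
  eapply Rle_trans; [now apply HB1|]. rewrite Rpower_plus.
  apply Rle_trans with (M1 * Rpower e k1 * (M2 * Rpower e k2 * norm x)); [|right; ring].
  apply Rmult_le_compat_l; [|now apply HB2].
  apply Rmult_le_pos; [lra|left; apply Rpower_gt_0].
- intros e x He. apply is_derive_intro. intros eps Heps.
  set (z := T2 e x). set (w := Rs e z).
  destruct (pf_bound A T1 k1 b1 H1 (e / 2) ltac:(lra)) as [M1 [HM1 HB1]].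
  set (M := M1 * (Rpower (e / 2) k1 + Rpower (2 * e) k1)).
  assert (HM : 0 < M).
  { apply Rmult_lt_0_compat; trivial. apply Rplus_lt_0_compat; apply Rpower_gt_0. }
  assert (HB : forall y' u, Rabs (y' - e) < e / 2 -> norm (T1 y' u) <= M * norm u).
  { intros y' u Hy. apply Rabs_def2 in Hy. eapply Rle_trans; [apply HB1; lra|].
    apply Rmult_le_compat_r; [exact (norm_ge_0 u)|]. apply Rmult_le_compat_l; [lra|].
    apply Rpower_between; lra. }
  assert (HK : 0 < Rabs k2 + 1) by (generalize (Rabs_pos k2); lra).
  destruct (is_derive_elim _ _ _ (pf_derive A T2 k2 b2 H2 e x He) (eps / (3 * M))) as [d2 [Hd2 D2]].
  { apply Rdiv_lt_0_compat; lra. }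
  destruct (is_derive_elim _ _ _ (pf_derive A T1 k1 b1 H1 e z He) (eps / 3)) as [d1 [Hd1 D1]]; [lra|].
  destruct (continuous_elim _ _ (pf_continuous T1 k1 b1 e w H1 He) (eps / (3 * (Rabs k2 + 1)))) as [d3 [Hd3 D3]].
  { apply Rdiv_lt_0_compat; lra. }
  exists (Rmin (e / 2) (Rmin d1 (Rmin d2 d3))). split.
  { repeat apply Rmin_glb_lt; trivial; lra. }
  intros y Hy.
  assert (Hy0 : Rabs (y - e) < e / 2) by (eapply Rlt_le_trans; [exact Hy|apply Rmin_l]).
  assert (Hy' : Rabs (y - e) < Rmin d1 (Rmin d2 d3)) by (eapply Rlt_le_trans; [exact Hy|apply Rmin_r]).
  assert (Hy1 : Rabs (y - e) < d1) by (eapply Rlt_le_trans; [exact Hy'|apply Rmin_l]).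
  assert (Hy'' : Rabs (y - e) < Rmin d2 d3) by (eapply Rlt_le_trans; [exact Hy'|apply Rmin_r]).
  assert (Hy2 : Rabs (y - e) < d2) by (eapply Rlt_le_trans; [exact Hy''|apply Rmin_l]).
  assert (Hy3 : Rabs (y - e) < d3) by (eapply Rlt_le_trans; [exact Hy''|apply Rmin_r]).
  assert (Hye : 0 < y) by (apply Rabs_def2 in Hy0; lra).
  assert (L1 := pf_linear A T1 k1 b1 H1 y Hye).
  specialize (D1 y Hy1). specialize (D2 y Hy2). specialize (D3 y Hy3).
  assert (Ec : Rs e (T1 e z) = T1 e w).
  { unfold w. symmetry. apply (resolvent_commute HA); trivial.
    - now apply (pf_linear A T1 k1 b1 H1).
    - intros u. now apply (pf_commute A T1 k1 b1 H1). }
  cbv beta in D1, D2, D3. rewrite Ec in D1. fold z. rewrite Ec.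
  (* Three errors of size [eps / 3]: the remainder of [T2] under the bounded [T1 y], the strong
     continuity of [T1] at [w], and the remainder of [T1] at [z]. *)
  replace (minus (minus (T1 y (T2 y x)) (T1 e z)) (scal (y - e) (scal (k1 + k2) (T1 e w))))
    with (plus (T1 y (minus (minus (T2 y x) z) (scal (y - e) (scal k2 w))))
           (plus (scal ((y - e) * k2) (minus (T1 y w) (T1 e w)))
              (minus (minus (T1 y z) (T1 e z)) (scal (y - e) (scal k1 (T1 e w)))))).
  2:{ rewrite !(lin_minus (T1 y)), !(lin_scal (T1 y)) by trivial. lin. }
  eapply Rle_trans; [apply norm_plus_le|].
  assert (Ha := Rabs_pos (y - e)).
  assert (E1 : norm (T1 y (minus (minus (T2 y x) z) (scal (y - e) (scal k2 w)))) <= eps / 3 * Rabs (y - e)).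
  { eapply Rle_trans; [now apply HB|].
    apply Rle_trans with (M * (eps / (3 * M) * Rabs (y - e))).
    - apply Rmult_le_compat_l; [lra|]. exact D2.
    - right. field. lra. }
  assert (E2 : norm (scal ((y - e) * k2) (minus (T1 y w) (T1 e w))) <= eps / 3 * Rabs (y - e)).
  { rewrite norm_scal_eq, Rabs_mult.
    apply Rle_trans with (Rabs (y - e) * (Rabs k2 + 1) * (eps / (3 * (Rabs k2 + 1)))).
    - apply Rmult_le_compat; [|exact (norm_ge_0 _)| |lra].
      + apply Rmult_le_pos; apply Rabs_pos.
      + apply Rmult_le_compat_l; lra.
    - right. field. lra. }
  replace (eps * Rabs (y - e))
    with (eps / 3 * Rabs (y - e) + (eps / 3 * Rabs (y - e) + eps / 3 * Rabs (y - e))) by field.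
  apply Rplus_le_compat; [exact E1|]. eapply Rle_trans; [apply norm_plus_le|].
  apply Rplus_le_compat; [exact E2|exact D1].
- destruct (pf_limit A T1 k1 b1 H1) as [C1 [HC1 L1]].
  destruct (pf_limit A T2 k2 b2 H2) as [C2 [HC2 L2]].
  destruct (pf_bound A T1 k1 b1 H1 1 Rlt_0_1) as [M1 [HM1 HB1]].
  exists (M1 * C2 + Rabs b2 * C1). split.
  { apply Rplus_le_le_0_compat; apply Rmult_le_pos; try lra. apply Rabs_pos. }
  intros e x He.
  assert (Ln := pf_linear A T1 k1 b1 H1 e ltac:(lra)).
  (* The error of [T2] passes through [e^(-k1) T1 e], which is bounded by [M1] for [e >= 1]; the
     error of [T1] is multiplied by [b2]. *)
  replace (minus (scal (Rpower e (- (k1 + k2))) (T1 e (T2 e x))) (scal (b1 * b2) x))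
    with (plus (scal (Rpower e (- k1)) (T1 e (minus (scal (Rpower e (- k2)) (T2 e x)) (scal b2 x))))
            (scal b2 (minus (scal (Rpower e (- k1)) (T1 e x)) (scal b1 x)))).
  2:{ rewrite (lin_minus (T1 e)), !(lin_scal (T1 e)) by trivial.
      replace (- (k1 + k2)) with (- k1 + - k2) by ring. rewrite Rpower_plus. lin. }
  eapply Rle_trans; [apply norm_plus_le|]. rewrite !norm_scal_eq.
  replace ((M1 * C2 + Rabs b2 * C1) / e * norm x)
    with (M1 * (C2 / e * norm x) + Rabs b2 * (C1 / e * norm x)) by (field; lra).
  apply Rplus_le_compat.
  + rewrite Rabs_pos_eq by (left; apply Rpower_gt_0).
    eapply Rle_trans.
    { apply Rmult_le_compat_l; [left; apply Rpower_gt_0|]. apply HB1; trivial. }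
    rewrite Rpower_Ropp, Rmult_assoc, <- (Rmult_assoc (/ _)).
    assert (Hp := Rpower_gt_0 e k1).
    replace (/ Rpower e k1 * (M1 * (Rpower e k1 * norm (minus (scal (Rpower e (- k2)) (T2 e x)) (scal b2 x)))))
      with (M1 * norm (minus (scal (Rpower e (- k2)) (T2 e x)) (scal b2 x))) by (field; lra).
    rewrite Rmult_assoc, <- Rmult_assoc.
    replace (/ Rpower e k1 * M1 * (Rpower e k1 * norm (minus (scal (Rpower e (- k2)) (T2 e x)) (scal b2 x))))
      with (M1 * norm (minus (scal (Rpower e (- k2)) (T2 e x)) (scal b2 x))) by (field; lra).
    apply Rmult_le_compat_l; [lra|]. now apply L2.
  + apply Rmult_le_compat_l; [apply Rabs_pos|]. now apply L1.
Qed.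

Lemma power_family_0 T b e x : power_family A T 0 b -> 0 < e -> T e x = scal b x.
Proof.
intros HT He.
assert (Hconst : forall e', e < e' -> T e' x = T e x).
{ intros e' He'. apply minus_eq_zero_eq.
  assert (HI : is_RInt (fun _ : R => zero : X) e e' (minus (T e' x) (T e x))).
  { apply (is_RInt_derive (fun e => T e x)); rewrite Rmin_left, Rmax_right by lra; intros t Ht.
    - replace (zero : X) with (scal 0 (Rs t (T t x))) by lin.
      apply (pf_derive A T 0 b HT). lra.
    - apply continuous_const. }
  assert (HJ := is_RInt_const e e' (zero : X)).
  rewrite <- (is_RInt_unique _ _ _ _ HI), (is_RInt_unique _ _ _ _ HJ). lin. }
apply minus_eq_zero_eq, norm_le_epsilon. intros eps Heps.
destruct (pf_limit A T 0 b HT) as [C [HC L]].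
assert (Hn : 0 <= norm x) by exact (norm_ge_0 x).
assert (Hp : 0 <= C * norm x / eps) by (apply Rdiv_le_0_compat; trivial; now apply Rmult_le_pos).
(* Large enough that the error [C / e' * norm x] at infinity is at most [eps], and beyond both [e]
   and 1. *)
set (e' := e + 1 + C * norm x / eps).
rewrite <- (Hconst e') by (unfold e'; lra).
assert (He' : 1 <= e') by (unfold e'; lra).
specialize (L e' x He'). rewrite Ropp_0, Rpower_O in L by lra.
replace (minus (T e' x) (scal b x)) with (minus (scal 1 (T e' x)) (scal b x)) by lin.
eapply Rle_trans; [exact L|].
apply Rmult_le_reg_r with e'; [lra|].
replace (C / e' * norm x * e') with (eps * (C * norm x / eps)) by (field; lra).
apply Rmult_le_compat_l; unfold e'; lra.
Qed.

Lemma power_family_shift : power_family A (fun e => shift A e) 1 1.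
Proof.
split.
- intros e He. apply (is_linear_ext (fun x => plus (A x) (scal e x))); [reflexivity|].
  split.
  + intros x y. rewrite (lin_plus A) by trivial. lin.
  + intros k x. rewrite (lin_scal A) by trivial. lin_reduce; simpl; ring.
  + destruct (linear_bound A A_linear) as [M [HM HB]]. exists (M + e). split; [lra|].
    intros x. eapply Rle_trans; [apply norm_plus_le|]. rewrite norm_scal_eq, Rabs_pos_eq by lra.
    specialize (HB x). lra.
- intros e x He. unfold shift. now rewrite (lin_plus A), (lin_scal A) by trivial.
- intros a Ha. destruct (linear_bound A A_linear) as [M [HM HB]].
  exists (M / a + 1). split; [assert (0 < M / a) by (now apply Rdiv_lt_0_compat); lra|].
  intros e x He. rewrite Rpower_1 by lra.
  assert (Hn : 0 <= norm x) by exact (norm_ge_0 x).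
  eapply Rle_trans; [apply norm_plus_le|]. rewrite norm_scal_eq, Rabs_pos_eq by lra.
  specialize (HB x). assert (M <= M / a * e).
  { replace M with (M / a * a) at 1 by (field; lra). apply Rmult_le_compat_l; trivial.
    apply Rdiv_le_0_compat; lra. }
  nra.
- intros e x He. apply is_derive_intro. intros eps Heps. exists 1. split; [lra|]. intros y _.
  (* The derivative of [A + e I] is the identity, which fits the equation with exponent 1 as
     [R_e (A + e I)]. *)
  rewrite <- (resolvent_unique HA e x (shift A e x) He eq_refl).
  replace (minus (minus (shift A y x) (shift A e x)) (scal (y - e) (scal 1 x)))
    with (zero : X) by (unfold shift; lin).
  replace (norm (zero : X)) with 0 by (symmetry; exact norm_zero). apply Rmult_le_pos; [lra|apply Rabs_pos].
- destruct (linear_bound A A_linear) as [M [HM HB]]. exists M. split; [lra|]. intros e x He.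
  rewrite Rpower_Ropp, Rpower_1 by lra.
  replace (minus (scal (/ e) (shift A e x)) (scal 1 x)) with (scal (/ e) (A x))
    by (unfold shift; lin).
  rewrite norm_scal_eq, Rabs_pos_eq by (left; apply Rinv_0_lt_compat; lra).
  replace (M / e * norm x) with (/ e * (M * norm x)) by (unfold Rdiv; ring).
  apply Rmult_le_compat_l; [left; apply Rinv_0_lt_compat; lra|]. apply HB.
Qed.

End PowerFamilies.

(* [beta q] times [(A + e I)^(q-1)]. *)
Definition res_int {X : CompleteNormedModule R_AbsRing} (A : X -> X) (q e : R) (x : X) : X :=
  RInt_gen (fun s => scal (Rpower s (q - 1)) (resolvent A (s + e) x))
    (at_right 0) (Rbar_locally p_infty).

Section ResolventIntegrals.

Context {X : CompleteNormedModule R_AbsRing} {A : X -> X} {kappa : R}.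
Context (HA : resolvent_bound A kappa).
Implicit Types (T : X -> X) (x u : X).

Local Notation Rs := (resolvent A).
Local Notation J := (res_int A).
Let A_linear : is_linear A := rb_linear A kappa HA.

Lemma continuous_Rpower c s : 0 < s -> continuous (fun s => Rpower s c) s.
Proof.
intros Hs. apply (ex_derive_continuous (V := R_NormedModule)). unfold Rpower. auto_derive. lra.
Qed.

Lemma res_int_integrand_continuous q e x s :
  0 <= e -> 0 < s -> continuous (fun s => scal (Rpower s (q - 1)) (Rs (s + e) x)) s.
Proof.
intros He Hs. apply (continuous_scal (V := X)).
- now apply continuous_Rpower.
- apply (resolvent_shift_continuous HA). lra.
Qed.

Lemma res_int_spec q e x :
  0 < q < 1 -> 0 < e ->
  impint (fun s => scal (Rpower s (q - 1)) (Rs (s + e) x)) (J q e x) /\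
  norm (J q e x) <= kappa * norm x * (Rpower e (q - 1) * beta q).
Proof.
intros Hq He. assert (Hk := rb_pos A kappa HA).
destruct (ex_impint_power (fun s => scal (Rpower s (q - 1)) (Rs (s + e) x))
            (kappa * norm x) q e Hq He) as [l [Hl1 Hl2]].
- intros s Hs. apply res_int_integrand_continuous; lra.
- intros s Hs. rewrite norm_scal_eq, Rabs_pos_eq by (left; apply Rpower_gt_0).
  replace (kappa * norm x * (Rpower s (q - 1) * / (s + e)))
    with (Rpower s (q - 1) * (kappa / (s + e) * norm x)) by (unfold Rdiv; ring).
  apply Rmult_le_compat_l; [left; apply Rpower_gt_0|]. apply (resolvent_norm HA). lra.
- replace (J q e x) with l; [now split|]. symmetry. now apply impint_RInt_gen.
Qed.

Lemma res_int_linear q e : 0 < q < 1 -> 0 < e -> is_linear (J q e).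
Proof.
intros Hq He. assert (Hk := rb_pos A kappa HA). split.
- intros x u. destruct (res_int_spec q e x Hq He) as [Hx _].
  destruct (res_int_spec q e u Hq He) as [Hu _].
  apply impint_RInt_gen. refine (impint_ext _ _ _ _ (impint_plus _ _ _ _ Hx Hu)).
  intros s Hs. simpl. rewrite (lin_plus (Rs (s + e))); [lin|].
  apply (resolvent_linear HA). lra.
- intros k x. destruct (res_int_spec q e x Hq He) as [Hx _].
  apply impint_RInt_gen. refine (impint_ext _ _ _ _ (impint_scal k _ _ Hx)).
  intros s Hs. simpl. assert (L : is_linear (Rs (s + e))) by (apply (resolvent_linear HA); lra).
  transitivity (scal (Rpower s (q - 1)) (scal (k : R) (Rs (s + e) x))); [lin|].
  f_equal. symmetry. exact (lin_scal (Rs (s + e)) k x L).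
- destruct (beta_spec q Hq) as [_ [Hb _]].
  assert (0 < / q) by (apply Rinv_0_lt_compat; lra).
  exists (kappa * (Rpower e (q - 1) * beta q)). split.
  + repeat apply Rmult_lt_0_compat; trivial; [apply Rpower_gt_0|lra].
  + intros x. destruct (res_int_spec q e x Hq He) as [_ Hx]. lra.
Qed.

Lemma res_int_commute T q e x :
  is_linear T -> (forall u, T (A u) = A (T u)) -> 0 < q < 1 -> 0 < e ->
  T (J q e x) = J q e (T x).
Proof.
intros HT Hc Hq He. symmetry. apply impint_RInt_gen.
destruct (res_int_spec q e x Hq He) as [Hx _].
refine (impint_ext _ _ _ _ (impint_linear T _ _ HT Hx)).
intros s Hs. simpl. rewrite (lin_scal T) by trivial. f_equal.
apply (resolvent_commute HA); trivial. lra.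
Qed.

(* Integrates the derivative of [s^q R_e R_(s+e) x], which vanishes at both ends. *)
Lemma impint_resolvent_sq q e x :
  0 < q < 1 -> 0 < e ->
  impint (fun s => scal (Rpower s (q - 1)) (Rs (s + e) (Rs (s + e) x)))
    (scal (1 - q) (Rs e (J q e x))).
Proof.
intros Hq He. assert (Hk := rb_pos A kappa HA). assert (Le := resolvent_linear HA e He).
set (w := fun s => plus (scal (q * Rpower s (q - 1)) (Rs e (Rs (s + e) x)))
                     (scal (Rpower s q) (Rs e (opp (Rs (s + e) (Rs (s + e) x)))))).
(* After multiplication by [s^q], the first bound gives the limit 0 at the left end and the second,
   since [q < 1], at infinity. *)
assert (Hbound : forall s, 0 < s -> norm (Rs e (Rs (s + e) x)) <= kappa / e * (kappa / e * norm x)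
                                 /\ norm (Rs e (Rs (s + e) x)) <= kappa / e * (kappa * norm x) * / s).
{ intros s Hs. assert (Hx : 0 <= norm x) by exact (norm_ge_0 x).
  assert (Hke : 0 <= kappa / e) by (apply Rdiv_le_0_compat; lra).
  split; (eapply Rle_trans; [now apply (resolvent_norm HA)|]).
  - apply Rmult_le_compat_l; trivial. apply (resolvent_bound_mono HA); lra.
  - rewrite Rmult_assoc. apply Rmult_le_compat_l; trivial.
    replace (kappa * norm x * / s) with (kappa / s * norm x) by (unfold Rdiv; ring).
    apply (resolvent_bound_mono HA); lra. }
assert (Hw : impint w (minus zero zero)).
{ apply (impint_derive (fun s => scal (Rpower s q) (Rs e (Rs (s + e) x)))).
  - intros s Hs.
    assert (D : is_derive (fun s => Rs e (Rs (s + e) x)) s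
                  (Rs e (opp (Rs (s + e) (Rs (s + e) x))))).
    { apply (filterdiff_ext_lin (K := R_AbsRing) (fun s => Rs e (Rs (s + e) x))
               (fun y : R_AbsRing => Rs e (scal y (opp (Rs (s + e) (Rs (s + e) x)))))).
      - apply (filterdiff_comp' (K := R_AbsRing) (V := X) (W := X) (fun s => Rs (s + e) x) (Rs e) s
                 (fun y : R_AbsRing => scal y (opp (Rs (s + e) (Rs (s + e) x)))) (Rs e)).
        + apply (filterdiff_ext_lin (K := R_AbsRing) (fun s => Rs (s + e) x)
                   (fun y : R_AbsRing => scal y (scal 1 (opp (Rs (s + e) (Rs (s + e) x)))))).
          * apply (is_derive_comp (V := X) (fun s => Rs s x) (fun s => s + e)).
            -- apply (resolvent_derive HA). lra.
            -- auto_derive; trivial.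
          * intros y. lin_reduce; ring.
        + now apply filterdiff_linear.
      - intros y. now apply lin_scal. }
    apply (is_derive_scal_fct (fun s => Rpower s q) (fun s => Rs e (Rs (s + e) x))); trivial.
    now apply is_derive_Rpower.
  - intros s Hs. unfold w. apply (continuous_plus (V := X)).
    + apply (continuous_scal (V := X)).
      * apply (ex_derive_continuous (V := R_NormedModule)). unfold Rpower. auto_derive. lra.
      * apply (continuous_comp (fun s => Rs (s + e) x) (Rs e)).
        -- apply (resolvent_shift_continuous HA). lra.
        -- exact (linear_cont (Rs e) _ Le).
    + apply (continuous_scal (V := X)).
      * now apply continuous_Rpower.
      * apply (continuous_comp (fun s => opp (Rs (s + e) (Rs (s + e) x))) (Rs e)).
        -- apply (continuous_opp (V := X)). apply continuous_intro. intros eps Heps.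
           set (M := kappa / e). assert (HM : 0 < M) by (apply Rdiv_lt_0_compat; lra).
           set (z := Rs (s + e) x).
           destruct (continuous_elim _ _ (resolvent_shift_continuous HA s e x ltac:(lra)) (eps / (2 * M)))
             as [d1 [Hd1 D1]]; [apply Rdiv_lt_0_compat; lra|].
           destruct (continuous_elim _ _ (resolvent_shift_continuous HA s e z ltac:(lra)) (eps / 2))
             as [d2 [Hd2 D2]]; [lra|].
           exists (Rmin s (Rmin d1 d2)). split; [repeat apply Rmin_glb_lt; trivial|].
           intros y Hy.
           assert (Hy0 : Rabs (y - s) < s) by (eapply Rlt_le_trans; [exact Hy|apply Rmin_l]).
           assert (Hy' : Rabs (y - s) < Rmin d1 d2) by (eapply Rlt_le_trans; [exact Hy|apply Rmin_r]).
           assert (Hy1 : Rabs (y - s) < d1) by (eapply Rlt_le_trans; [exact Hy'|apply Rmin_l]).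
           assert (Hy2 : Rabs (y - s) < d2) by (eapply Rlt_le_trans; [exact Hy'|apply Rmin_r]).
           apply Rabs_def2 in Hy0. specialize (D1 y Hy1). specialize (D2 y Hy2). cbv beta in D1, D2.
           eapply Rle_trans; [apply (norm_minus_trans (Rs (y + e) z))|].
           replace eps with (M * (eps / (2 * M)) + eps / 2) by (field; lra).
           apply Rplus_le_compat; [|left; exact D2].
           rewrite <- (lin_minus (Rs (y + e))) by (apply (resolvent_linear HA); lra).
           apply Rle_trans with (M * norm (minus (Rs (y + e) x) z)).
           ++ apply (resolvent_bound_mono HA); lra.
           ++ apply Rmult_le_compat_l; [lra|left; exact D1].
        -- exact (linear_cont (Rs e) _ Le).
  - apply (filterlim_at_right_power (V := X) _ zero (kappa / e * (kappa / e * norm x)) q); [lra|].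
    intros s Hs. rewrite Rmult_comm.
    eapply Rle_trans; [right; apply norm_minus_zero|].
    eapply Rle_trans; [apply norm_scal_le|].
    rewrite Rabs_pos_eq by (left; apply Rpower_gt_0).
    apply Rmult_le_compat_l; [left; apply Rpower_gt_0|]. apply Hbound; lra.
  - apply (filterlim_infty_power (V := X) _ zero (kappa / e * (kappa * norm x)) (1 - q)); [lra|].
    intros s Hs.
    eapply Rle_trans; [right; apply norm_minus_zero|].
    eapply Rle_trans; [apply norm_scal_le|].
    rewrite Rabs_pos_eq by (left; apply Rpower_gt_0).
    replace (- (1 - q)) with (q + - (1)) by ring. rewrite Rpower_plus, Rpower_Ropp, Rpower_1 by lra.
    replace (kappa / e * (kappa * norm x) * (Rpower s q * / s))
      with (Rpower s q * (kappa / e * (kappa * norm x) * / s)) by ring.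
    apply Rmult_le_compat_l; [left; apply Rpower_gt_0|]. apply Hbound; lra. }
destruct (res_int_spec q e x Hq He) as [Hx _].
apply (impint_linear (Rs e)) in Hx; trivial. apply (impint_scal (1 - q)) in Hx.
assert (H := impint_plus _ _ _ _ Hw Hx).
replace (scal (1 - q) (Rs e (J q e x)))
  with (plus (minus zero zero) (scal (1 - q) (Rs e (J q e x)))) by lin.
refine (impint_ext _ _ _ _ H). intros s Hs. unfold w.
(* The resolvent identity gains the factor [/ s] that reduces [s^q] to [s^(q-1)], so [w s] becomes
   [s^(q-1) R_(s+e)^2 x - (1-q) s^(q-1) R_e R_(s+e) x]. *)
assert (Es : Rs e (Rs (s + e) (Rs (s + e) x))
             = scal (/ s) (minus (Rs e (Rs (s + e) x)) (Rs (s + e) (Rs (s + e) x)))).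
{ rewrite (resolvent_identity HA e (s + e)) by lra. lin. }
rewrite (lin_opp (Rs e)), (lin_scal (Rs e)), Es by trivial.
rewrite (Rpower_sub_1 s q) by trivial. lin.
Qed.

(** Differentiation under the integral sign produces the integral of [- s^(q-1) R_(s+e)^2], which
    [impint_resolvent_sq] rewrites as [(q-1) R_e J]. At infinity [J] is compared with the scalar
    integral of [s^(q-1) / (s + e)]. *)
Lemma power_family_res_int q : 0 < q < 1 -> power_family A (J q) (q - 1) (beta q).
Proof.
intros Hq. assert (Hk := rb_pos A kappa HA).
destruct (beta_spec q Hq) as [_ [Hb _]].
assert (Hb0 : 0 < beta q).
{ assert (0 < / q) by (apply Rinv_0_lt_compat; lra). lra. }
split.
- intros e He. now apply res_int_linear.
- intros e x He. symmetry. now apply res_int_commute.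
- intros a Ha. exists (kappa * beta q). split; [now apply Rmult_lt_0_compat|].
  intros e x He. destruct (res_int_spec q e x Hq ltac:(lra)) as [_ H]. lra.
- intros e x He. apply is_derive_intro. intros eps Heps.
  assert (Hx : 0 <= norm x) by exact (norm_ge_0 x).
  set (C := kappa / (e / 2) * (kappa / e * (kappa * norm x)) * (Rpower e (q - 1) * beta q) + 1).
  assert (HC0 : 0 <= kappa / (e / 2) * (kappa / e * (kappa * norm x))).
  { repeat apply Rmult_le_pos; trivial; try lra; left; apply Rinv_0_lt_compat; lra. }
  assert (HC : 0 < C).
  { unfold C. assert (Hp := Rpower_gt_0 e (q - 1)).
    assert (0 <= kappa / (e / 2) * (kappa / e * (kappa * norm x)) * (Rpower e (q - 1) * beta q)).
    { apply Rmult_le_pos; trivial. apply Rmult_le_pos; lra. } lra. }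
  exists (Rmin (e / 2) (eps / C)). split.
  { apply Rmin_glb_lt; [lra|]. now apply Rdiv_lt_0_compat. }
  intros y Hy.
  assert (Hy1 : Rabs (y - e) < e / 2) by (eapply Rlt_le_trans; [exact Hy|apply Rmin_l]).
  assert (Hy2 : Rabs (y - e) <= eps / C) by (left; eapply Rlt_le_trans; [exact Hy|apply Rmin_r]).
  apply Rabs_def2 in Hy1.
  destruct (res_int_spec q e x Hq He) as [Ie _].
  destruct (res_int_spec q y x Hq ltac:(lra)) as [Iy _].
  assert (Isq := impint_scal (y - e) _ _ (impint_resolvent_sq q e x Hq He)).
  assert (I := impint_plus _ _ _ _ (impint_minus _ _ _ _ Iy Ie) Isq).
  replace (minus (minus (J q y x) (J q e x)) (scal (y - e) (scal (q - 1) (Rs e (J q e x)))))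
    with (plus (minus (J q y x) (J q e x)) (scal (y - e) (scal (1 - q) (Rs e (J q e x))))) by lin.
  assert (Hle := impintR_scal
     (Rabs (y - e) * Rabs (y - e) * (kappa / (e / 2) * (kappa / e * (kappa * norm x)))) _ _
     (impint_beta_shift q e Hq He)).
  apply Rle_trans with (Rabs (y - e) * Rabs (y - e) * (kappa / (e / 2) * (kappa / e * (kappa * norm x)))
                        * (Rpower e (q - 1) * beta q)).
  + refine (impint_norm_le _ _ _ _ _ I Hle). intros s Hs. cbv beta.
    set (z := Rs (s + e) (Rs (s + e) x)).
    (* As for a single resolvent, the remainder under the integral is exactly
       [(y - e)^2 R_(s+y) R_(s+e)^2 x]. One resolvent keeps the decay [/ (s + e)] needed for
       convergence; the others are bounded uniformly in [s]. *)
    apply Rle_trans with (norm (scal ((y - e) * (y - e) * Rpower s (q - 1)) (Rs (s + y) z)));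
      [right; f_equal|].
    2:{ rewrite norm_scal_eq, !Rabs_mult, (Rabs_pos_eq (Rpower s (q - 1))) by (left; apply Rpower_gt_0).
      replace (Rabs (y - e) * Rabs (y - e) * (kappa / (e / 2) * (kappa / e * (kappa * norm x)))
               * (Rpower s (q - 1) * / (s + e)))
        with (Rabs (y - e) * Rabs (y - e) * Rpower s (q - 1)
              * (kappa / (e / 2) * (kappa / e * (kappa / (s + e) * norm x)))) by (unfold Rdiv; ring).
      apply Rmult_le_compat_l.
      { repeat apply Rmult_le_pos; try apply Rabs_pos. left; apply Rpower_gt_0. }
      apply Rle_trans with (kappa / (e / 2) * norm z); [apply (resolvent_bound_mono HA); lra|].
      apply Rmult_le_compat_l; [apply Rdiv_le_0_compat; lra|].
      apply Rle_trans with (kappa / e * norm (Rs (s + e) x)).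
      { apply (resolvent_bound_mono HA); lra. }
      apply Rmult_le_compat_l; [apply Rdiv_le_0_compat; lra|]. apply (resolvent_norm HA). lra. }
    assert (E1 := resolvent_identity HA (s + y) (s + e) x ltac:(lra) ltac:(lra)).
    assert (E2 := resolvent_identity HA (s + e) (s + y) (Rs (s + e) x) ltac:(lra) ltac:(lra)).
    fold z in E2.
    assert (E3 : Rs (s + e) (Rs (s + y) (Rs (s + e) x)) = Rs (s + y) z)
      by (unfold z; apply (resolvent_commutes HA); lra).
    rewrite E3 in E2.
    transitivity (plus (scal (Rpower s (q - 1)) (scal (s + e - (s + y)) (Rs (s + y) (Rs (s + e) x))))
                    (scal (y - e) (scal (Rpower s (q - 1)) z))).
    * rewrite <- E1. lin.
    * transitivity (scal ((y - e) * Rpower s (q - 1)) (scal (s + y - (s + e)) (Rs (s + y) z))); [|lin].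
      rewrite <- E2. lin.
  + replace (eps * Rabs (y - e)) with (Rabs (y - e) * (eps / C * C)) by (field; lra).
    rewrite 2!Rmult_assoc. apply Rmult_le_compat_l; [apply Rabs_pos|].
    apply Rmult_le_compat; trivial; [apply Rabs_pos| |unfold C; lra].
    apply Rmult_le_pos; trivial. apply Rmult_le_pos; [left; apply Rpower_gt_0|lra].
- destruct (linear_bound A A_linear) as [M [HM HB]].
  exists (kappa * M * beta q). split; [repeat apply Rmult_le_pos; lra|]. intros e x He.
  assert (Hx : 0 <= norm x) by exact (norm_ge_0 x).
  destruct (res_int_spec q e x Hq ltac:(lra)) as [Ie _].
  assert (Ib := impint_beta_shift q e Hq ltac:(lra)).
  assert (Ibx : impint (fun s => scal (Rpower s (q - 1) * / (s + e)) x) (scal (Rpower e (q - 1) * beta q) x)).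
  { exact (impint_linear (V := R_CompleteNormedModule) (fun r => scal r x) _ _
             (is_linear_scal_l x) Ib). }
  assert (I := impint_minus _ _ _ _ Ie Ibx).
  assert (Hle := impintR_scal (kappa * M * norm x / e) _ _ Ib).
  assert (N := fun Hn => impint_norm_le _ _ _ _ Hn I Hle).
  assert (HN : norm (minus (J q e x) (scal (Rpower e (q - 1) * beta q) x))
               <= kappa * M * norm x / e * (Rpower e (q - 1) * beta q)).
  { apply N. intros s Hs. cbv beta.
    (* Here [R_(s+e) x - x / (s+e) = - R_(s+e) A x / (s+e)], and [R_(s+e) A x] supplies the extra
       factor [/ e]. *)
    apply Rle_trans with (norm (scal (- (Rpower s (q - 1) * / (s + e))) (Rs (s + e) (A x))));
      [right; f_equal|].
    - rewrite (resolvent_A HA), (A_resolvent HA) by lra. lin.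
    - assert (Hi : 0 < / (s + e)) by (apply Rinv_0_lt_compat; lra).
      assert (Hp := Rpower_gt_0 s (q - 1)).
      rewrite norm_scal_eq, Rabs_Ropp, Rabs_pos_eq by (left; now apply Rmult_lt_0_compat).
      rewrite Rmult_comm. apply Rmult_le_compat_r; [left; now apply Rmult_lt_0_compat|].
      apply Rle_trans with (kappa / e * norm (A x)); [apply (resolvent_bound_mono HA); lra|].
      replace (kappa * M * norm x / e) with (kappa / e * (M * norm x)) by (unfold Rdiv; ring).
      apply Rmult_le_compat_l; [apply Rdiv_le_0_compat; lra|apply HB]. }
  replace (minus (scal (Rpower e (- (q - 1))) (J q e x)) (scal (beta q) x))
    with (scal (Rpower e (- (q - 1))) (minus (J q e x) (scal (Rpower e (q - 1) * beta q) x))).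
  + rewrite norm_scal_eq, Rabs_pos_eq by (left; apply Rpower_gt_0).
    assert (Hp := Rpower_gt_0 e (q - 1)). rewrite Rpower_Ropp.
    replace (kappa * M * beta q / e * norm x)
      with (/ Rpower e (q - 1) * (kappa * M * norm x / e * (Rpower e (q - 1) * beta q)))
      by (field; split; lra).
    apply Rmult_le_compat_l; [left; now apply Rinv_0_lt_compat|trivial].
  + assert (Hp := Rpower_gt_0 e (q - 1)). rewrite Rpower_Ropp. lin.
Qed.

(** To cancel exponents one needs an inverse of [J (s + t) e]: up to a constant it is [J r e]
    composed with [A + e I], where [r = 1 - s - t]. Both [F1] and [F2] have total exponent 0, and
    [F1] applied to [R_e J_(s+t) x] contains [F2] applied to [x]. *)
Lemma res_int_mult s t e x :
  0 < s -> 0 < t -> s + t < 1 -> 0 < e ->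
  J s e (J t e x) = scal (beta s * beta t / beta (s + t)) (Rs e (J (s + t) e x)).
Proof.
intros Hs Ht Hst He.
assert (Hpos : forall q, 0 < q < 1 -> 0 < beta q).
{ intros q Hq. destruct (beta_spec q Hq) as [_ [Hb _]].
  assert (0 < / q) by (apply Rinv_0_lt_compat; lra). lra. }
set (r := 1 - s - t). assert (Hr : 0 < r < 1) by (unfold r; lra).
assert (Fs := power_family_res_int s ltac:(lra)). assert (Ft := power_family_res_int t ltac:(lra)).
assert (Fst := power_family_res_int (s + t) ltac:(lra)). assert (Fr := power_family_res_int r Hr).
assert (S := power_family_shift HA).
assert (F2 := power_family_comp HA _ _ _ _ _ _ Fr (power_family_comp HA _ _ _ _ _ _ S Fst)).
assert (F1 := power_family_comp HA _ _ _ _ _ _ Fs (power_family_comp HA _ _ _ _ _ _ Ft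
  (power_family_comp HA _ _ _ _ _ _ Fr (power_family_comp HA _ _ _ _ _ _ S S)))).
replace (r - 1 + (1 + (s + t - 1))) with 0 in F2 by (unfold r; ring).
replace (s - 1 + (t - 1 + (r - 1 + (1 + 1)))) with 0 in F1 by (unfold r; ring).
assert (E2 := power_family_0 _ _ e x F2 He).
assert (E1 := power_family_0 _ _ e (Rs e (J (s + t) e x)) F1 He).
cbv beta in E1, E2. rewrite (shift_resolvent HA), E2 in E1 by trivial.
assert (Lt := res_int_linear t e ltac:(lra) He). assert (Ls := res_int_linear s e ltac:(lra) He).
rewrite (lin_scal (J t e)), (lin_scal (J s e)) in E1 by trivial.
assert (P1 := Hpos r Hr). assert (P2 := Hpos (s + t) ltac:(lra)).
transitivity (scal (/ (beta r * (1 * beta (s + t))))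
                (scal (beta r * (1 * beta (s + t))) (J s e (J t e x)))); [lin|].
rewrite E1. lin.
Qed.

End ResolventIntegrals.

(** * Fractional powers *)

(** The integral of [frac_pow01] without its sine factor. It is the limit of [A (res_int A q e u)]
    as [e] decreases to 0, see [frac_int_approx]. *)
Definition frac_int {X : CompleteNormedModule R_AbsRing} (A : X -> X) (q : R) (u : X) : X :=
  RInt_gen (fun s => scal (Rpower s (q - 1)) (resolvent A s (A u)))
    (at_right 0) (Rbar_locally p_infty).

(* Equals [A^q] by Euler's reflection formula, see [gamma]. *)
Definition npow {X : CompleteNormedModule R_AbsRing} (A : X -> X) (q : R) (u : X) : X :=
  if Req_EM_T q 0 then u else scal (/ beta q) (frac_int A q u).

Lemma beta_pos q : 0 < q < 1 -> 0 < beta q.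
Proof.
intros Hq. destruct (beta_spec q Hq) as [_ [Hb _]].
assert (0 < / q) by (apply Rinv_0_lt_compat; lra). lra.
Qed.

Section FractionalPowers.

Context {X : CompleteNormedModule R_AbsRing} {A : X -> X} {kappa : R}.
Context (HA : resolvent_bound A kappa).
Implicit Types (T : X -> X) (x u : X).

Local Notation Rs := (resolvent A).
Local Notation J := (res_int A).
Local Notation B := (frac_int A).
Let A_linear : is_linear A := rb_linear A kappa HA.

Lemma zero_of_power_bound x K m :
  0 < m -> (forall e, 0 < e < 1 -> norm x <= K * Rpower e m) -> x = zero.
Proof.
intros Hm H.
apply (filterlim_locally_unique (V := X) (F := at_right 0) (fun _ => x)).
- apply filterlim_const.
- apply (filterlim_at_right_power (V := X) _ zero K m); trivial. intros s Hs.
  eapply Rle_trans; [right; apply norm_minus_zero|]. auto.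
Qed.

(** Combines the bound [1 + kappa], good for small [s], with [kappa * M / s], good for large [s].
    The resulting [/ (s + 1)] reduces every estimate of [frac_int] to [beta]. *)
Lemma resolvent_A_decay :
  exists D, 0 < D /\ forall s u, 0 < s -> norm (Rs s (A u)) <= D * norm u * / (s + 1).
Proof.
assert (Hk := rb_pos A kappa HA).
destruct (linear_bound A A_linear) as [M [HM HB]].
assert (HkM : 0 < kappa * M) by now apply Rmult_lt_0_compat.
exists (kappa * M + (1 + kappa)). split; [lra|]. intros s u Hs.
assert (Hu : 0 <= norm u) by exact (norm_ge_0 u).
assert (H1 : norm (Rs s (A u)) <= (1 + kappa) * norm u).
{ rewrite (resolvent_A HA) by trivial. now apply (A_resolvent_norm HA). }
assert (H2 : s * norm (Rs s (A u)) <= kappa * M * norm u).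
{ apply Rle_trans with (s * (kappa / s * (M * norm u))).
  - apply Rmult_le_compat_l; [lra|]. eapply Rle_trans; [now apply (resolvent_norm HA)|].
    apply Rmult_le_compat_l; [apply Rdiv_le_0_compat; lra|apply HB].
  - right. field. lra. }
apply Rmult_le_reg_r with (s + 1); [lra|]. rewrite Rmult_assoc, Rinv_l by lra. lra.
Qed.

Lemma frac_int_ex q u :
  0 < q < 1 -> impint (fun s => scal (Rpower s (q - 1)) (Rs s (A u))) (B q u).
Proof.
intros Hq. destruct resolvent_A_decay as [D [HD HDs]].
destruct (ex_impint_power (fun s => scal (Rpower s (q - 1)) (Rs s (A u)))
            (D * norm u) q 1 Hq Rlt_0_1) as [l [Hl1 _]].
- intros s Hs. apply (continuous_scal (V := X)); [now apply continuous_Rpower|].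
  now apply (resolvent_continuous HA).
- intros s Hs. rewrite norm_scal_eq, Rabs_pos_eq by (left; apply Rpower_gt_0).
  replace (D * norm u * (Rpower s (q - 1) * / (s + 1)))
    with (Rpower s (q - 1) * (D * norm u * / (s + 1))) by ring.
  apply Rmult_le_compat_l; [left; apply Rpower_gt_0|]. now apply HDs.
- replace (B q u) with l; trivial. symmetry. now apply impint_RInt_gen.
Qed.

Lemma frac_int_bound :
  exists D, 0 < D /\ forall q u, 0 < q < 1 -> norm (B q u) <= D * beta q * norm u.
Proof.
destruct resolvent_A_decay as [D [HD HDs]]. exists D. split; trivial. intros q u Hq.
destruct (beta_spec q Hq) as [Hb _].
assert (Hle := impintR_scal (D * norm u) _ _ Hb).
apply Rle_trans with (D * norm u * beta q); [|right; ring].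
refine (impint_norm_le _ _ _ _ _ (frac_int_ex q u Hq) Hle). intros s Hs. cbv beta.
rewrite norm_scal_eq, Rabs_pos_eq by (left; apply Rpower_gt_0).
replace (D * norm u * (Rpower s (q - 1) * / (s + 1)))
  with (Rpower s (q - 1) * (D * norm u * / (s + 1))) by ring.
apply Rmult_le_compat_l; [left; apply Rpower_gt_0|]. now apply HDs.
Qed.

Lemma frac_int_linear q : 0 < q < 1 -> is_linear (B q).
Proof.
intros Hq. split.
- intros x u. apply impint_RInt_gen.
  refine (impint_ext _ _ _ _ (impint_plus _ _ _ _ (frac_int_ex q x Hq) (frac_int_ex q u Hq))).
  intros s Hs. cbv beta. assert (L := resolvent_linear HA s Hs).
  rewrite (lin_plus A), (lin_plus (Rs s)) by trivial. lin.
- intros k x. apply impint_RInt_gen.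
  refine (impint_ext _ _ _ _ (impint_scal k _ _ (frac_int_ex q x Hq))).
  intros s Hs. cbv beta. assert (L := resolvent_linear HA s Hs).
  transitivity (scal (Rpower s (q - 1)) (scal (k : R) (Rs s (A x)))); [lin|].
  f_equal. symmetry. transitivity (Rs s (scal (k : R) (A x))).
  + f_equal. exact (lin_scal A k x A_linear).
  + exact (lin_scal (Rs s) k (A x) L).
- destruct frac_int_bound as [D [HD HDq]]. exists (D * beta q). split.
  + apply Rmult_lt_0_compat; trivial. now apply beta_pos.
  + intros x. now apply HDq.
Qed.

Lemma frac_int_commute T q u :
  is_linear T -> (forall x, T (A x) = A (T x)) -> 0 < q < 1 -> T (B q u) = B q (T u).
Proof.
intros HT Hc Hq. symmetry. apply impint_RInt_gen.
refine (impint_ext _ _ _ _ (impint_linear T _ _ HT (frac_int_ex q u Hq))).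
intros s Hs. cbv beta. rewrite (lin_scal T), <- Hc by trivial. f_equal.
now apply (resolvent_commute HA).
Qed.

(* Uses [e / (s + e) <= (e / s)^(q/2)]. *)
Lemma frac_int_approx :
  exists K, 0 < K /\ forall q u e, 0 < q < 1 -> 0 < e ->
    norm (minus (A (J q e u)) (B q u)) <= K * beta (q / 2) * Rpower e (q / 2) * norm u.
Proof.
assert (Hk := rb_pos A kappa HA).
destruct resolvent_A_decay as [D [HD HDs]].
exists (kappa * D). split; [now apply Rmult_lt_0_compat|]. intros q u e Hq He.
destruct (res_int_spec HA q e u Hq He) as [HJ _].
assert (HAJ := impint_linear A _ _ A_linear HJ).
assert (HI := impint_minus _ _ _ _ HAJ (frac_int_ex q u Hq)).
destruct (beta_spec (q / 2) ltac:(lra)) as [Hb _].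
assert (Hle := impintR_scal (kappa * D * norm u * Rpower e (q / 2)) _ _ Hb).
apply Rle_trans with (kappa * D * norm u * Rpower e (q / 2) * beta (q / 2)); [|right; ring].
refine (impint_norm_le _ _ _ _ _ HI Hle). intros s Hs. cbv beta.
apply Rle_trans with (norm (scal (Rpower s (q - 1) * - e) (Rs (s + e) (Rs s (A u))))).
{ right. f_equal. rewrite (lin_scal A) by trivial.
  assert (E := resolvent_identity HA (s + e) s (A u) ltac:(lra) Hs).
  rewrite <- (resolvent_A HA) by lra.
  transitivity (scal (Rpower s (q - 1)) (minus (Rs (s + e) (A u)) (Rs s (A u)))); [lin|].
  rewrite E. lin. }
rewrite norm_scal_eq, Rabs_mult, Rabs_Ropp, (Rabs_pos_eq e), Rabs_pos_eq
  by (try (left; apply Rpower_gt_0); lra).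
assert (Hu : 0 <= norm u) by exact (norm_ge_0 u).
assert (Hse : 0 < / (s + e)) by (apply Rinv_0_lt_compat; lra).
assert (Hs1 : 0 < / (s + 1)) by (apply Rinv_0_lt_compat; lra).
assert (Hr : norm (Rs (s + e) (Rs s (A u))) <= kappa / (s + e) * (D * norm u * / (s + 1))).
{ eapply Rle_trans; [apply (resolvent_norm HA); lra|].
  apply Rmult_le_compat_l; [apply Rdiv_le_0_compat; lra|now apply HDs]. }
(* The exponent must stay below [q] for integrability at 0; the choice [q / 2] turns [s^(q-1)] into
   [s^(q/2 - 1)] and the integral into [beta (q / 2)]. *)
assert (Hfrac : e * / (s + e) <= Rpower e (q / 2) * Rpower s (- (q / 2))).
{ rewrite <- Rpower_inv_base, Rpower_mult_distr by (trivial; now apply Rinv_0_lt_compat).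
  destruct (Rle_dec e s) as [Hes|Hes].
  - apply Rle_trans with (e * / s).
    + apply Rmult_le_compat_l; [lra|]. apply Rinv_le_contravar; lra.
    + assert (H01 : 0 < e * / s <= 1).
      { split; [apply Rmult_lt_0_compat; trivial; now apply Rinv_0_lt_compat|].
        apply Rmult_le_reg_r with s; trivial. rewrite Rmult_assoc, Rinv_l; lra. }
      rewrite (Rpower_sub_1 (e * / s) (q / 2)) by lra.
      rewrite <- (Rmult_1_r (e * / s)) at 1. apply Rmult_le_compat_l; [lra|].
      replace (q / 2 - 1) with (- (1 - q / 2)) by ring. rewrite Rpower_Ropp, <- Rinv_1 at 1.
      apply Rinv_le_contravar; [apply Rpower_gt_0|]. apply Rpower_le_1; lra.
  - apply Rle_trans with 1.
    + apply Rmult_le_reg_r with (s + e); [lra|]. rewrite Rmult_assoc, Rinv_l; lra.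
    + apply Rpower_ge_1; [|lra]. apply Rmult_le_reg_r with s; trivial.
      rewrite Rmult_assoc, Rinv_l; lra. }
apply Rle_trans with (Rpower s (q - 1) * e * (kappa / (s + e) * (D * norm u * / (s + 1)))).
{ apply Rmult_le_compat_l; trivial. apply Rmult_le_pos; [left; apply Rpower_gt_0|lra]. }
replace (q / 2 - 1) with ((q - 1) + - (q / 2)) by field. rewrite Rpower_plus.
replace (Rpower s (q - 1) * e * (kappa / (s + e) * (D * norm u * / (s + 1))))
  with (kappa * D * norm u * Rpower s (q - 1) * / (s + 1) * (e * / (s + e))) by (unfold Rdiv; ring).
replace (kappa * D * norm u * Rpower e (q / 2) * (Rpower s (q - 1) * Rpower s (- (q / 2)) * / (s + 1)))
  with (kappa * D * norm u * Rpower s (q - 1) * / (s + 1) * (Rpower e (q / 2) * Rpower s (- (q / 2)))) by ring.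
apply Rmult_le_compat_l; trivial.
repeat apply Rmult_le_pos; try lra. left; apply Rpower_gt_0.
Qed.

Lemma Rpower_exp_mono e a b : 0 < e < 1 -> a <= b -> Rpower e b <= Rpower e a.
Proof.
intros He Hab. replace b with (a + (b - a)) by ring. rewrite Rpower_plus.
rewrite <- (Rmult_1_r (Rpower e a)) at 2. apply Rmult_le_compat_l; [left; apply Rpower_gt_0|].
apply Rpower_le_1; lra.
Qed.

(** For [e > 0] the products [A J] satisfy this law up to a factor [A R_e]. The four estimates [X1]
    to [X4] replace each [A J] by its limit and remove [A R_e], all at the rate [e^m]. *)
Lemma frac_int_mult s t u :
  0 < s -> 0 < t -> s + t < 1 ->
  B s (B t u) = scal (beta s * beta t / beta (s + t)) (B (s + t) u).
Proof.
intros Hs Ht Hst. assert (Hk := rb_pos A kappa HA).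
set (C := beta s * beta t / beta (s + t)).
destruct frac_int_bound as [D [HD HDq]]. destruct frac_int_approx as [K [HK HKq]].
assert (Hu : 0 <= norm u) by exact (norm_ge_0 u).
(* A common rate: the errors are of order [e^(s/2)], [e^(t/2)], [e^((s+t)/2)] and [e^(s+t)]. *)
set (m := Rmin s t / 2).
assert (Hm : 0 < m) by (unfold m; assert (0 < Rmin s t) by (now apply Rmin_glb_lt); lra).
assert (Hms : m <= s / 2) by (unfold m; assert (H := Rmin_l s t); lra).
assert (Hmt : m <= t / 2) by (unfold m; assert (H := Rmin_r s t); lra).
assert (Hbeta : forall q, 0 < q < 1 -> 0 < beta q) by apply beta_pos.
assert (Bs := Hbeta s ltac:(lra)). assert (Bt := Hbeta t ltac:(lra)).
assert (Bst := Hbeta (s + t) ltac:(lra)).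
assert (Bs2 := Hbeta (s / 2) ltac:(lra)). assert (Bt2 := Hbeta (t / 2) ltac:(lra)).
assert (Bst2 := Hbeta ((s + t) / 2) ltac:(lra)).
set (cs := K * beta (s / 2)). set (ct := K * beta (t / 2)). set (cst := K * beta ((s + t) / 2)).
assert (Hcs : 0 < cs) by now apply Rmult_lt_0_compat.
assert (Hct : 0 < ct) by now apply Rmult_lt_0_compat.
assert (Hcst : 0 < cst) by now apply Rmult_lt_0_compat.
apply minus_eq_zero_eq.
apply zero_of_power_bound with
  (m := m) (K := (D * beta s * ct + cs * (D * beta t + ct)
     + Rabs C * ((1 + kappa) * cst + (kappa * cst + (1 + kappa) * (kappa * beta (s + t))))) * norm u); trivial.
intros e He.
assert (Happ : forall q x, 0 < q < 1 -> m <= q / 2 ->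
          norm (minus (A (J q e x)) (B q x)) <= K * beta (q / 2) * Rpower e m * norm x).
{ intros q x Hq Hmq. eapply Rle_trans; [apply HKq; lra|].
  apply Rmult_le_compat_r; [exact (norm_ge_0 x)|]. apply Rmult_le_compat_l.
  - assert (H := Hbeta (q / 2) ltac:(lra)). apply Rmult_le_pos; lra.
  - now apply Rpower_exp_mono. }
assert (Ls := frac_int_linear s ltac:(lra)).
assert (Le := resolvent_linear HA e ltac:(lra)).
assert (Ljs := res_int_linear HA s e ltac:(lra) ltac:(lra)).
assert (Em0 := Rpower_gt_0 e m).
assert (Em1 : Rpower e m <= 1) by (apply Rpower_le_1; lra).
set (y := A (J t e u)). set (z := A (J (s + t) e u)). set (b := B (s + t) u).
assert (Ez : A (J s e y) = scal C (A (Rs e z))).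
{ unfold y, z. rewrite <- (res_int_commute HA A) by (trivial; lra).
  rewrite (res_int_mult HA) by lra. fold C. rewrite !(lin_scal A) by trivial.
  f_equal. f_equal. rewrite (resolvent_A HA) by lra. reflexivity. }
assert (Ny : norm (minus y (B t u)) <= ct * Rpower e m * norm u) by (apply Happ; lra).
assert (Nz : norm (minus z b) <= cst * Rpower e m * norm u) by (apply Happ; lra).
assert (Ny1 : norm y <= (D * beta t + ct) * norm u).
{ eapply Rle_trans; [apply (norm_le_minus y (B t u))|].
  assert (H := HDq t u ltac:(lra)).
  assert (ct * Rpower e m * norm u <= ct * norm u).
  { apply Rmult_le_compat_r; trivial. rewrite <- (Rmult_1_r ct) at 2. apply Rmult_le_compat_l; lra. }
  lra. }
assert (X1 : norm (minus (B s (B t u)) (B s y)) <= D * beta s * ct * norm u * Rpower e m).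
{ rewrite <- (lin_minus (B s)) by trivial. eapply Rle_trans; [apply HDq; lra|].
  rewrite norm_minus_sym.
  replace (D * beta s * ct * norm u * Rpower e m)
    with (D * beta s * (ct * Rpower e m * norm u)) by ring.
  apply Rmult_le_compat_l; trivial. apply Rmult_le_pos; lra. }
assert (X2 : norm (minus (B s y) (A (J s e y))) <= cs * (D * beta t + ct) * norm u * Rpower e m).
{ rewrite norm_minus_sym. eapply Rle_trans; [apply Happ; lra|]. fold cs.
  replace (cs * (D * beta t + ct) * norm u * Rpower e m)
    with (cs * Rpower e m * ((D * beta t + ct) * norm u)) by ring.
  apply Rmult_le_compat_l; trivial. apply Rmult_le_pos; lra. }
assert (X3 : norm (minus (A (Rs e z)) (A (Rs e b))) <= (1 + kappa) * cst * norm u * Rpower e m).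
{ rewrite <- (lin_minus A), <- (lin_minus (Rs e)) by trivial.
  eapply Rle_trans; [apply (A_resolvent_norm HA); lra|].
  replace ((1 + kappa) * cst * norm u * Rpower e m)
    with ((1 + kappa) * (cst * Rpower e m * norm u)) by ring.
  apply Rmult_le_compat_l; trivial. lra. }
(* [A R_e b - b = - e R_e b], which is small because [b] is close to [z = A J_(s+t) u]: the norm of
   [e R_e A J_(s+t) u] is [O(e e^(s+t-1))]. *)
assert (X4 : norm (minus (A (Rs e b)) b)
             <= (kappa * cst + (1 + kappa) * (kappa * beta (s + t))) * norm u * Rpower e m).
{ rewrite (A_resolvent HA) by lra.
  replace (minus (minus b (scal e (Rs e b))) b)
    with (minus (scal e (Rs e (minus z b))) (scal e (Rs e z)))
    by (rewrite (lin_minus (Rs e)) by trivial; lin).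
  eapply Rle_trans; [apply norm_minus_le|].
  rewrite Rmult_plus_distr_r, Rmult_plus_distr_r. rewrite !norm_scal_eq, Rabs_pos_eq by lra.
  apply Rplus_le_compat.
  - apply Rle_trans with (e * (kappa / e * norm (minus z b))).
    + apply Rmult_le_compat_l; [lra|]. apply (resolvent_norm HA). lra.
    + replace (e * (kappa / e * norm (minus z b))) with (kappa * norm (minus z b)) by (field; lra).
      replace (kappa * cst * norm u * Rpower e m) with (kappa * (cst * Rpower e m * norm u)) by ring.
      apply Rmult_le_compat_l; lra.
  - unfold z. rewrite (resolvent_A HA) by lra.
    apply Rle_trans with (e * ((1 + kappa) * (kappa * norm u * (Rpower e (s + t - 1) * beta (s + t))))).
    + apply Rmult_le_compat_l; [lra|]. eapply Rle_trans; [apply (A_resolvent_norm HA); lra|].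
      apply Rmult_le_compat_l; [lra|]. apply (res_int_spec HA); lra.
    + replace (e * ((1 + kappa) * (kappa * norm u * (Rpower e (s + t - 1) * beta (s + t)))))
        with ((1 + kappa) * (kappa * beta (s + t)) * norm u * (e * Rpower e (s + t - 1))) by ring.
      rewrite <- Rpower_sub_1 by lra. apply Rmult_le_compat_l.
      * repeat apply Rmult_le_pos; lra.
      * apply Rpower_exp_mono; lra. }
replace (minus (B s (B t u)) (scal C b))
  with (plus (minus (B s (B t u)) (B s y)) (plus (minus (B s y) (A (J s e y)))
          (scal C (plus (minus (A (Rs e z)) (A (Rs e b))) (minus (A (Rs e b)) b)))))
  by (rewrite Ez; lin).
replace ((D * beta s * ct + cs * (D * beta t + ct)
     + Rabs C * ((1 + kappa) * cst + (kappa * cst + (1 + kappa) * (kappa * beta (s + t))))) * norm u * Rpower e m)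
  with (D * beta s * ct * norm u * Rpower e m + (cs * (D * beta t + ct) * norm u * Rpower e m
    + Rabs C * ((1 + kappa) * cst * norm u * Rpower e m
        + (kappa * cst + (1 + kappa) * (kappa * beta (s + t))) * norm u * Rpower e m))) by ring.
eapply Rle_trans; [apply norm_plus_le|]. apply Rplus_le_compat; trivial.
eapply Rle_trans; [apply norm_plus_le|]. apply Rplus_le_compat; trivial.
rewrite norm_scal_eq. apply Rmult_le_compat_l; [apply Rabs_pos|].
eapply Rle_trans; [apply norm_plus_le|]. now apply Rplus_le_compat.
Qed.

Lemma npow_linear q : 0 <= q < 1 -> is_linear (npow A q).
Proof.
intros Hq. unfold npow. destruct (Req_EM_T q 0) as [H0|H0].
- apply is_linear_id.
- assert (L := frac_int_linear q ltac:(lra)).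
  apply (is_linear_comp (B q) (fun x => scal (/ beta q) x)); trivial.
  apply (is_linear_scal_r (V := X)). exact Rmult_comm.
Qed.

Lemma npow_commute T q u :
  is_linear T -> (forall x, T (A x) = A (T x)) -> 0 <= q < 1 ->
  T (npow A q u) = npow A q (T u).
Proof.
intros HT Hc Hq. unfold npow. destruct (Req_EM_T q 0) as [H0|H0]; trivial.
rewrite (lin_scal T) by trivial. f_equal. apply frac_int_commute; trivial. lra.
Qed.

Lemma npow_plus s t u :
  0 <= s -> 0 <= t -> s + t < 1 -> npow A s (npow A t u) = npow A (s + t) u.
Proof.
intros Hs Ht Hst. unfold npow at 1 3. destruct (Req_EM_T s 0) as [->|Hs0].
{ rewrite Rplus_0_l. unfold npow. now destruct (Req_EM_T t 0). }
unfold npow. destruct (Req_EM_T t 0) as [->|Ht0].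
{ rewrite Rplus_0_r. now destruct (Req_EM_T s 0). }
destruct (Req_EM_T (s + t) 0); [lra|].
rewrite (lin_scal (B s)) by (apply frac_int_linear; lra).
rewrite frac_int_mult by lra.
assert (Bs := beta_pos s ltac:(lra)). assert (Bt := beta_pos t ltac:(lra)).
assert (Bst := beta_pos (s + t) ltac:(lra)). lin.
Qed.

End FractionalPowers.

(** * Logarithmic decay *)

(** The value at 0 is set apart because the integral defining [beta 0] diverges. *)
Definition npow_coef (q : R) : R := if Req_EM_T q 0 then 1 else gamma q.

Lemma frac_pow_npow {X : CompleteNormedModule R_AbsRing} (A : X -> X) (m : nat) (t : R) (u : X) :
  0 <= t < 1 ->
  frac_pow A (INR m + t) u = scal (npow_coef t) (npow A t (Nat.iter m A u)).
Proof.
intros Ht.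
assert (Hi : Int_part (INR m + t) = Z.of_nat m).
{ symmetry. apply Int_part_spec. rewrite <- INR_IZR_INZ. lra. }
assert (Hf : frac_part (INR m + t) = t).
{ unfold frac_part. rewrite Hi, <- INR_IZR_INZ. ring. }
unfold frac_pow, npow_coef, npow. rewrite Hi, Hf, Nat2Z.id.
destruct (Req_EM_T t 0) as [H0|H0]; [lin|].
assert (Hb := beta_pos t ltac:(lra)).
unfold frac_pow01. fold (frac_int A t (Nat.iter m A u)). unfold gamma.
assert (HPI := PI_RGT_0). lin.
Qed.

Lemma INR_floor q : 0 <= q -> exists m t, q = INR m + t /\ 0 <= t < 1.
Proof.
intros Hq. destruct (nfloor_ex q Hq) as [m Hm]. exists m, (q - INR m). split; [ring|lra].
Qed.

Lemma npow_coef_lower t t1 :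
  0 <= t <= t1 -> t1 < 1 -> cos (PI * t1 / 2) / 4 <= npow_coef t /\ 0 < cos (PI * t1 / 2).
Proof.
intros Ht Ht1. unfold npow_coef. destruct (Req_EM_T t 0) as [H0|H0].
- assert (Hc := COS_bound (PI * t1 / 2)). assert (HPI := PI_RGT_0). split; [lra|].
  apply cos_gt_0; nra.
- apply gamma_lower; lra.
Qed.

(** With [L = ln (1 / a)] the exponential is [a^h], so any power of the logarithm is absorbed by an
    arbitrarily small power of [a]. Each induction step spends half of the exponent on one factor
    [L]. *)
Lemma pow_exp_bounded (n : nat) (h : R) :
  0 < h -> exists C, 0 <= C /\ forall L, 0 <= L -> L ^ n * exp (- (h * L)) <= C.
Proof.
revert h; induction n as [|n IH]; intros h Hh.
- exists 1. split; [lra|]. intros L HL. rewrite pow_O, Rmult_1_l, <- exp_0.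
  destruct (Req_dec L 0) as [->|H0]; [right; f_equal; ring|].
  left. apply exp_increasing. assert (0 < h * L) by (apply Rmult_lt_0_compat; lra). lra.
- destruct (IH (h / 2)) as [C [HC HCL]]; [lra|].
  exists (C * (2 / h)). split; [apply Rmult_le_pos; trivial; apply Rdiv_le_0_compat; lra|].
  intros L HL.
  replace (- (h * L)) with (- (h / 2 * L) + - (h / 2 * L)) by field. rewrite exp_plus.
  replace (L ^ S n * (exp (- (h / 2 * L)) * exp (- (h / 2 * L))))
    with (L ^ n * exp (- (h / 2 * L)) * (L * exp (- (h / 2 * L)))) by (simpl; ring).
  assert (Hp := exp_pos (- (h / 2 * L))).
  apply Rmult_le_compat; auto.
  + apply Rmult_le_pos; [now apply pow_le|lra].
  + apply Rmult_le_pos; lra.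
  + rewrite exp_Ropp. assert (He := exp_ineq1_le (h / 2 * L)).
    assert (0 <= h / 2 * L) by (apply Rmult_le_pos; lra).
    apply Rmult_le_reg_r with (exp (h / 2 * L)); [apply exp_pos|].
    rewrite Rmult_assoc, Rinv_l by (apply Rgt_not_eq, exp_pos).
    apply Rle_trans with (2 / h * (h / 2 * L)); [right; field; lra|].
    apply Rmult_le_compat_l; [apply Rdiv_le_0_compat; lra|lra].
Qed.

(** One [N] bounds the vector and all its iterated logarithms. The recursion exposes the first
    logarithm, which the induction on decay consumes, whereas [is_log_iter] exposes the last one. *)
Fixpoint log_chain {X : CompleteNormedModule R_AbsRing} (A : X -> X) (n : nat) (N : R) (x : X) : Prop :=
  norm x <= N /\
  match n with
  | O => True
  | S n => exists y, is_log A x y /\ log_chain A n N y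
  end.

Section Logarithm.

Context {X : CompleteNormedModule R_AbsRing} {A : X -> X} {kappa : R}.
Context (HA : resolvent_bound A kappa).
Implicit Types (T : X -> X) (x y u : X).

Let A_linear : is_linear A := rb_linear A kappa HA.

Lemma iter_linear m : is_linear (Nat.iter m A).
Proof.
induction m as [|m IH]; [apply is_linear_id|].
exact (is_linear_comp (Nat.iter m A) A IH A_linear).
Qed.

Lemma iter_commute T m x :
  (forall u, T (A u) = A (T u)) -> T (Nat.iter m A x) = Nat.iter m A (T x).
Proof. intros Hc. induction m as [|m IH]; trivial. simpl. now rewrite Hc, IH. Qed.

Lemma frac_pow_commute T q x :
  is_linear T -> (forall u, T (A u) = A (T u)) -> 0 <= q ->
  T (frac_pow A q x) = frac_pow A q (T x).
Proof.
intros HT Hc Hq. destruct (INR_floor q Hq) as [m [t [-> Ht]]].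
rewrite !frac_pow_npow, (lin_scal T), (npow_commute HA T), (iter_commute T) by trivial.
reflexivity.
Qed.

Lemma frac_pow_linear q : 0 <= q -> is_linear (frac_pow A q).
Proof.
intros Hq. destruct (INR_floor q Hq) as [m [t [-> Ht]]].
apply (is_linear_ext (fun x => scal (npow_coef t) (npow A t (Nat.iter m A x)))).
- intros x. now rewrite frac_pow_npow.
- apply (is_linear_comp (fun x => npow A t (Nat.iter m A x)) (fun x => scal (npow_coef t) x)).
  + apply (is_linear_comp (Nat.iter m A) (npow A t)); [apply iter_linear|].
    now apply (npow_linear HA).
  + apply (is_linear_scal_r (V := X)). exact Rmult_comm.
Qed.

Lemma frac_pow_A q x : 0 <= q -> frac_pow A (q + 1) x = A (frac_pow A q x).
Proof.
intros Hq. destruct (INR_floor q Hq) as [m [t [-> Ht]]].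
replace (INR m + t + 1) with (INR (S m) + t) by (rewrite S_INR; ring).
rewrite !frac_pow_npow, (lin_scal A), (npow_commute HA A) by trivial. reflexivity.
Qed.

Lemma is_log_elim x y :
  is_log A x y -> forall eps, 0 < eps -> exists d, 0 < d /\ forall h, 0 < h < d ->
    norm (minus (minus (frac_pow A h x) x) (scal h y)) <= eps * h.
Proof.
intros H eps He.
destruct (proj1 (filterlim_locally_ball_norm (U := X) _ y) H (mkposreal eps He)) as [d Hd].
exists d. split; [apply cond_pos|]. intros h Hh.
assert (Hb : norm (minus (scal (/ h) (minus (frac_pow A h x) x)) y) < eps).
{ apply Hd; [|apply Hh]. change (Rabs (h - 0) < d). rewrite Rminus_0_r, Rabs_pos_eq; lra. }
replace (minus (minus (frac_pow A h x) x) (scal h y))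
  with (scal h (minus (scal (/ h) (minus (frac_pow A h x) x)) y)) by lin.
rewrite norm_scal_eq, Rabs_pos_eq, Rmult_comm by lra. apply Rmult_le_compat_r; lra.
Qed.

Lemma is_log_npow x y :
  is_log A x y -> forall eps, 0 < eps -> exists d, 0 < d /\ forall h, 0 < h < d ->
    norm (minus (minus (npow A h x) x) (scal h y)) <= eps * h.
Proof.
intros H eps He. destruct (is_log_elim x y H (eps / 4)) as [d [Hd HD]]; [lra|].
assert (Hx : 0 <= norm x) by exact (norm_ge_0 x).
assert (Hy : 0 <= norm y) by exact (norm_ge_0 y).
(* [K] bounds [x + h y]. The threshold [1 / 8] gives [gamma h >= 1 / 2], and [eps / (120 * K)] makes
   the error [60 * h^2 * K] from [gamma h - 1 = O(h^2)] at most [eps / 2 * h]. *)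
set (K := norm x + norm y + 1). assert (HK : 0 < K) by (unfold K; lra).
exists (Rmin d (Rmin (1 / 8) (eps / (120 * K)))). split.
{ repeat apply Rmin_glb_lt; trivial; [lra|]. apply Rdiv_lt_0_compat; lra. }
intros h [Hh0 Hh].
assert (Hh1 : h < d) by (eapply Rlt_le_trans; [exact Hh|apply Rmin_l]).
assert (Hh' : h < Rmin (1 / 8) (eps / (120 * K))) by (eapply Rlt_le_trans; [exact Hh|apply Rmin_r]).
assert (Hh2 : h < 1 / 8) by (eapply Rlt_le_trans; [exact Hh'|apply Rmin_l]).
assert (Hh3 : h < eps / (120 * K)) by (eapply Rlt_le_trans; [exact Hh'|apply Rmin_r]).
specialize (HD h (conj Hh0 Hh1)).
replace h with (INR 0 + h) in HD at 1 by (simpl; ring).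
rewrite frac_pow_npow in HD by lra. simpl in HD. unfold npow_coef in HD.
destruct (Req_EM_T h 0) as [H0|H0]; [lra|].
assert (Hg := gamma_near_0 h ltac:(lra)). apply Rabs_le_between in Hg.
set (g := gamma h) in *. assert (Hh4 : 0 < h ^ 2 <= / 64) by (split; nra).
assert (Hg2 : 1 / 2 <= g) by lra.
replace (minus (minus (npow A h x) x) (scal h y))
  with (plus (scal (/ g) (minus (minus (scal g (npow A h x)) x) (scal h y)))
          (scal ((1 - g) / g) (plus x (scal h y)))) by lin.
assert (Hig : 0 < / g <= 2).
{ split; [apply Rinv_0_lt_compat; lra|].
  replace 2 with (/ (1 / 2)) by field. apply Rinv_le_contravar; lra. }
eapply Rle_trans; [apply norm_plus_le|]. rewrite 2!norm_scal_eq.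
replace (eps * h) with (2 * (eps / 4 * h) + eps / 2 * h) by field.
apply Rplus_le_compat.
- rewrite Rabs_pos_eq by lra. apply Rmult_le_compat; trivial; [lra|exact (norm_ge_0 _)|lra].
- assert (Hn : norm (plus x (scal h y)) <= K).
  { eapply Rle_trans; [apply norm_plus_le|]. rewrite norm_scal_eq, Rabs_pos_eq by lra.
    unfold K. nra. }
  assert (Hr : Rabs ((1 - g) / g) <= 60 * h ^ 2).
  { unfold Rdiv. rewrite Rabs_mult, (Rabs_pos_eq (/ g)) by lra.
    apply Rle_trans with (30 * h ^ 2 * 2); [|lra].
    apply Rmult_le_compat; try lra; [apply Rabs_pos|]. apply Rabs_le; lra. }
  apply Rle_trans with (60 * h ^ 2 * K).
  + apply Rmult_le_compat; trivial; [apply Rabs_pos|exact (norm_ge_0 _)].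
  + apply Rle_trans with (60 * K * h * h); [right; ring|].
    apply Rmult_le_compat_r; [lra|].
    apply Rle_trans with (60 * K * (eps / (120 * K))).
    * apply Rmult_le_compat_l; lra.
    * right. field. lra.
Qed.

Lemma is_log_commute T x y :
  is_linear T -> (forall u, T (A u) = A (T u)) -> is_log A x y -> is_log A (T x) (T y).
Proof.
intros HT Hc H. unfold is_log.
apply filterlim_within_ext with (f := fun h => T (scal (/ h) (minus (frac_pow A h x) x))).
- intros h Hh. rewrite (lin_scal T), (lin_minus T), (frac_pow_commute T) by (trivial; lra).
  reflexivity.
- eapply filterlim_comp; [exact H|]. exact (linear_cont T y HT).
Qed.

(** Meant for [T = S_a], which commutes with [A] and is bounded by [e 0]: [S_a v] inherits the chain
    of [v] with a bound independent of [a]. *)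
Lemma log_chain_commute T n N c x :
  is_linear T -> (forall u, T (A u) = A (T u)) -> (forall u, norm (T u) <= c * norm u) -> 0 <= c ->
  log_chain A n N x -> log_chain A n (c * N) (T x).
Proof.
intros HT Hc Hn Hc0. revert x; induction n as [|n IH]; intros x [Hx H]; split.
- eapply Rle_trans; [apply Hn|]. now apply Rmult_le_compat_l.
- trivial.
- eapply Rle_trans; [apply Hn|]. now apply Rmult_le_compat_l.
- destruct H as [y [Hy1 Hy2]]. exists (T y). split; auto. now apply is_log_commute.
Qed.

Lemma log_chain_le n N N' x : N <= N' -> log_chain A n N x -> log_chain A n N' x.
Proof.
intros HN. revert x; induction n as [|n IH]; intros x [Hx H]; split; try lra; trivial.
destruct H as [y [Hy1 Hy2]]. exists y. auto.
Qed.

(** Reassociates the composition: the logarithm taken off the end of [is_log_iter] is prepended to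
    the chain already built, which is the accumulator of length [m]. *)
Lemma log_chain_iter n m N u w :
  is_log_iter A n u w -> log_chain A m N w -> exists N', log_chain A (n + m) N' u.
Proof.
revert m N w; induction n as [|n IH]; intros m N w.
- intros -> H. now exists N.
- intros [v [Hv Hw]] H.
  destruct (IH (S m) (Rmax (norm v) N) v Hv) as [N' HN'].
  + split; [apply Rmax_l|]. exists w. split; trivial. apply log_chain_le with N; trivial.
    apply Rmax_r.
  + exists N'. now replace (S n + m)%nat with (n + S m)%nat by lia.
Qed.

Lemma dom_log_iter_chain n u : dom_log_iter A n u -> exists N, 0 < N /\ log_chain A n N u.
Proof.
intros [w Hw]. destruct (log_chain_iter n 0 (norm w) u w Hw) as [N HN].
- split; trivial. lra.
- rewrite Nat.add_0_r in HN. exists (Rmax 1 N). split.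
  + apply Rlt_le_trans with 1; [lra|apply Rmax_l].
  + apply log_chain_le with N; trivial. apply Rmax_r.
Qed.

(** Abstracts [a^(-m) S_a A^(m+t)], up to scalar factors, with [m] fixed and [t] moving in an
    interval inside [[0, 1)], where [npow_plus] is available. *)
Record decay_family (M t0 t1 a : R) (F : R -> X -> X) : Prop := {
  df_linear : forall t, t0 <= t <= t1 -> is_linear (F t);
  df_npow : forall t h x, t0 <= t -> 0 < h -> t + h <= t1 -> F t (npow A h x) = F (t + h) x;
  df_bound : forall t x, t0 <= t <= t1 -> norm (F t x) <= M * Rpower a t * norm x
}.

(* Telescoping over a subdivision of [t, t + h]: the generator turns
   [F r x - F (r + tau) x] into [- tau F r y] up to [o(tau)], and
   [tau a^r <= (1 / ln (1/a) + tau) (a^r - a^(r + tau))]. *)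
Lemma decay_step M t0 t1 a F x y t h K :
  0 < a < 1 -> 0 <= M -> 0 <= K -> decay_family M t0 t1 a F -> is_log A x y ->
  t0 <= t -> 0 < h -> t + h <= t1 ->
  (forall r, t <= r <= t + h -> norm (F r y) <= K * Rpower a r) ->
  norm (F t x) <= M * Rpower a (t + h) * norm x + K * Rpower a t / ln (1 / a).
Proof.
intros Ha HM HK HF Hlog Ht0 Hh Hth HFy.
assert (Hx : 0 <= norm x) by exact (norm_ge_0 x).
set (L := ln (1 / a)).
assert (HL : 0 < L).
{ unfold L. rewrite <- ln_1. apply ln_increasing; [lra|]. apply Rlt_div_r; lra. }
assert (Hexp : forall r, Rpower a r = exp (- (r * L))).
{ intros r. unfold Rpower, L. f_equal. unfold Rdiv. rewrite Rmult_1_l, ln_Rinv by lra. ring. }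
assert (Hat := Rpower_gt_0 a t).
assert (HiL : 0 < / L) by now apply Rinv_0_lt_compat.
assert (Hmain : forall eps, 0 < eps < 1 ->
  norm (F t x) <= M * Rpower a (t + h) * norm x + (K + M * eps) * (/ L + eps) * Rpower a t).
{ intros eps Heps. destruct (is_log_npow x y Hlog eps) as [d [Hd HD]]; [lra|].
  assert (Hde : 0 < Rmin d eps) by (apply Rmin_glb_lt; lra).
  destruct (nfloor_ex (h / Rmin d eps)) as [N0 [_ HN0]]; [apply Rdiv_le_0_compat; lra|].
  (* The successor of the floor exceeds the quotient, hence [tau] is strictly below both [d] and
     [eps]. *)
  set (N := S N0). assert (HN : 0 < INR N) by (apply lt_0_INR; unfold N; lia).
  set (tau := h / INR N).
  assert (Htau : 0 < tau) by now apply Rdiv_lt_0_compat.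
  assert (Htau1 : tau < Rmin d eps).
  { unfold tau. apply Rlt_div_l; trivial. apply Rlt_div_l in HN0; trivial.
    unfold N. rewrite S_INR. lra. }
  assert (Htd : tau < d) by (eapply Rlt_le_trans; [exact Htau1|apply Rmin_l]).
  assert (Hte : tau < eps) by (eapply Rlt_le_trans; [exact Htau1|apply Rmin_r]).
  assert (HNt : INR N * tau = h) by (unfold tau; field; lra).
  (* From [exp (tau * L) >= 1 + tau * L]; the factor [/ L + tau] is exactly what makes the resulting
     bound an equality. The right-hand sides telescope. *)
  assert (Hgeo : forall r, tau * Rpower a r <= (/ L + tau) * (Rpower a r - Rpower a (r + tau))).
  { intros r. rewrite Rpower_plus.
    replace ((/ L + tau) * (Rpower a r - Rpower a r * Rpower a tau))
      with ((/ L + tau) * (1 - Rpower a tau) * Rpower a r) by ring.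
    apply Rmult_le_compat_r; [left; apply Rpower_gt_0|].
    rewrite Hexp, exp_Ropp.
    assert (He := exp_ineq1_le (tau * L)). assert (HtL : 0 < tau * L) by now apply Rmult_lt_0_compat.
    apply Rle_trans with ((/ L + tau) * (1 - / (1 + tau * L))).
    - right. field. split; lra.
    - apply Rmult_le_compat_l; [lra|]. apply Rplus_le_compat_l, Ropp_le_contravar.
      apply Rinv_le_contravar; lra. }
  assert (Hind : forall k, (k <= N)%nat ->
    norm (minus (F t x) (F (t + INR k * tau) x))
      <= (K + M * eps) * ((/ L + tau) * (Rpower a t - Rpower a (t + INR k * tau)))).
  { induction k as [|k IH]; intros Hk.
    - simpl INR. rewrite Rmult_0_l, Rplus_0_r, Rminus_diag, !Rmult_0_r.
      replace (minus (F t x) (F t x)) with (zero : X) by lin. right. exact norm_zero.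
    - assert (Hk1 : (k <= N)%nat) by lia. specialize (IH Hk1).
      assert (Hkt : INR k * tau + tau <= h).
      { replace (INR k * tau + tau) with (INR (S k) * tau) by (rewrite S_INR; ring).
        rewrite <- HNt. apply Rmult_le_compat_r; [lra|]. now apply le_INR. }
      assert (Hk0 : 0 <= INR k * tau) by (apply Rmult_le_pos; [apply pos_INR|lra]).
      set (r := t + INR k * tau) in *.
      assert (Hr : t <= r /\ r + tau <= t + h) by (unfold r; lra).
      replace (t + INR (S k) * tau) with (r + tau) by (unfold r; rewrite S_INR; ring).
      assert (Lr : is_linear (F r)) by (apply (df_linear _ _ _ _ _ HF); lra).
      set (rho := minus (minus (npow A tau x) x) (scal tau y)).
      assert (Hrho : norm rho <= eps * tau) by (apply HD; lra).
      assert (Es : minus (F r x) (F (r + tau) x) = opp (plus (F r rho) (scal tau (F r y)))).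
      { rewrite <- (df_npow _ _ _ _ _ HF) by lra. unfold rho.
        rewrite !(lin_minus (F r)), (lin_scal (F r)) by trivial. lin. }
      assert (Hs : norm (minus (F r x) (F (r + tau) x))
                   <= (K + M * eps) * ((/ L + tau) * (Rpower a r - Rpower a (r + tau)))).
      { rewrite Es. apply Rle_trans with ((K + M * eps) * (tau * Rpower a r)).
        - eapply Rle_trans; [right; exact (norm_opp _)|].
          eapply Rle_trans; [apply norm_plus_le|].
          assert (N1 : norm (F r rho) <= M * Rpower a r * (eps * tau)).
          { eapply Rle_trans; [apply (df_bound _ _ _ _ _ HF); lra|].
            apply Rmult_le_compat_l; trivial. apply Rmult_le_pos; trivial. left; apply Rpower_gt_0. }
          assert (N2 : norm (scal tau (F r y)) <= tau * (K * Rpower a r)).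
          { rewrite norm_scal_eq, Rabs_pos_eq by lra. apply Rmult_le_compat_l; [lra|]. apply HFy; lra. }
          lra.
        - apply Rmult_le_compat_l; [|apply Hgeo].
          apply Rplus_le_le_0_compat; trivial. apply Rmult_le_pos; lra. }
      eapply Rle_trans; [apply (norm_minus_trans (F r x))|]. lra. }
  specialize (Hind N (Nat.le_refl _)). rewrite HNt in Hind.
  eapply Rle_trans; [apply (norm_le_minus _ (F (t + h) x))|].
  apply Rplus_le_compat.
  - apply (df_bound _ _ _ _ _ HF); lra.
  - eapply Rle_trans; [exact Hind|]. rewrite Rmult_assoc. apply Rmult_le_compat_l.
    + apply Rplus_le_le_0_compat; trivial. apply Rmult_le_pos; lra.
    + assert (Hath := Rpower_gt_0 a (t + h)). apply Rmult_le_compat; try lra.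
      assert (Rpower a (t + h) <= Rpower a t) by (apply Rpower_exp_mono; lra). lra. }
apply le_epsilon. intros eta Heta.
(* Collects the coefficients of [eps] in [(K + M * eps) * (/ L + eps)], with [eps^2 <= eps]; the
   added 1 keeps [Q] positive. *)
set (Q := (K + M * / L + M) * Rpower a t + 1).
assert (HQ0 : 0 <= (K + M * / L + M) * Rpower a t).
{ apply Rmult_le_pos; [|lra]. assert (0 <= M * / L) by (apply Rmult_le_pos; lra). lra. }
assert (HQ : 0 < Q) by (unfold Q; lra).
set (eps := Rmin (1 / 2) (eta / Q)).
assert (Heps0 : 0 < eps) by (apply Rmin_glb_lt; [lra|now apply Rdiv_lt_0_compat]).
assert (Heps1 : eps <= 1 / 2) by apply Rmin_l.
assert (Heps2 : eps * Q <= eta).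
{ apply Rle_trans with (eta / Q * Q); [|right; field; lra].
  apply Rmult_le_compat_r; [lra|apply Rmin_r]. }
eapply Rle_trans; [apply (Hmain eps); lra|].
rewrite Rplus_assoc. apply Rplus_le_compat_l.
replace (K * Rpower a t / L) with (K * / L * Rpower a t) by (unfold Rdiv; ring).
apply Rle_trans with (K * / L * Rpower a t + eps * ((K + M * / L + M) * Rpower a t)).
- assert (He2 : M * eps * eps <= M * eps).
  { rewrite <- (Rmult_1_r (M * eps)) at 2. apply Rmult_le_compat_l; [apply Rmult_le_pos|]; lra. }
  replace ((K + M * eps) * (/ L + eps) * Rpower a t)
    with ((K * / L + eps * K + eps * M * / L + M * eps * eps) * Rpower a t) by ring.
  replace (K * / L * Rpower a t + eps * ((K + M * / L + M) * Rpower a t))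
    with ((K * / L + eps * K + eps * M * / L + M * eps) * Rpower a t) by ring.
  apply Rmult_le_compat_r; lra.
- apply Rplus_le_compat_l. unfold Q in Heps2. lra.
Qed.

(** Each logarithm needs exponents to the right of [t]. Half of the remaining gap up to [t1] is
    spent per step, so [t2] is quantified inside the induction, and before the constant, which does
    not depend on [a], [F], [N] or [x]. *)
Lemma decay_chain M t0 t1 n :
  0 <= M -> forall t2, t0 <= t2 < t1 -> exists C, 0 <= C /\
    forall a F N x t, 0 < a < 1 -> 0 <= N -> decay_family M t0 t1 a F -> log_chain A n N x ->
      t0 <= t <= t2 -> norm (F t x) <= C * N * Rpower a t / ln (1 / a) ^ n.
Proof.
intros HM. induction n as [|n IH]; intros t2 Ht2.
- exists M. split; trivial. intros a F N x t Ha HN HF [Hx _] Ht. simpl. rewrite Rdiv_1_r.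
  eapply Rle_trans; [apply (df_bound _ _ _ _ _ HF); lra|].
  replace (M * N * Rpower a t) with (M * Rpower a t * N) by ring.
  apply Rmult_le_compat_l; trivial. apply Rmult_le_pos; trivial. left; apply Rpower_gt_0.
- set (h := (t1 - t2) / 2). assert (Hh : 0 < h) by (unfold h; lra).
  destruct (IH (t2 + h)) as [C [HC HCF]]; [unfold h; lra|].
  destruct (pow_exp_bounded (S n) h Hh) as [E [HE HEL]].
  exists (M * E + C). split.
  { apply Rplus_le_le_0_compat; trivial. now apply Rmult_le_pos. }
  intros a F N x t Ha HN HF [Hx [y [Hy1 Hy2]]] Ht.
  set (L := ln (1 / a)).
  assert (HL : 0 < L).
  { unfold L. rewrite <- ln_1. apply ln_increasing; [lra|]. apply Rlt_div_r; lra. }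
  assert (HLn : 0 < L ^ n) by now apply pow_lt.
  assert (HLn1 : 0 < L ^ S n) by now apply pow_lt.
  assert (Hat := Rpower_gt_0 a t).
  eapply Rle_trans.
  { apply (decay_step M t0 t1 a F x y t h (C * N / L ^ n)); trivial; try lra.
    - apply Rdiv_le_0_compat; trivial. now apply Rmult_le_pos.
    - unfold h; lra.
    - intros r Hr. eapply Rle_trans; [apply (HCF a F N y r); trivial; lra|].
      fold L. right. field. lra. }
  fold L. rewrite Rpower_plus.
  (* The term at the far end [t + h] carries a surplus [a^h], which beats all [S n] powers of the
     logarithm at once. *)
  assert (Hah : L ^ S n * Rpower a h <= E).
  { eapply Rle_trans; [|apply (HEL L); lra]. right. f_equal. unfold Rpower, L. f_equal.
    unfold Rdiv. rewrite Rmult_1_l, ln_Rinv by lra. ring. }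
  replace ((M * E + C) * N * Rpower a t / L ^ S n)
    with (M * (E / L ^ S n) * Rpower a t * N + C * N / L ^ n * Rpower a t / L)
    by (simpl; field; split; lra).
  apply Rplus_le_compat_r. rewrite (Rmult_comm (Rpower a t)), <- Rmult_assoc.
  apply Rmult_le_compat; try lra.
  + repeat apply Rmult_le_pos; trivial; left; apply Rpower_gt_0.
  + exact (norm_ge_0 x).
  + apply Rmult_le_compat_r; [lra|]. apply Rmult_le_compat_l; trivial.
    apply Rle_div_r; trivial. lra.
Qed.

End Logarithm.

(** * Regularization *)

Lemma positive_type_resolvent_bound {X : CompleteNormedModule R_AbsRing} (A : X -> X) :
  positive_type A -> exists kappa, resolvent_bound A kappa.
Proof.
intros [HL [kappa [Hk H]]]. exists kappa.
split; trivial; intros a Ha; destruct (H a Ha) as [H1 [H2 H3]]; trivial.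
Qed.

Section Regularization.

Context {X : CompleteNormedModule R_AbsRing} {A : X -> X} {kappa : R}.
Context (HA : resolvent_bound A kappa).
Context {Reg : R -> X -> X} {e : R -> R} {p0 : Rbar}.
Context (hReg : regularization A Reg e p0).
Implicit Types (x u v : X).

Let A_linear : is_linear A := rb_linear A kappa HA.

Lemma residual_linear a : 0 < a -> is_linear (residual A Reg a).
Proof.
intros Ha. assert (LR := reg_linear A Reg e p0 hReg a Ha).
assert (L : is_linear (fun u => Reg a (A u))) by exact (is_linear_comp A (Reg a) A_linear LR).
destruct (linear_bound _ L) as [M [HM HB]]. split.
- intros x u. unfold residual.
  transitivity (minus (plus x u) (plus (Reg a (A x)) (Reg a (A u)))); [|lin].
  f_equal. exact (lin_plus _ x u L).
- intros k x. unfold residual.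
  transitivity (minus (scal (k : R) x) (scal (k : R) (Reg a (A x)))); [|lin].
  f_equal. exact (lin_scal _ k x L).
- exists (1 + M). split; [lra|]. intros x. unfold residual.
  eapply Rle_trans; [apply norm_minus_le|]. specialize (HB x). cbv beta in HB. lra.
Qed.

Lemma residual_commute a u : 0 < a -> residual A Reg a (A u) = A (residual A Reg a u).
Proof.
intros Ha. unfold residual. rewrite (lin_minus A) by trivial. f_equal.
now apply (reg_commute A Reg e p0 hReg).
Qed.

Lemma residual_frac_pow_bound a q x :
  0 < a -> 0 <= q -> Rbar_le q p0 ->
  norm (residual A Reg a (frac_pow A q x)) <= e q * Rpower a q * norm x.
Proof.
intros Ha Hq Hp.
apply (opnorm_bound (fun u => residual A Reg a (frac_pow A q u))).
- intros k u. assert (LS := residual_linear a Ha). assert (LF := frac_pow_linear HA q Hq).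
  now rewrite (lin_scal (frac_pow A q)), (lin_scal (residual A Reg a)).
- now apply (reg_saturation A Reg e p0 hReg).
Qed.

Lemma frac_pow_0 x : frac_pow A 0 x = x.
Proof.
replace 0 with (INR 0 + 0) by (simpl; ring). rewrite frac_pow_npow by lra.
unfold npow_coef, npow. destruct (Req_EM_T 0 0) as [_|H]; [simpl; lin|lra].
Qed.

Lemma residual_bound a x : Rbar_le 0 p0 -> 0 < a -> norm (residual A Reg a x) <= e 0 * norm x.
Proof.
intros Hp Ha. assert (H := residual_frac_pow_bound a 0 x Ha (Rle_refl 0) Hp).
rewrite frac_pow_0, Rpower_O in H by trivial. lra.
Qed.

Lemma residual_const_ge_0 : Rbar_le 0 p0 -> 0 <= e 0.
Proof.
intros Hp. apply (opnorm_ge_0 (fun u => residual A Reg 1 (frac_pow A 0 u))).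
assert (H := reg_saturation A Reg e p0 hReg 1 0 Rlt_0_1 (Rle_refl 0) Hp).
now rewrite Rpower_O, Rmult_1_r in H by lra.
Qed.

Lemma Reg_bound : exists M, 0 <= M /\ forall a x, 0 < a -> norm (Reg a x) <= M / a * norm x.
Proof.
destruct (reg_bound A Reg e p0 hReg) as [es Hes]. exists es. split.
- assert (H := opnorm_ge_0 _ _ (Hes 1 Rlt_0_1)). lra.
- intros a x Ha. apply opnorm_bound; auto. intros k u.
  apply lin_scal. now apply (reg_linear A Reg e p0 hReg).
Qed.

Lemma residual_log_decay q n :
  0 <= q -> Rbar_lt q p0 -> exists C, 0 <= C /\
    forall a x N, 0 < a < 1 -> 0 <= N -> log_chain A n N x ->
      norm (residual A Reg a (frac_pow A q x)) <= C * N * Rpower a q / ln (1 / a) ^ n.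
Proof.
intros Hq Hp. destruct (INR_floor q Hq) as [m [t0 [Eq Ht0]]].
(* The moving interval [[t0, t1]] has to end below 1, for the semigroup law, and at most at [p0]
   after adding [m], for the saturation bound. *)
assert (Ht1 : exists t1, t0 < t1 < 1 /\ Rbar_le (INR m + t1) p0).
{ destruct p0 as [r| |]; simpl in Hp.
  - exists (t0 + Rmin ((1 - t0) / 2) (r - q)).
    assert (H1 := Rmin_l ((1 - t0) / 2) (r - q)). assert (H2 := Rmin_r ((1 - t0) / 2) (r - q)).
    assert (H3 : 0 < Rmin ((1 - t0) / 2) (r - q)) by (apply Rmin_glb_lt; lra).
    simpl. lra.
  - exists ((1 + t0) / 2). simpl. split; trivial. lra.
  - contradiction. }
destruct Ht1 as [t1 [Ht1 Hmt1]].
destruct (reg_const_bounded A Reg e p0 hReg (INR m + 1)) as [Me HMe].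
(* Saturation bounds [npow_coef t] times the normalized power, so a positive lower bound on the
   coefficient, uniform over [[t0, t1]], is required. *)
destruct (npow_coef_lower t1 t1) as [_ Hcos]; [lra|lra|].
set (c0 := cos (PI * t1 / 2) / 4). assert (Hc0 : 0 < c0) by (unfold c0; lra).
assert (Hm := pos_INR m).
assert (Hsat : forall t, t0 <= t <= t1 -> Rbar_le (INR m + t) p0).
{ intros t Ht. apply Rbar_le_trans with (2 := Hmt1). simpl. lra. }
assert (HMe0 : 0 <= Me).
{ apply Rle_trans with (Rabs (e (INR m + t0))); [apply Rabs_pos|]. apply HMe; [lra|]. apply Hsat; lra. }
destruct (decay_chain (A := A) (Me / c0) t0 t1 n) with (t2 := t0) as [C [HC HCF]];
  [apply Rdiv_le_0_compat; lra|lra|].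
exists (Rabs (npow_coef t0) * C). split; [apply Rmult_le_pos; trivial; apply Rabs_pos|].
intros a x N Ha HN Hx.
assert (LS := residual_linear a ltac:(lra)).
assert (Ham := Rpower_gt_0 a (INR m)).
set (F := fun t z => scal (/ Rpower a (INR m)) (residual A Reg a (npow A t (Nat.iter m A z)))).
assert (HF : decay_family (A := A) (Me / c0) t0 t1 a F).
{ split.
  - intros t Ht.
    apply (is_linear_comp (fun z => residual A Reg a (npow A t (Nat.iter m A z)))
             (fun u => scal (/ Rpower a (INR m)) u)).
    + apply (is_linear_comp (fun z => npow A t (Nat.iter m A z)) (residual A Reg a)); trivial.
      apply (is_linear_comp (Nat.iter m A) (npow A t)).
      * apply (iter_linear HA).
      * apply (npow_linear HA). lra.
    + apply (is_linear_scal_r (V := X)). exact Rmult_comm.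
  - intros t h z Ht Hh Hth. unfold F. f_equal. f_equal.
    transitivity (npow A t (npow A h (Nat.iter m A z))); [|apply (npow_plus HA); lra].
    f_equal. apply (npow_commute HA (Nat.iter m A)); [apply (iter_linear HA)| |lra].
    intros u. symmetry. now apply iter_commute.
  - intros t z Ht. unfold F. rewrite norm_scal_eq, Rabs_pos_eq by (left; now apply Rinv_0_lt_compat).
    destruct (npow_coef_lower t t1) as [Hct _]; [lra|lra|]. fold c0 in Hct.
    assert (Hb := residual_frac_pow_bound a (INR m + t) z ltac:(lra) ltac:(lra) (Hsat t Ht)).
    rewrite frac_pow_npow, (lin_scal (residual A Reg a)), norm_scal_eq, Rabs_pos_eq, Rpower_plus in Hb
      by (trivial; lra).
    assert (He := HMe (INR m + t) ltac:(lra) (Hsat t Ht)).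
    assert (Hat := Rpower_gt_0 a t). assert (Hz : 0 <= norm z) by exact (norm_ge_0 z).
    set (nr := norm (residual A Reg a (npow A t (Nat.iter m A z)))) in *.
    assert (Hnr : 0 <= nr) by exact (norm_ge_0 _).
    assert (H1 : c0 * nr <= Me * (Rpower a (INR m) * Rpower a t) * norm z).
    { apply Rle_trans with (npow_coef t * nr); [now apply Rmult_le_compat_r|].
      eapply Rle_trans; [exact Hb|]. apply Rmult_le_compat_r; trivial.
      apply Rmult_le_compat_r; [left; now apply Rmult_lt_0_compat|].
      apply Rle_trans with (2 := He). apply Rle_abs. }
    apply Rmult_le_reg_l with (c0 * Rpower a (INR m)); [now apply Rmult_lt_0_compat|].
    replace (c0 * Rpower a (INR m) * (/ Rpower a (INR m) * nr)) with (c0 * nr) by (field; lra).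
    replace (c0 * Rpower a (INR m) * (Me / c0 * Rpower a t * norm z))
      with (Me * (Rpower a (INR m) * Rpower a t) * norm z) by (field; lra). trivial. }
assert (H := HCF a F N x t0 Ha HN HF Hx ltac:(lra)).
unfold F in H. rewrite norm_scal_eq, Rabs_pos_eq in H by (left; now apply Rinv_0_lt_compat).
rewrite Eq, frac_pow_npow, (lin_scal (residual A Reg a)), norm_scal_eq, Rpower_plus by trivial.
replace (Rabs (npow_coef t0) * C * N * (Rpower a (INR m) * Rpower a t0) / ln (1 / a) ^ n)
  with (Rabs (npow_coef t0) * (Rpower a (INR m) * (C * N * Rpower a t0 / ln (1 / a) ^ n)))
  by (unfold Rdiv; ring).
apply Rmult_le_compat_l; [apply Rabs_pos|].
apply Rmult_le_reg_l with (/ Rpower a (INR m)); [now apply Rinv_0_lt_compat|].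
rewrite <- (Rmult_assoc (/ _)), Rinv_l, Rmult_1_l by lra. trivial.
Qed.

End Regularization.

(** * Critical parameter and convergence rate *)

Lemma ln_inv a : 0 < a -> ln (1 / a) = - ln a.
Proof. intros Ha. unfold Rdiv. rewrite Rmult_1_l. now apply ln_Rinv. Qed.

Lemma ln_inv_pos a : 0 < a < 1 -> 0 < ln (1 / a).
Proof. intros Ha. rewrite <- ln_1. apply ln_increasing; [lra|]. apply Rlt_div_r; lra. Qed.

Section Rates.

Context (k : R) (nu : nat) (hk : 1 <= k).

(* The critical parameter size, solving [b^k = delta (ln (1/delta))^nu]. *)
Definition crit (d : R) : R := Rpower d (1 / k) * Rpower (ln (1 / d)) (INR nu / k).

(** For [k = p + 1] this is the claimed rate. It is both [d / crit d], the size of the noise term at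
    the critical parameter, and [crit d ^ (k-1) / (ln (1/d))^nu], the size of the approximation
    error there. *)
Definition rate (d : R) : R := Rpower d ((k - 1) / k) * Rpower (ln (1 / d)) (- (INR nu / k)).

Lemma crit_gt_0 d : 0 < crit d.
Proof. apply Rmult_lt_0_compat; apply Rpower_gt_0. Qed.

Lemma rate_gt_0 d : 0 < rate d.
Proof. apply Rmult_lt_0_compat; apply Rpower_gt_0. Qed.

Lemma crit_rate d : 0 < d < 1 -> d = rate d * crit d.
Proof.
intros Hd. unfold rate, crit.
transitivity (Rpower d ((k - 1) / k + 1 / k) * Rpower (ln (1 / d)) (- (INR nu / k) + INR nu / k)).
- replace ((k - 1) / k + 1 / k) with 1 by (field; lra).
  replace (- (INR nu / k) + INR nu / k) with 0 by ring.
  rewrite Rpower_1, Rpower_O; [ring|now apply ln_inv_pos|lra].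
- rewrite !Rpower_plus. ring.
Qed.

Lemma crit_power d : 0 < d < 1 -> Rpower (crit d) k = d * ln (1 / d) ^ nu.
Proof.
intros Hd. unfold crit. rewrite <- Rpower_mult_distr by apply Rpower_gt_0.
rewrite !Rpower_mult.
replace (1 / k * k) with 1 by (field; lra). replace (INR nu / k * k) with (INR nu) by (field; lra).
rewrite Rpower_1, Rpower_pow; [trivial|now apply ln_inv_pos|lra].
Qed.

Lemma crit_power_rate d : 0 < d < 1 -> Rpower (crit d) (k - 1) = rate d * ln (1 / d) ^ nu.
Proof.
intros Hd. assert (Hc := crit_gt_0 d).
apply Rmult_eq_reg_l with (crit d); [|lra].
rewrite <- Rpower_sub_1, crit_power by trivial. rewrite (crit_rate d) at 1 by trivial. ring.
Qed.

(** Half of the factor [d] in [crit d ^ k = d (ln (1/d))^nu] absorbs the logarithm. The power of [d]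
    that remains is what makes [ln (1/a)] comparable to [ln (1/d)] for parameters below it. *)
Lemma crit_small : exists C, 0 < C /\ forall d, 0 < d < 1 -> crit d <= C * Rpower d (1 / (2 * k)).
Proof.
destruct (pow_exp_bounded nu (1 / 2)) as [E [HE HEL]]; [lra|].
exists (Rpower (E + 1) (1 / k)). split; [apply Rpower_gt_0|]. intros d Hd.
assert (HL := ln_inv_pos d Hd). assert (Hd2 := Rpower_gt_0 d (1 / 2)).
assert (HLn : 0 < ln (1 / d) ^ nu) by now apply pow_lt.
assert (Hs : ln (1 / d) ^ nu * Rpower d (1 / 2) <= E).
{ eapply Rle_trans; [|apply (HEL (ln (1 / d))); lra]. right. f_equal. unfold Rpower. f_equal.
  rewrite ln_inv by lra. field. }
replace (crit d) with (Rpower (ln (1 / d) ^ nu * Rpower d (1 / 2) * Rpower d (1 / 2)) (1 / k)).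
- rewrite <- Rpower_mult_distr by (trivial; now apply Rmult_lt_0_compat).
  replace (Rpower (Rpower d (1 / 2)) (1 / k)) with (Rpower d (1 / (2 * k)))
    by (rewrite Rpower_mult; f_equal; field; lra).
  apply Rmult_le_compat_r; [left; apply Rpower_gt_0|].
  apply Rle_Rpower_l; [apply Rdiv_le_0_compat; lra|]. split; [now apply Rmult_lt_0_compat|lra].
- replace (ln (1 / d) ^ nu * Rpower d (1 / 2) * Rpower d (1 / 2)) with (Rpower (crit d) k).
  + rewrite Rpower_mult. replace (k * (1 / k)) with 1 by (field; lra).
    apply Rpower_1, crit_gt_0.
  + rewrite crit_power by trivial. rewrite Rmult_assoc, <- Rpower_plus.
    replace (1 / 2 + 1 / 2) with 1 by field. rewrite Rpower_1 by lra. ring.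
Qed.

Lemma ln_inv_lower a d : 0 < d < 1 -> 0 < a <= Rpower d (1 / (2 * k)) ->
  a < 1 /\ ln (1 / d) / (2 * k) <= ln (1 / a).
Proof.
intros Hd Ha. assert (HL := ln_inv_pos d Hd).
assert (H1k : 0 < 1 / (2 * k)) by (apply Rdiv_lt_0_compat; lra).
rewrite ln_inv in HL by lra.
assert (Hln : ln a <= 1 / (2 * k) * ln d).
{ unfold Rpower in Ha. rewrite <- (ln_exp (1 / (2 * k) * ln d)). apply ln_le; lra. }
split.
- apply ln_lt_inv; try lra. rewrite ln_1. nra.
- rewrite !ln_inv by lra.
  replace (- ln d / (2 * k)) with (- (1 / (2 * k) * ln d)) by (field; lra). lra.
Qed.

(** Trades the logarithm of the parameter for that of the noise level, at the cost of the factor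
    [(2 * k)^nu]. *)
Lemma log_quotient a d w : 0 < d < 1 -> 0 < a <= Rpower d (1 / (2 * k)) -> 0 <= w ->
  w / ln (1 / a) ^ nu <= (2 * k) ^ nu * w / ln (1 / d) ^ nu.
Proof.
intros Hd Ha Hw. destruct (ln_inv_lower a d Hd Ha) as [Ha1 Hl].
assert (HL := ln_inv_pos d Hd). assert (HLa := ln_inv_pos a ltac:(lra)).
assert (HLn : 0 < ln (1 / d) ^ nu) by now apply pow_lt.
assert (HLan : 0 < ln (1 / a) ^ nu) by now apply pow_lt.
assert (H2k : 0 < (2 * k) ^ nu) by (apply pow_lt; lra).
replace ((2 * k) ^ nu * w / ln (1 / d) ^ nu) with (w * / (ln (1 / d) / (2 * k)) ^ nu).
- apply Rmult_le_compat_l; trivial. apply Rinv_le_contravar.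
  + apply pow_lt. apply Rdiv_lt_0_compat; lra.
  + apply pow_incr. split; trivial. apply Rdiv_le_0_compat; lra.
- unfold Rdiv at 1. rewrite Rpow_mult_distr, pow_inv. field. lra.
Qed.

End Rates.

(** * Interpolation estimate and lower bound for the parameter *)

Section Interpolation.

Context {X : CompleteNormedModule R_AbsRing} {A : X -> X} {kappa : R}.
Context (HA : resolvent_bound A kappa).
Context {Reg : R -> X -> X} {e : R -> R} {p0 : Rbar}.
Context (hReg : regularization A Reg e p0).
Context (p : R) (nu : nat) (hp : 0 <= p) (hp0 : Rbar_lt (p + 1) p0).

Let A_linear : is_linear A := rb_linear A kappa HA.

(* Split [A^p x] with the regularization operator at the critical parameter. *)
Lemma log_interpolation N D :
  0 <= N -> 0 <= D -> exists C, 0 <= C /\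
    forall d (x : X), 0 < d < 1 -> log_chain A nu N x ->
      norm (A (frac_pow A p x)) <= D * d -> norm (frac_pow A p x) <= C * rate (p + 1) nu d.
Proof.
intros HN HD. set (k := p + 1). assert (Hk : 1 <= k) by (unfold k; lra).
destruct (crit_small k nu Hk) as [C1 [HC1 HC1d]].
destruct (Reg_bound hReg) as [es [Hes HReg]].
destruct (residual_log_decay HA hReg p nu hp) as [C2 [HC2 HC2a]].
{ apply Rbar_lt_trans with (2 := hp0). simpl. lra. }
assert (H2k : 0 < (2 * k) ^ nu) by (apply pow_lt; lra).
exists (C2 * N * (2 * k) ^ nu * Rpower (/ C1) p + es * C1 * D). split.
{ apply Rplus_le_le_0_compat; repeat apply Rmult_le_pos; try lra. left; apply Rpower_gt_0. }
intros d x Hd Hx HAx. set (y := frac_pow A p x) in *.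
assert (Hc := crit_gt_0 k nu d). assert (Hr := rate_gt_0 k nu d).
(* Dividing by [C1] brings the critical parameter below [d^(1/(2k))], hence below 1, where
   [log_quotient] applies. *)
set (b := crit k nu d / C1). assert (Hb : 0 < b) by now apply Rdiv_lt_0_compat.
assert (Hb2 : b <= Rpower d (1 / (2 * k))).
{ unfold b. apply Rle_div_l; trivial. rewrite Rmult_comm. now apply HC1d. }
destruct (ln_inv_lower k Hk b d Hd (conj Hb Hb2)) as [Hb1 _].
assert (HL := ln_inv_pos d Hd). assert (HLn : 0 < ln (1 / d) ^ nu) by now apply pow_lt.
replace y with (plus (residual A Reg b y) (Reg b (A y))) by (unfold residual; lin).
eapply Rle_trans; [apply norm_plus_le|]. rewrite Rmult_plus_distr_r.
apply Rplus_le_compat.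
- eapply Rle_trans; [apply (HC2a b x N); trivial; lra|].
  assert (Hbp := Rpower_gt_0 b p).
  eapply Rle_trans.
  { apply (log_quotient k nu Hk b d); trivial; [now split|]. repeat apply Rmult_le_pos; lra. }
  right. unfold b at 1. unfold Rdiv at 2.
  rewrite <- (Rpower_mult_distr (crit k nu d)) by (trivial; now apply Rinv_0_lt_compat).
  replace p with (k - 1) at 1 by (unfold k; ring).
  rewrite crit_power_rate by trivial. field. lra.
- eapply Rle_trans; [now apply HReg|].
  apply Rle_trans with (es / b * (D * d)).
  { apply Rmult_le_compat_l; trivial. now apply Rdiv_le_0_compat. }
  right. rewrite (crit_rate k nu Hk d Hd) at 1. unfold b. field. lra.
Qed.

(** A parameter above [d^(1/(2k))] already exceeds a multiple of [crit] by [crit_small]. Below that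
    threshold the decay gives [K d <= Q a^k / (ln (1/d))^nu], that is, [a^k] is at least [K / Q]
    times [crit^k]. *)
Lemma residual_lower_bound N K :
  0 <= N -> 0 < K -> exists c, 0 < c /\
    forall d a (x : X), 0 < d < 1 -> 0 < a -> log_chain A nu N x ->
      K * d <= norm (residual A Reg a (frac_pow A (p + 1) x)) -> c * crit (p + 1) nu d <= a.
Proof.
intros HN HK. set (k := p + 1). assert (Hk : 1 <= k) by (unfold k; lra).
destruct (crit_small k nu Hk) as [C1 [HC1 HC1d]].
destruct (residual_log_decay HA hReg k nu ltac:(lra) hp0) as [C2 [HC2 HC2a]].
assert (H2k : 0 < (2 * k) ^ nu) by (apply pow_lt; lra).
set (Q := C2 * N * (2 * k) ^ nu + 1).
assert (HQ0 : 0 <= C2 * N * (2 * k) ^ nu) by (repeat apply Rmult_le_pos; lra).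
assert (HQ : 0 < Q) by (unfold Q; lra).
assert (HKQ : 0 < K / Q) by now apply Rdiv_lt_0_compat.
exists (Rmin (/ C1) (Rpower (K / Q) (1 / k))). split.
{ apply Rmin_glb_lt; [now apply Rinv_0_lt_compat|apply Rpower_gt_0]. }
intros d a x Hd Ha Hx Hle. assert (Hc := crit_gt_0 k nu d).
destruct (Rle_dec (Rpower d (1 / (2 * k))) a) as [Hda|Hda].
- apply Rle_trans with (/ C1 * crit k nu d).
  + apply Rmult_le_compat_r; [lra|apply Rmin_l].
  + apply Rle_trans with (2 := Hda). apply Rmult_le_reg_l with C1; trivial.
    rewrite <- Rmult_assoc, Rinv_r, Rmult_1_l by lra. now apply HC1d.
- assert (Ha2 : 0 < a <= Rpower d (1 / (2 * k))) by lra.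
  destruct (ln_inv_lower k Hk a d Hd Ha2) as [Ha1 _].
  assert (HL := ln_inv_pos d Hd). assert (HLn : 0 < ln (1 / d) ^ nu) by now apply pow_lt.
  assert (Hak := Rpower_gt_0 a k).
  assert (H1 : K * d <= Q * Rpower a k / ln (1 / d) ^ nu).
  { eapply Rle_trans; [exact Hle|]. eapply Rle_trans; [apply (HC2a a x N); trivial; lra|].
    eapply Rle_trans.
    { apply (log_quotient k nu Hk a d); trivial. repeat apply Rmult_le_pos; lra. }
    apply Rmult_le_compat_r; [left; now apply Rinv_0_lt_compat|].
    replace ((2 * k) ^ nu * (C2 * N * Rpower a k)) with (C2 * N * (2 * k) ^ nu * Rpower a k) by ring.
    apply Rmult_le_compat_r; unfold Q; lra. }
  assert (H2 : K / Q * Rpower (crit k nu d) k <= Rpower a k).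
  { rewrite crit_power by trivial.
    apply Rmult_le_reg_l with (Q / ln (1 / d) ^ nu); [now apply Rdiv_lt_0_compat|].
    replace (Q / ln (1 / d) ^ nu * (K / Q * (d * ln (1 / d) ^ nu))) with (K * d) by (field; lra).
    replace (Q / ln (1 / d) ^ nu * Rpower a k) with (Q * Rpower a k / ln (1 / d) ^ nu)
      by (unfold Rdiv; ring). trivial. }
  apply Rle_trans with (Rpower (K / Q) (1 / k) * crit k nu d).
  { apply Rmult_le_compat_r; [lra|apply Rmin_r]. }
  assert (Hroot : forall z, 0 < z -> Rpower (Rpower z k) (1 / k) = z).
  { intros z Hz. rewrite Rpower_mult. replace (k * (1 / k)) with 1 by (field; lra). now apply Rpower_1. }
  rewrite <- (Hroot a Ha), <- (Hroot (crit k nu d) Hc).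
  rewrite Rpower_mult_distr by (trivial; apply Rpower_gt_0).
  apply Rle_Rpower_l; [apply Rdiv_le_0_compat; lra|]. split; trivial.
  apply Rmult_lt_0_compat; trivial. apply Rpower_gt_0.
Qed.

End Interpolation.

(** * Convergence under the discrepancy principle *)

Theorem theorem10
  (X : CompleteNormedModule R_AbsRing) (A : X -> X)
  (hA : positive_type A) (hinj : Injective A) (hunb : unbounded_inverse A)
  (Reg : R -> X -> X) (e : R -> R) (p0 : Rbar) (hp0 : Rbar_lt 1 p0)
  (hReg : regularization A Reg e p0)
  (hcont : forall (u : X) (a : R), 0 < a ->
     continuous (fun b : R => residual A Reg b u) a)
  (f udag ubar : X) (hf : A udag = f)
  (p : R) (hp : 0 <= p) (hp' : Rbar_lt p (Rbar_minus p0 1))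
  (nu : nat) (hnu : (1 <= nu)%nat)
  (v : X) (hv : dom_log_iter A nu v) (hsource : minus ubar udag = frac_pow A p v)
  (delta0 : R) (hdelta0 : 0 < delta0 < 1)
  (b0 b1 : R) (hb0 : b0 > e 0) (hb1 : b1 >= b0) :
  exists c c' : R, 0 < c /\ 0 < c' /\
    forall (delta : R) (fd : X) (alpha : Rbar),
      0 < delta <= delta0 ->
      norm (minus f fd) <= delta ->
      Rbar_lt 0 alpha ->
      discrepancy A Reg b0 b1 ubar fd delta alpha ->
      norm (minus (reg_element A Reg ubar fd alpha) udag)
        <= c * Rpower delta (p / (p + 1))
             * Rpower (ln (1 / delta)) (- (INR nu / (p + 1))) /\
      Rbar_le (c' * Rpower delta (1 / (p + 1))
                  * Rpower (ln (1 / delta)) (INR nu / (p + 1))) alpha.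
Proof.
destruct (positive_type_resolvent_bound A hA) as [kappa HA].
assert (LA := rb_linear A kappa HA).
assert (hpp : Rbar_lt (p + 1) p0).
{ destruct p0 as [r| |]; simpl in hp' |- *; trivial. lra. }
assert (H0p : Rbar_le 0 p0).
{ apply Rbar_lt_le, Rbar_lt_trans with (2 := hp0). simpl. lra. }
assert (He0 := residual_const_ge_0 hReg H0p).
destruct (dom_log_iter_chain nu v hv) as [N [HN Hv]].
(* Covers both vectors to which the interpolation is applied: [v] itself when the parameter is
   infinite, and [S_a v], whose chain is bounded by [e 0 * N]. *)
set (N1 := (1 + e 0) * N).
assert (HN1 : 0 <= N1) by (apply Rmult_le_pos; lra).
(* The constant [b1 + e 0 + 1] dominates [b1 + 1], from the infinite parameter, and [b1 + e 0], from
   a finite one. *)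
destruct (log_interpolation HA hReg p nu hp hpp N1 (b1 + e 0 + 1)) as [C [HC HCi]];
  [trivial|lra|].
(* The gap [b0 - e 0] is what remains of the defect after its noise part, at most [e 0 * delta], is
   removed. *)
destruct (residual_lower_bound HA hReg p nu hp hpp N (b0 - e 0)) as [c' [Hc' Hlow]];
  [lra|lra|].
destruct (Reg_bound hReg) as [es [Hes HRegb]].
exists (C + es / c' + 1), c'.
assert (Hesc : 0 <= es / c') by now apply Rdiv_le_0_compat.
split; [lra|]. split; trivial.
intros d fd alpha Hd Hfd Halpha [Hinf Hfin].
assert (Hd1 : 0 < d < 1) by lra.
assert (Hr := rate_gt_0 (p + 1) nu d). assert (Hcr := crit_gt_0 (p + 1) nu d).
assert (Erate : rate (p + 1) nu d
          = Rpower d (p / (p + 1)) * Rpower (ln (1 / d)) (- (INR nu / (p + 1)))).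
{ unfold rate. do 2 f_equal. field. lra. }
rewrite !Rmult_assoc, <- Erate. fold (crit (p + 1) nu d).
set (w := minus (A ubar) fd) in *. set (u0 := frac_pow A p v) in *.
assert (Hw : w = plus (A u0) (minus f fd)).
{ unfold w. rewrite <- hsource, (lin_minus A), hf by trivial. lin. }
destruct (Rle_dec (norm w) (b1 * d)) as [Hle|Hgt].
- rewrite (Hinf Hle). split; [|exact I]. simpl. rewrite hsource. fold u0.
  apply Rle_trans with (C * rate (p + 1) nu d).
  + apply HCi; trivial.
    * apply log_chain_le with N; trivial. unfold N1. nra.
    * replace (A (frac_pow A p v)) with (minus w (minus f fd)) by (rewrite Hw; unfold u0; lin).
      eapply Rle_trans; [apply norm_minus_le|]. nra.
  + apply Rmult_le_compat_r; lra.
- destruct (Hfin ltac:(lra)) as [_ [Hai [Hdl Hdu]]].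
  destruct alpha as [a| |]; simpl in Halpha, Hai; try contradiction.
  assert (LS := residual_linear HA hReg a Halpha).
  assert (LR := reg_linear A Reg e p0 hReg a Halpha).
  (* Commutation of [R_a] with [A] gives defect [= S_a w], and [w = A u0 + (f - fd)] separates the
     source from the noise. *)
  assert (Hdef : defect A Reg ubar fd a
            = plus (residual A Reg a (frac_pow A (p + 1) v)) (residual A Reg a (minus f fd))).
  { rewrite (frac_pow_A HA) by trivial. fold u0.
    rewrite <- (lin_plus (residual A Reg a)), <- Hw by trivial.
    unfold defect, residual, reg_element. fold w.
    rewrite (reg_commute A Reg e p0 hReg), (lin_minus A) by trivial. unfold w. lin. }
  assert (Hnoise : norm (residual A Reg a (minus f fd)) <= e 0 * d).
  { eapply Rle_trans; [now apply (residual_bound HA hReg)|]. now apply Rmult_le_compat_l. }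
  assert (Hlo : (b0 - e 0) * d <= norm (residual A Reg a (frac_pow A (p + 1) v))).
  { rewrite Hdef in Hdl. assert (H := norm_plus_le (residual A Reg a (frac_pow A (p + 1) v))
      (residual A Reg a (minus f fd))). lra. }
  assert (Hup : norm (residual A Reg a (frac_pow A (p + 1) v)) <= (b1 + e 0) * d).
  { rewrite Hdef in Hdu.
    replace (residual A Reg a (frac_pow A (p + 1) v))
      with (minus (plus (residual A Reg a (frac_pow A (p + 1) v)) (residual A Reg a (minus f fd)))
              (residual A Reg a (minus f fd))) by lin.
    eapply Rle_trans; [apply norm_minus_le|]. lra. }
  assert (Ha := Hlow d a v Hd1 Halpha Hv Hlo).
  split; [|exact Ha].
  simpl reg_element. fold w.
  (* Error decomposition: [S_a u0] is the approximation error, handled by interpolation, and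
     [R_a (f - fd)] the noise, handled by the lower bound on [a]. *)
  replace (minus (minus ubar (Reg a w)) udag)
    with (minus (residual A Reg a u0) (Reg a (minus f fd))).
  2:{ rewrite Hw, (lin_plus (Reg a)) by trivial. unfold residual. fold u0 in hsource.
      rewrite <- hsource at 1. lin. }
  eapply Rle_trans; [apply norm_minus_le|].
  apply Rle_trans with (C * rate (p + 1) nu d + es / c' * rate (p + 1) nu d);
    [apply Rplus_le_compat|nra].
  + unfold u0. rewrite (frac_pow_commute HA (residual A Reg a));
      [|trivial|intros u; now apply (residual_commute HA hReg)|trivial].
    apply HCi; trivial.
    * apply log_chain_le with (e 0 * N); [unfold N1; nra|].
      apply (log_chain_commute HA); trivial.
      -- intros u. now apply (residual_commute HA hReg).
      -- intros u. now apply (residual_bound HA hReg).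
    * rewrite <- (frac_pow_A HA), <- (frac_pow_commute HA (residual A Reg a));
        [| trivial|intros u; now apply (residual_commute HA hReg)|lra|trivial].
      eapply Rle_trans; [exact Hup|]. nra.
  + eapply Rle_trans; [now apply HRegb|].
    apply Rle_trans with (es / a * d).
    { apply Rmult_le_compat_l; trivial. now apply Rdiv_le_0_compat. }
    apply Rle_trans with (es / (c' * crit (p + 1) nu d) * d).
    * apply Rmult_le_compat_r; [lra|]. apply Rmult_le_compat_l; trivial.
      apply Rinv_le_contravar; trivial. now apply Rmult_lt_0_compat.
    * right. rewrite (crit_rate (p + 1) nu ltac:(lra) d Hd1) at 2. field. lra.
Qed.
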